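(* Let $V\subset(\mathbb{C}^* )^n$ be a complex algebraic hypersurface and let $x$ be a regular point in $\mathrm{Critv}(\mathrm{Log}_{|V})$ with $\mathrm{Log}^{-1}(x)\cap V\subset \mathrm{Critp}(\mathrm{Log}_{|V})$. Let $v_1(x),\ldots,v_s(x)$ be the inward normal vectors of the branches of critical values through $x$, as defined in the context. Then the convex hull of the vectors $\{v_i(x)\}_{i=1}^s$ does not contain the origin if and only if $x\in\partial\mathscr{A}(V)$. In other words, the convex hull of the vectors $\{v_i(x)\}_{i=1}^s$ contains the origin if and only if $x$ is contained in the interior of the amoeba $\mathscr{A}(V)$.
   Context: The map $\mathrm{Log}:(\mathbb{C}^* )^n\to\mathbb{R}^n$ is $\mathrm{Log}(z_1,\ldots,z_n)=(\log|z_1|,\ldots,\log|z_n|)$, the amoeba of $V$ is $\mathscr{A}(V)=\mathrm{Log}(V)$, and $\partial\mathscr{A}(V)$ is its topological boundary in $\mathbb{R}^n$. $V$ is defined by a polynomial $f$; $V$ may be singular, but only smooth points of $V$ are considered, i.e. the points of $\mathrm{Log}^{-1}(x)\cap V$ are assumed to be smooth points of $V$. $\mathrm{Critp}(\mathrm{Log}_{|V})$ is the set of critical points of $\mathrm{Log}_{|V}$ (points of $V$ where the real Jacobian of $\mathrm{Log}_{|V}$ has rank less than $n$), and $\mathrm{Critv}(\mathrm{Log}_{|V})=\mathrm{Log}(\mathrm{Critp}(\mathrm{Log}_{|V}))$ is the set of critical values. The logarithmic Gauss map is $\gamma:V\to\mathbb{CP}^{n-1}$, $\gamma(z)=[z_1\frac{\partial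 f}{\partial z_1}(z):\cdots:z_n\frac{\partial f}{\partial z_n}(z)]$. A point $x\in\mathrm{Critv}(\mathrm{Log}_{|V})$ is called regular if $\mathrm{Log}^{-1}(x)\cap V$ contains no critical point of $\gamma$. For a regular point $x$, let $\mathscr{B}_1(x),\ldots,\mathscr{B}_s(x)$ be the local holomorphic branches of $V$ whose images under $\mathrm{Log}$ contain $x$ (small pieces of $V$ around the points of $\mathrm{Log}^{-1}(x)\cap V$), and let $\mathscr{C}_i(x)=\mathrm{Log}(\mathscr{B}_i(x)\cap\mathrm{Critp}(\mathrm{Log}_{|V}))$ be the corresponding real branches of critical values passing through $x$ ($\mathscr{C}_i(x)$ is empty if $\mathscr{B}_i(x)$ does not meet $\mathrm{Critp}(\mathrm{Log}_{|V})$). Standing assumption: every nonempty $\mathscr{C}_i(x)$ has dimension $n-1$. The vector $v_i(x)$ is the normal vector at $x$ to $\mathscr{C}_i(x)$ (if nonempty) pointing inside the local amoeba $\mathscr{A}(\mathscr{B}_i(x))=\mathrm{Log}(\mathscr{B}_i(x))$; the setting takes for granted that such a normal vector exists. *)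

(* Defs.v *)
From HB Require Import structures.
From mathcomp Require Import all_boot all_order all_algebra.
From mathcomp Require Import all_classical all_reals all_analysis.
From mathcomp Require Import complex.
(* The notations of [mpoly] clash with those of MathComp-Analysis. *)
From mathcomp Require Import -(notations) mpoly.

Set Implicit Arguments.
Unset Strict Implicit.
Unset Printing Implicit Defensive.

Import Order.TTheory GRing.Theory Num.Theory.
Import numFieldNormedType.Exports.

Local Open Scope classical_set_scope.
Local Open Scope ring_scope.

(* Typing R[i] as a [numFieldType] gives C, and C^n = 'rV_n, the topology
   induced by the modulus; the bare R[i] carries no topology. *)
Definition Cx (R : realType) : numFieldType := R[i].

Section Amoebas.
Context {R : realType} {n : nat}.
Implicit Types (f : mpoly n (Cx R)) (z p : 'rV[Cx R]_n) (x v w : 'rV[R]_n).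
Implicit Types (U : set 'rV[Cx R]_n) (A C : set 'rV[R]_n).

Definition torus : set 'rV[Cx R]_n := [set z | forall j, z 0 j != 0].

Definition hypersurface f : set 'rV[Cx R]_n :=
  [set z | torus z /\ meval (z 0) f = 0].

Definition Log z : 'rV[R]_n := \row_j ln (Normc.normc (z 0 j)).

Definition amoeba f : set 'rV[R]_n := Log @` hypersurface f.

Definition boundary A : set 'rV[R]_n := closure A `\` A°.

Definition fibre f x : set 'rV[Cx R]_n := hypersurface f `&` Log @^-1` [set x].

Definition grad f z : 'rV[Cx R]_n := \row_j meval (z 0) (mderiv j f).

Definition smooth_point f z : Prop := hypersurface f z /\ grad f z != 0.

(* The row space of this matrix is T_z V, the kernel of df at z. *)
Definition tangent_space f z : 'M[Cx R]_n := kermx (grad f z)^T.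

(* C^n is identified with R^(2n) by (a, b) |-> a + i b. *)
Definition of_real_coord (u : 'rV[R]_(n + n)) : 'rV[Cx R]_n :=
  \row_j (Complex (u 0 (lshift n j)) (u 0 (rshift n j)) : Cx R).

Definition real_coord m (T : 'M[Cx R]_(m, n)) : 'M[R]_(m, n + n) :=
  row_mx (map_mx (@complex.Re R) T) (map_mx (@complex.Im R) T).

(* The rows of T and of iT span the complex row space of T over the reals. *)
Definition real_span m (T : 'M[Cx R]_(m, n)) : 'M[R]_(m + m, n + n) :=
  col_mx (real_coord T) (real_coord ((Complex 0 1 : Cx R) *: T)).

(* d(Log|V) at z: row i is the image under dLog of the i-th of a family of
   vectors spanning T_z V over the reals. *)
Definition Log_jacobian f z : 'M[R]_(n + n, n) :=
  real_span (tangent_space f z)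
    *m jacobian (Log \o of_real_coord) (real_coord z).

Definition Critp f : set 'rV[Cx R]_n :=
  [set z | smooth_point f z /\ (\rank (Log_jacobian f z) < n)%N].

Definition Critv f : set 'rV[R]_n := Log @` Critp f.

(* The j-th homogeneous coordinate of the logarithmic Gauss map gamma. *)
Definition gauss_poly f (j : 'I_n) : mpoly n (Cx R) :=
  mpolyX (Cx R) (mnm1 j) * mderiv j f.

Definition gauss_lift f z : 'rV[Cx R]_n :=
  \row_j meval (z 0) (gauss_poly f j).

Definition gauss_lift_jacobian f z : 'M[Cx R]_n :=
  \matrix_(i, j) meval (z 0) (mderiv i (gauss_poly f j)).

(* With G the lift of gamma to C^n minus the origin, the tangent space of
   CP^(n-1) at [G z] is C^n / C (G z), and d(gamma) is dG on T_z V followed by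
   the projection; its rank is therefore the rank below minus 1, to be compared
   with n - 1. *)
Definition gauss_critical f z : Prop :=
  smooth_point f z /\
  (\rank (tangent_space f z *m gauss_lift_jacobian f z + gauss_lift f z)%MS
     < n)%N.

Definition regular_value f x : Prop :=
  Critv f x /\ forall z, fibre f x z -> ~ gauss_critical f z.

(* For a small neighbourhood U of a smooth point p of V, the local branch of V
   at p is V `&` U. *)
Definition local_amoeba f U : set 'rV[R]_n := Log @` (hypersurface f `&` U).

Definition critical_branch f U : set 'rV[R]_n :=
  Log @` (hypersurface f `&` U `&` Critp f).

(* An injective continuous image of an open d-dimensional cube; the balls of
   'rV_d are cubes. The dimension of a subanalytic set, such as a branch of
   critical values, is the largest dimension of such a cell inside it. *)
Definition contains_cell C (d : nat) : Prop :=
  exists phi : 'rV[R]_d -> 'rV[R]_n,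
    [/\ {within ball (0 : 'rV[R]_d) 1, continuous phi},
        set_inj (ball (0 : 'rV[R]_d) 1) phi
      & phi @` ball (0 : 'rV[R]_d) 1 `<=` C].

Definition has_dim C (d : nat) : Prop :=
  contains_cell C d /\ forall e, contains_cell C e -> (e <= d)%N.

(* The tangent space of C at x when C is a C^1 submanifold. *)
Definition tangent_cone C x : set 'rV[R]_n :=
  [set w | exists (y : nat -> 'rV[R]_n) (t : nat -> R),
     [/\ forall k, C (y k) /\ 0 < t k,
         y k @[k --> \oo] --> x
       & t k *: (y k - x) @[k --> \oo] --> w]].

Definition normal_to C x v : Prop :=
  v != 0 /\ forall w, tangent_cone C x w -> v *m w^T = 0.

Definition points_inside A x v : Prop :=
  \forall t \near (0 : R)^'+, A (x + t *: v).

(* [v] is the normal vector, at x = Log p, to the branch of critical values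
   coming from p, pointing inside the local amoeba. That it is the inward one
   of the two opposite normal directions means that - v does not point inside. *)
Definition inward_normal f p v : Prop :=
  \forall U \near powerset_filter_from (nbhs p),
    [/\ normal_to (critical_branch f U) (Log p) v,
        points_inside (local_amoeba f U) (Log p) v
      & ~ points_inside (local_amoeba f U) (Log p) (- v)].

Definition branch_dimension f p : Prop :=
  \forall U \near powerset_filter_from (nbhs p),
    critical_branch f U !=set0 -> has_dim (critical_branch f U) n.-1.

Definition convex_hull s (v : 'I_s -> 'rV[R]_n) : set 'rV[R]_n :=
  [set w | exists c : 'I_s -> R,
     [/\ forall i, 0 <= c i, \sum_i c i = 1 & w = \sum_i c i *: v i]].

End Amoebas.

(* Main.v *)
Require Import Defs.
From HB Require Import structures.
From mathcomp Require Import all_boot all_order all_algebra.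
From mathcomp Require Import all_classical all_reals all_analysis.
From mathcomp Require Import complex.
From mathcomp Require Import -(notations) mpoly.
From mathcomp Require Import ring lra.

(** The theorem reduces to a description of the local amoeba at a point p of the
    fibre over x.

    Since p is a critical point of Log on V, the logarithmic Gauss map is real
    there: some complex multiple of (z_k df/dz_k)(p) is a nonzero real vector eta
    ([Critp_gauss]).  Fix j with eta_j != 0; near p, V is a graph over the
    coordinates other than j.  Let H z = sum_k eta_k (log|z_k| - x_k), which is
    stationary at p along V, and call slice a set of points of V near p whose moduli
    |z_k|, k != j, are prescribed.

    If H takes both signs on the slice through p, arbitrarily close to p, then any
    two points of a nearby slice are joined by a path in it and the intermediate
    value theorem shows that the local amoeba is a neighbourhood of x
    ([both_sides]); this is excluded, as - v does not point inside.  So H has a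
    constant sign on that slice, H >= 0 after replacing eta by - eta.  Then:
    - H z >= - e |Log z - x| on V near p, for every e > 0 ([lower_bound]);
    - the minimum of H on a nearby slice is reached near p, and at a critical point
      of Log, because rotating z_k moves log|z_j| at the speed Im (G_k / G_j), where
      G_k = z_k df/dz_k; this minimum is small with respect to the distance of the
      slice, so that the tangent cone of the branch of critical values contains
      every vector orthogonal to eta ([critical_near], [tangent_eta]) and v is a
      positive multiple of eta ([normal_parallel]);
    - this minimum is <= 0 ([low_point_on_slice]).  Otherwise, for some al > 0, the
      function H - al t - al t^2, where t parametrizes a segment of slices issued
      from that of p, has an interior minimum; but along a holomorphic curve of V
      on which t is the real part of the parameter, H is harmonic and t^2 is
      strictly subharmonic;
    - since the slice of p also contains points where H > 0, all y near x with
      v . (y - x) >= 0 belong to the local amoeba ([fill]).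
    Hence the local amoeba contains a half-ball v . (y - x) >= 0, and lies in
    v . (y - x) >= - o(|y - x|) ([branch_bounds]).

    Finally, if 0 is in the convex hull of the v_i, then every y satisfies
    v_i . (y - x) >= 0 for some i, and x is interior.  If not, Gordan's theorem gives
    w with v_i . w < 0 for all i; as Log is proper and the fibre is finite, x + t w,
    for a small t > 0, can only be the image of a point near some p_i, which
    contradicts the lower bound.  The case of the boundary follows, x being in the
    amoeba. *)

Set Implicit Arguments.
Unset Strict Implicit.
Unset Printing Implicit Defensive.

Import Order.TTheory GRing.Theory Num.Theory.
Import numFieldNormedType.Exports.

Local Open Scope classical_set_scope.
Local Open Scope ring_scope.

(** * Moduli, boxes and compactness in C^n *)

(** Splits an equality between complex numbers into its real and imaginary parts,
    and attempts to prove both by [ring]. *)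
Ltac cplx := apply/eqP; rewrite eq_complex /=; apply/andP; split; apply/eqP; try ring.

(** The modulus, as a real number.  It is locked, as are [ev], [differential],
    [dist1] and [cay] below, to keep them from being unfolded by conversion. *)
HB.lock Definition nc (R : realType) (z : Cx R) : R := Normc.normc z.
Arguments nc {R} z.

Section Modulus.
Context {R : realType}.
Implicit Types (a b : R) (z w : Cx R).

(** The embedding of the reals, and the imaginary unit. *)
Definition rc (a : R) : Cx R := a%:C%C.
Definition ii : Cx R := Complex 0 1.

Lemma ncM z w : nc (z * w) = nc z * nc w.
Proof. rewrite nc.unlock; exact: Normc.normcM. Qed.

Lemma ncV z : nc z^-1 = (nc z)^-1.
Proof. rewrite nc.unlock; exact: Normc.normcV. Qed.

Lemma ncD z w : nc (z + w) <= nc z + nc w.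
Proof. rewrite nc.unlock; exact: le_normcD. Qed.

Lemma ncN z : nc (- z) = nc z.
Proof. rewrite nc.unlock; exact: normcN. Qed.

Lemma ncB z w : nc (z - w) <= nc z + nc w.
Proof. by rewrite -(ncN w) ncD. Qed.

Lemma nc_sym z w : nc (z - w) = nc (w - z).
Proof. by rewrite -ncN opprB. Qed.

Lemma nc0 : nc (0 : Cx R) = 0.
Proof. rewrite nc.unlock; exact: Normc.normc0. Qed.

Lemma nc1 : nc (1 : Cx R) = 1.
Proof. rewrite nc.unlock; exact: Normc.normc1. Qed.

Lemma nc_ge0 z : 0 <= nc z.
Proof. by case: z => a b; rewrite nc.unlock /= sqrtr_ge0. Qed.

Lemma nc_eq0 z : (nc z == 0) = (z == 0).
Proof. by apply/eqP/eqP => [|->]; [rewrite nc.unlock; exact: Normc.eq0_normc|exact: nc0]. Qed.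

Lemma nc_gt0 z : (0 < nc z) = (z != 0).
Proof. by rewrite lt_neqAle nc_ge0 andbT eq_sym nc_eq0. Qed.

Lemma nc_normE z : `|z| = rc (nc z).
Proof. by rewrite /rc nc.unlock; case: z. Qed.

Lemma nc_rc a : nc (rc a) = `|a|.
Proof. by rewrite nc.unlock /rc /= expr0n addr0 sqrtr_sqr. Qed.

Lemma nc_ii : nc ii = 1.
Proof. by rewrite nc.unlock /= expr0n add0r expr1n sqrtr1. Qed.

Lemma ii2 : ii * ii = -1.
Proof. by cplx. Qed.

Lemma nc_sub_ge z w : nc z - nc w <= nc (z - w).
Proof. by rewrite lerBlDr (le_trans _ (ncD _ _))// subrK. Qed.

Lemma nc_dist z w : `|nc z - nc w| <= nc (z - w).
Proof. by rewrite ler_norml nc_sub_ge andbT lerNl opprB nc_sym nc_sub_ge. Qed.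

Lemma nc_Re z : `|complex.Re z| <= nc z.
Proof.
case: z => a b; rewrite nc.unlock /= -sqrtr_sqr ler_wsqrtr// lerDl; exact: sqr_ge0.
Qed.

Lemma nc_Im z : `|complex.Im z| <= nc z.
Proof.
case: z => a b; rewrite nc.unlock /= -sqrtr_sqr ler_wsqrtr// lerDr; exact: sqr_ge0.
Qed.

Lemma nc_ltE z (e : Cx R) : (`|z| < e) <-> complex.Im e = 0 /\ nc z < complex.Re e.
Proof.
rewrite nc_normE; case: e => a b; rewrite /rc.
split; first by move=> /andP[/eqP/= -> ->].
by move=> /= [-> h]; rewrite ltcE /= eqxx.
Qed.

End Modulus.

Section ComplexTopology.
Context {R : realType} {n : nat}.
Implicit Types (z w p : 'rV[Cx R]_n) (e : R) (U : set 'rV[Cx R]_n).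

(** The closed polydisc of radius e around p. *)
Definition cbox p e : set 'rV[Cx R]_n := [set z | forall k, nc (z 0 k - p 0 k) <= e].

Lemma cbox_center p e : 0 <= e -> cbox p e p.
Proof. by move=> e0 k; rewrite subrr nc0. Qed.

Lemma cbox_le p e e' : e <= e' -> cbox p e `<=` cbox p e'.
Proof. by move=> ee' z h k; exact: le_trans (h k) ee'. Qed.

(** The balls of C^n have radii in C: a positive radius is a complex number with
    zero imaginary part. *)
Lemma nbhs_cboxP p U : nbhs p U <-> exists2 e, 0 < e & cbox p e `<=` U.
Proof.
split.
- move=> /nbhs_ballP[e e0 eU].
  move: e0 eU; case: e => a b /andP[/= /eqP b0 a0] eU; rewrite b0 in eU.
  exists (a / 2); first by rewrite divr_gt0.
  move=> z hz; apply: eU.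
  have e0 : 0 < (a +i* 0 : R[i])%C by rewrite ltcE /= eqxx.
  split=> // i j; rewrite -ball_normE/=; apply/nc_ltE; split=> //=.
  rewrite (ord1 i) nc_sym (le_lt_trans (hz j))// ltr_pdivrMr// ltr_pMr//.
  by rewrite ltr1n.
- move=> [e e0 eU]; apply/nbhs_ballP; exists (rc e) => /=.
    by rewrite ltcE /= eqxx.
  move=> z [_ hz]; apply: eU => k; have := hz 0 k.
  rewrite -ball_normE/= => /nc_ltE[_ /=].
  by rewrite nc_sym => /ltW.
Qed.

Lemma nbhs_cbox p e : 0 < e -> nbhs p (cbox p e).
Proof. by move=> e0; apply/nbhs_cboxP; exists e. Qed.

Lemma cbox_continuous (T : pseudoMetricType R) (g : 'rV[Cx R]_n -> T) z :
  (forall e, 0 < e -> exists2 d, 0 < d & forall w, cbox z d w -> ball (g z) e (g w)) ->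
  {for z, continuous g}.
Proof.
move=> h A /nbhs_ballP[e e0 eA]; have [d d0 hd] := h e e0.
by apply/nbhs_cboxP; exists d => // w /hd; exact: eA.
Qed.

End ComplexTopology.

Section Compactness.
Context {R : realType}.

Lemma nc_continuous : continuous (@nc R : Cx R -> R).
Proof.
move=> z A /nbhs_ballP[e e0 eA]; apply/nbhs_ballP; exists (rc e) => /=.
  by rewrite ltcE /= eqxx.
move=> w; rewrite -ball_normE/= => /nc_ltE[_ /= h].
apply: eA; rewrite -ball_normE/=.
exact: le_lt_trans (nc_dist _ _) h.
Qed.

Lemma compact_disc (c : Cx R) (e : R) : compact [set z : Cx R | nc (z - c) <= e].
Proof.
pose g (u : R * R) : Cx R := c + Complex u.1 u.2.
have cg : continuous g.
  move=> u A /nbhs_ballP[[a b] /andP[/= /eqP b0 a0] dA]; rewrite b0 in dA.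
  have a2 : 0 < a / 2 by rewrite divr_gt0.
  change (nbhs u (g @^-1` A)).
  apply/nbhs_ballP; exists (a / 2) => //= w [].
  rewrite -!ball_normE/= => h1 h2; apply: dA; rewrite -ball_normE/=.
  apply/nc_ltE; split=> //=.
  rewrite /g opprD addrACA subrr add0r.
  have -> : (Complex u.1 u.2 : Cx R) - Complex w.1 w.2 =
    rc (u.1 - w.1) + ii * rc (u.2 - w.2).
    by cplx.
  rewrite (le_lt_trans (ncD _ _))// ncM nc_ii mul1r !nc_rc.
  by rewrite [ltRHS]splitr ltrD.
apply: (@subclosed_compact _ _ (g @` (`[-e, e] `*` `[-e, e]))).
- have -> : [set z : Cx R | nc (z - c) <= e] = (fun z => nc (z - c)) @^-1` [set x | x <= e].
    by [].
  apply: closed_comp; last exact: closed_le.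
  move=> z _; apply: (@continuous_comp _ _ _ (fun z : Cx R => z - c) nc).
    exact: (@cvgB (Cx R) (Cx R) _ (nbhs z) _ id (cst c) z c (@cvg_id _ _) (@cvg_cst _ c _ _ _)).
  exact: nc_continuous.
- apply: continuous_compact; first exact: continuous_subspaceT.
  by apply: compact_setX; exact: segment_compact.
- move=> z /= hz; exists (complex.Re (z - c), complex.Im (z - c)).
    split; rewrite /= in_itv/= -ler_norml; first exact: le_trans (nc_Re _) hz.
    exact: le_trans (nc_Im _) hz.
  by rewrite /g/=; have -> : Complex (complex.Re (z - c)) (complex.Im (z - c)) = z - c;
    [case: (z - c)|rewrite addrC subrK].
Qed.

Lemma compact_cbox n (p : 'rV[Cx R]_n) (e : R) : compact (cbox p e).
Proof.
exact: (@rV_compact _ n (fun k => [set z : Cx R | nc (z - p 0 k) <= e])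
  (fun k => @compact_disc _ _)).
Qed.

(** A positive continuous function on a compact set is bounded below by a
    positive constant. *)
Lemma compact_pos (T : topologicalType) (K : set T) (g : T -> R) :
  compact K -> {in K, continuous g} -> (forall z, K z -> 0 < g z) ->
  exists2 m, 0 < m & forall z, K z -> m <= g z.
Proof.
move=> cK cg g0; have [->|/set0P K0] := eqVneq K set0; first by exists 1.
have cg' : {within K, continuous g} by apply: continuous_in_subspaceT.
have [c cKc hc] := compact_EVT_min K0 cK cg'.
rewrite inE in cKc.
by exists (g c); [exact: g0|move=> z Kz; apply: hc; rewrite inE].
Qed.

End Compactness.

(** * Polynomial maps near a point *)

(** Induction on polynomials as a ring generated by constants and variables. *)
Lemma mpoly_ring_ind (K : comNzRingType) n (P : mpoly n K -> Prop) :
  (forall c, P (mpolyC n c)) -> (forall i, P (mpolyX K (mnm1 i))) ->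
  (forall p q, P p -> P q -> P (p + q)) ->
  (forall p q, P p -> P q -> P (p * q)) -> forall p, P p.
Proof.
move=> hC hX hD hM.
have h1 : P 1 by exact: (hC 1).
have hm m : P (mpolyX K m).
  rewrite mpolyXE_id; apply: (big_ind P) => // i _.
  by elim: (m i) => [|k ih]; rewrite ?expr0 ?exprS//; apply: hM.
elim/mpolyind => [|c m p _ _ hp]; first by rewrite -(mpolyC0 n); exact: hC.
by rewrite -mul_mpolyC; apply: hD => //; exact: hM.
Qed.

(** The value of f at z. *)
HB.lock Definition ev (R : realType) n (f : mpoly n (Cx R)) (z : 'rV[Cx R]_n) : Cx R :=
  meval (z 0) f.

(** The complex differential of f at p, applied to h. *)
HB.lock Definition differential (R : realType) n (f : mpoly n (Cx R)) (p h : 'rV[Cx R]_n)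
  : Cx R := \sum_k ev (mderiv k f) p * h 0 k.

(** The l^1 distance. *)
HB.lock Definition dist1 (R : realType) n (z w : 'rV[Cx R]_n) : R :=
  \sum_k nc (w 0 k - z 0 k).

Section PolynomialEstimates.
Context {R : realType} {n : nat}.
Implicit Types (f : mpoly n (Cx R)) (z w p : 'rV[Cx R]_n).

Lemma evC c z : ev (mpolyC n c) z = c.
Proof. by rewrite ev.unlock mevalC. Qed.

Lemma evX k z : ev (mpolyX (Cx R) (mnm1 k)) z = z 0 k.
Proof. by rewrite ev.unlock mevalXU. Qed.

Lemma evD f g z : ev (f + g) z = ev f z + ev g z.
Proof. by rewrite ev.unlock mevalD. Qed.

Lemma evM f g z : ev (f * g) z = ev f z * ev g z.
Proof. by rewrite ev.unlock mevalM. Qed.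

Lemma ev_mderivC k c z : ev (mderiv k (mpolyC n c)) z = 0.
Proof. by rewrite ev.unlock mderivC meval0. Qed.

Lemma ev_mderivX k i z : ev (mderiv k (mpolyX (Cx R) (mnm1 i))) z = (k == i)%:R.
Proof.
rewrite ev.unlock mderivX mevalZ mnm1E [k == i]eq_sym.
have [->|_] := eqVneq i k; last by rewrite mul0r.
have -> : mnm_sub (mnm1 k) (mnm1 k) = @mnm0 n by apply/mnmP => l; rewrite !mnmE subnn.
by rewrite mpolyX0 meval1 mul1r.
Qed.

Lemma ev_mderivD k f g z : ev (mderiv k (f + g)) z = ev (mderiv k f) z + ev (mderiv k g) z.
Proof. by rewrite ev.unlock mderivD mevalD. Qed.

Lemma ev_mderivM k f g z :
  ev (mderiv k (f * g)) z = ev (mderiv k f) z * ev g z + ev f z * ev (mderiv k g) z.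
Proof. by rewrite ev.unlock mderivM mevalD !mevalM. Qed.

Lemma dist1_ge0 z w : 0 <= dist1 z w.
Proof. by rewrite dist1.unlock; apply: sumr_ge0 => k _; exact: nc_ge0. Qed.

Lemma nc_sum (I : finType) (P : pred I) (F : I -> Cx R) :
  nc (\sum_(i | P i) F i) <= \sum_(i | P i) nc (F i).
Proof.
elim/big_ind2 : _ => [|x1 x2 y1 y2 h1 h2|//]; first by rewrite nc0.
by rewrite (le_trans (ncD _ _))// lerD.
Qed.

Lemma differential_bound f p : exists2 L, 0 < L &
  forall z w, nc (differential f p (w - z)) <= L * dist1 z w.
Proof.
exists (1 + \sum_k nc (ev (mderiv k f) p)).
  by rewrite ltr_wpDr// sumr_ge0// => k _; exact: nc_ge0.
move=> z w; rewrite differential.unlock dist1.unlock (le_trans (nc_sum _ _))// mulr_sumr ler_sum// => k _.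
rewrite ncM !mxE ler_wpM2r ?nc_ge0// (bigD1 k)//= addrCA lerDl.
by rewrite addr_ge0// sumr_ge0// => i _; exact: nc_ge0.
Qed.

Lemma differential_split f p (j : 'I_n) (h : 'rV[Cx R]_n) :
  differential f p h = ev (mderiv j f) p * h 0 j +
    \sum_(k | k != j) ev (mderiv k f) p * h 0 k.
Proof. by rewrite differential.unlock (bigD1 j). Qed.

Lemma differentialC c p h : differential (mpolyC n c) p h = 0.
Proof. by rewrite differential.unlock big1// => k _; rewrite ev_mderivC mul0r. Qed.

Lemma differentialX i p h : differential (mpolyX (Cx R) (mnm1 i)) p h = h 0 i.
Proof.
rewrite differential.unlock (bigD1 i)//= big1 => [|k ki].
  by rewrite addr0 ev_mderivX eqxx mul1r.
by rewrite ev_mderivX (negbTE ki) mul0r.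
Qed.

Lemma differentialD f g p h :
  differential (f + g) p h = differential f p h + differential g p h.
Proof.
by rewrite differential.unlock -big_split; apply: eq_bigr => k _; rewrite ev_mderivD mulrDl.
Qed.

Lemma differentialM f g p h :
  differential (f * g) p h = ev g p * differential f p h + ev f p * differential g p h.
Proof.
rewrite differential.unlock !mulr_sumr -big_split; apply: eq_bigr => k _ /=.
by rewrite ev_mderivM; ring.
Qed.

(** Strict differentiability: the error of the linear approximation at p is small
    with respect to dist1 z w, for both z and w near p. *)
Definition strictly_differentiable f p := forall e : R, 0 < e ->
  exists2 d, 0 < d & forall z w, cbox p d z -> cbox p d w ->
    nc (ev f w - ev f z - differential f p (w - z)) <= e * dist1 z w.

Lemma cbox_minl p (d e : R) : cbox p (Num.min d e) `<=` cbox p d.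
Proof. by apply: cbox_le; rewrite ge_min lexx. Qed.

Lemma cbox_minr p (d e : R) : cbox p (Num.min d e) `<=` cbox p e.
Proof. by apply: cbox_le; rewrite ge_min lexx orbT. Qed.

Lemma dist1_cbox p w (d : R) : cbox p d w -> dist1 p w <= n%:R * d.
Proof.
move=> h; rewrite dist1.unlock (le_trans (ler_sum _ (fun k _ => h k)))//.
by rewrite sumr_const card_ord mulr_natl.
Qed.

Lemma strictly_differentiable_continuous f p : strictly_differentiable f p ->
  forall e : R, 0 < e -> exists2 d, 0 < d & forall w, cbox p d w -> nc (ev f w - ev f p) <= e.
Proof.
move=> h e e0; have [d d0 hd] := h 1 ltr01.
have [L L0 hL] := differential_bound f p.
have n0 : (0 : R) <= n%:R by rewrite ler0n.
have K0 : 0 < (1 + L) * n%:R + 1 by rewrite ltr_wpDl// mulr_ge0// addr_ge0// ltW.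
exists (Num.min d (e / ((1 + L) * n%:R + 1))) => [|w hw].
  by rewrite lt_min d0 divr_gt0.
have h1 := hd p w (cbox_center _ (ltW d0)) (cbox_minl hw).
have h2 := dist1_cbox (cbox_minr hw).
rewrite -[X in nc X](subrK (differential f p (w - p))) (le_trans (ncD _ _))//.
rewrite (le_trans (lerD h1 (hL _ _)))// -mulrDl.
rewrite (le_trans (ler_wpM2l _ h2)) ?addr_ge0 ?ler01 ?(ltW L0)//.
set K := _ + 1 in K0 h2 *; have tK : e / K * K = e by rewrite divfK// gt_eqF.
have t0 : 0 <= e / K by rewrite divr_ge0// ltW.
by rewrite -[X in _ <= X]tK /K; lra.
Qed.

Lemma meval_strictly_differentiable f p : strictly_differentiable f p.
Proof.
elim/mpoly_ring_ind: f => [c|i|f g hf hg|f g hf hg] e e0.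
- exists 1 => // z w _ _; rewrite !evC subrr differentialC subrr nc0.
  by rewrite mulr_ge0// ?dist1_ge0 ?ltW.
- exists 1 => // z w _ _; rewrite !evX differentialX !mxE subrr nc0.
  by rewrite mulr_ge0// ?dist1_ge0 ?ltW.
- have e2 : 0 < e / 2 by rewrite divr_gt0.
  have [d1 d10 h1] := hf _ e2; have [d2 d20 h2] := hg _ e2.
  exists (Num.min d1 d2) => [|z w hz hw]; first by rewrite lt_min d10.
  have := h1 z w (cbox_minl hz) (cbox_minl hw).
  have := h2 z w (cbox_minr hz) (cbox_minr hw).
  rewrite differentialD !evD => k2 k1.
  set X := (X in nc X); have -> : X =
   (ev f w - ev f z - differential f p (w - z)) +
   (ev g w - ev g z - differential g p (w - z)) by rewrite /X; ring.
  rewrite (le_trans (ncD _ _))// [e]splitr mulrDl; exact: lerD.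
- have [Lf Lf0 bf] := differential_bound f p.
  have [Lg Lg0 bg] := differential_bound g p.
  pose M := nc (ev f p) + nc (ev g p) + 1.
  have M0 : 0 < M by rewrite ltr_wpDl// addr_ge0// nc_ge0.
  pose eta := Num.min 1 (e / (4 * (Lf + Lg))).
  have L0 : 0 < 4 * (Lf + Lg) by rewrite mulr_gt0// addr_gt0.
  have eta0 : 0 < eta by rewrite lt_min ltr01 divr_gt0.
  have [df df0 cf] := strictly_differentiable_continuous hf eta0.
  have [dg dg0 cg] := strictly_differentiable_continuous hg eta0.
  have e10 : 0 < e / (4 * M) by rewrite divr_gt0// mulr_gt0.
  have [d1 d10 h1] := hf _ e10; have [d2 d20 h2] := hg _ e10.
  pose d := Num.min (Num.min df dg) (Num.min d1 d2).
  exists d => [|z w hz hw]; first by rewrite !lt_min df0 dg0 d10.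
  have B q y (le : d <= q) (hy : cbox p d y) : cbox p q y := cbox_le le hy.
  have ldf : d <= df by rewrite /d !ge_min lexx.
  have ldg : d <= dg by rewrite /d !ge_min lexx !orbT.
  have ld1 : d <= d1 by rewrite /d !ge_min lexx !orbT.
  have ld2 : d <= d2 by rewrite /d !ge_min lexx !orbT.
  have := h1 z w (B _ _ ld1 hz) (B _ _ ld1 hw).
  have := h2 z w (B _ _ ld2 hz) (B _ _ ld2 hw).
  have := cf w (B _ _ ldf hw); have := cg z (B _ _ ldg hz).
  have := bf z w; have := bg z w.
  set Df := differential f p _; set Dg := differential g p _; set D := dist1 z w.
  rewrite differentialM -/Df -/Dg.
  have -> : ev (f * g) w - ev (f * g) z - (ev g p * Df + ev f p * Dg) =
    ev f w * (ev g w - ev g z - Dg) + ev g z * (ev f w - ev f z - Df) +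
    (ev f w - ev f p) * Dg + (ev g z - ev g p) * Df.
    by rewrite !evM; ring.
  move=> kDg kDf kg kf k2 k1.
  have D0 : 0 <= D := dist1_ge0 z w.
  have eta1 : eta <= 1 by rewrite /eta ge_min lexx.
  have eta2 : eta * (4 * (Lf + Lg)) <= e.
    by rewrite -ler_pdivlMr// /eta ge_min lexx orbT.
  have fM : nc (ev f w) <= M.
    rewrite -[ev f w](subrK (ev f p)) (le_trans (ncD _ _))// /M.
    by have := nc_ge0 (ev g p); lra.
  have gM : nc (ev g z) <= M.
    rewrite -[ev g z](subrK (ev g p)) (le_trans (ncD _ _))// /M.
    by have := nc_ge0 (ev f p); lra.
  have t1 : nc (ev f w * (ev g w - ev g z - Dg)) <= e / 4 * D.
    rewrite ncM (le_trans (ler_pM (nc_ge0 _) (nc_ge0 _) fM k2))// mulrA ler_wpM2r//.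
    by have -> : M * (e / (4 * M)) = e / 4; [field; rewrite gt_eqF|].
  have t2 : nc (ev g z * (ev f w - ev f z - Df)) <= e / 4 * D.
    rewrite ncM (le_trans (ler_pM (nc_ge0 _) (nc_ge0 _) gM k1))// mulrA ler_wpM2r//.
    by have -> : M * (e / (4 * M)) = e / 4; [field; rewrite gt_eqF|].
  have t3 : nc ((ev f w - ev f p) * Dg) <= eta * Lg * D.
    by rewrite ncM -mulrA ler_pM ?nc_ge0.
  have t4 : nc ((ev g z - ev g p) * Df) <= eta * Lf * D.
    by rewrite ncM -mulrA ler_pM ?nc_ge0.
  rewrite (le_trans (ncD _ _))// (le_trans (lerD (ncD _ _) t4))//.
  rewrite (le_trans (lerD (lerD (ncD _ _) t3) (lexx _)))//.
  rewrite (le_trans (lerD (lerD (lerD t1 t2) (lexx _)) (lexx _)))//.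
  rewrite -!mulrDl ler_wpM2r//; lra.
Qed.

Lemma ev_continuous f p (e : R) : 0 < e ->
  exists2 d, 0 < d & forall w, cbox p d w -> nc (ev f w - ev f p) <= e.
Proof. exact: strictly_differentiable_continuous (meval_strictly_differentiable f p) e. Qed.

(** The point z with its coordinate j replaced by c. *)
Definition upd z (j : 'I_n) (c : Cx R) : 'rV[Cx R]_n := \row_k (if k == j then c else z 0 k).

Lemma updE z j c k : (upd z j c) 0 k = if k == j then c else z 0 k.
Proof. by rewrite mxE. Qed.

(** As a function of its coordinate j, f is a polynomial in one variable, of
    degree bounded independently of the other coordinates. *)
Lemma upd_poly f (j : 'I_n) : exists N : nat, forall z, exists P : {poly Cx R},
  [/\ (size P <= N)%N, forall c, P.[c] = ev f (upd z j c)
    & forall c, P^`().[c] = ev (mderiv j f) (upd z j c)].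
Proof.
elim/mpoly_ring_ind: f => [c|i|f g [N1 h1] [N2 h2]|f g [N1 h1] [N2 h2]].
- exists 1%N => z; exists c%:P; split=> [|d|d]; first exact: size_polyC_leq1.
    by rewrite hornerC evC.
  by rewrite derivC horner0 ev_mderivC.
- exists 2%N => z; have [->|ij] := eqVneq i j.
    exists 'X; split=> [|d|d]; first by rewrite size_polyX.
      by rewrite hornerX evX updE eqxx.
    by rewrite derivX hornerC ev_mderivX eqxx.
  exists (z 0 i)%:P; split=> [|d|d]; first by rewrite (leq_trans (size_polyC_leq1 _)).
    by rewrite hornerC evX updE (negbTE ij).
  by rewrite derivC horner0 ev_mderivX eq_sym (negbTE ij).
- exists (maxn N1 N2) => z; have [P [sP eP dP]] := h1 z; have [Q [sQ eQ dQ]] := h2 z.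
  exists (P + Q); split=> [|d|d].
  + rewrite (leq_trans (size_polyD _ _))// geq_max !leq_max sP sQ orbT//.
  + by rewrite hornerD eP eQ evD.
  + by rewrite derivD hornerD dP dQ ev_mderivD.
- exists (N1 + N2)%N => z; have [P [sP eP dP]] := h1 z; have [Q [sQ eQ dQ]] := h2 z.
  exists (P * Q); split=> [|d|d].
  + rewrite (leq_trans (size_polyMleq _ _))// (leq_trans (leq_pred _))// leq_add//.
  + by rewrite hornerM eP eQ evM.
  + by rewrite derivM hornerD !hornerM eP eQ dP dQ ev_mderivM.
Qed.

(** The logarithmic derivative of a product of linear factors is bounded by their
    number divided by the distance to the nearest root. *)
Lemma prod_root_bound (rs : seq (Cx R)) (c : Cx R) (D : R) : 0 <= D ->
  (forall r, r \in rs -> D <= nc (c - r)) ->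
  nc ((\prod_(r <- rs) ('X - r%:P))^`().[c]) * D <=
    (size rs)%:R * nc ((\prod_(r <- rs) ('X - r%:P)).[c]).
Proof.
move=> D0; elim: rs => [|r rs ih] h.
  by rewrite big_nil -polyC1 derivC horner0 nc0 !mul0r lexx.
rewrite big_cons derivM derivXsubC mul1r hornerD !hornerM hornerXsubC.
have hr := h r (mem_head _ _).
have {ih} := ih (fun s hs => h s (mem_behead (s := r :: rs) hs)).
set A := _.[c]; set B := _.[c] => hh.
rewrite (le_trans (ler_wpM2r D0 (ncD _ _)))// mulrDl !ncM.
have -> : (size (r :: rs))%:R = 1 + (size rs)%:R :> R by rewrite /= -natr1 addrC.
have h1 : nc B * D <= nc (c - r) * nc B by rewrite mulrC ler_wpM2r// nc_ge0.
have h2 : nc (c - r) * (nc A * D) <= nc (c - r) * ((size rs)%:R * nc B).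
  by rewrite ler_wpM2l// nc_ge0.
lra.
Qed.

Lemma poly_root_near (P : {poly Cx R}) (c : Cx R) : P^`().[c] != 0 ->
  exists2 r, P.[r] = 0 &
    nc (r - c) * nc (P^`().[c]) <= (size P)%:R * nc P.[c].
Proof.
move=> d0.
have P0 : P != 0 by apply: contraNneq d0 => ->; rewrite deriv0 horner0.
have [rs Prs] := closed_field_poly_normal (P : {poly R[i]}).
have l0 : lead_coef P != 0 by rewrite lead_coef_eq0.
have root_rs r : r \in rs -> P.[r] = 0.
  move=> hr; rewrite Prs hornerZ; apply/eqP; rewrite mulf_eq0; apply/orP; right.
  by rewrite -/(root _ _) root_prod_XsubC.
have [Pc0|Pc0] := eqVneq P.[c] 0.
  by exists c => //; rewrite subrr nc0 mul0r mulr_ge0// ?nc_ge0 ?ler0n.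
have [/hasP[r hr hle]|/hasPn hn] := boolP (has (fun r : Cx R =>
  nc (r - c) * nc (P^`().[c]) <= (size P)%:R * nc P.[c]) rs).
  by exists r => //; exact: root_rs.
have dgt : 0 < nc (P^`().[c]) by rewrite nc_gt0.
pose D := (size P)%:R * nc P.[c] / nc (P^`().[c]).
have D0 : 0 <= D by rewrite divr_ge0 ?mulr_ge0 ?nc_ge0.
have hD r : r \in rs -> D <= nc (c - r).
  move=> /hn; rewrite -ltNge => /ltW; rewrite /D ler_pdivrMr// nc_sym//.
have := prod_root_bound D0 hD.
have szP : size P = (size rs).+1.
  by rewrite Prs size_scale// size_prod_XsubC.
set Q := \prod_(r <- rs) _; have PQ : P = lead_coef P *: Q by [].
have eP : nc P.[c] = nc (lead_coef P) * nc Q.[c] by rewrite {1}PQ hornerZ ncM.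
have eP' : nc (P^`().[c]) = nc (lead_coef P) * nc Q^`().[c] by rewrite {1}PQ derivZ hornerZ ncM.
have lg : 0 < nc (lead_coef P) by rewrite nc_gt0.
move=> hh; have {}hh : nc P^`().[c] * D <= (size rs)%:R * nc P.[c].
  by rewrite eP eP' -mulrA [X in _ <= X]mulrCA ler_pM2l.
move: hh; rewrite /D mulrC divfK ?gt_eqF// szP.
by rewrite ler_pM2r ?nc_gt0// ler_nat ltnn.
Qed.

(** Near a point where the j-th partial derivative does not vanish, a zero of f is
    found by moving coordinate j by at most a constant times |f z|. *)
Lemma root_near f p (j : 'I_n) : ev (mderiv j f) p != 0 ->
  exists C d : R, [/\ 0 < C, 0 < d & forall z, cbox p d z ->
    ev (mderiv j f) z != 0 /\
    exists2 c, ev f (upd z j c) = 0 & nc (c - z 0 j) <= C * nc (ev f z)].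
Proof.
move=> dp; have a0 : 0 < nc (ev (mderiv j f) p) by rewrite nc_gt0.
have [N hN] := upd_poly f j.
have a20 : 0 < nc (ev (mderiv j f) p) / 2 by rewrite divr_gt0.
have [d d0 hd] := ev_continuous (mderiv j f) p a20.
set a := nc _ in a0 a20 hd.
exists (N.+1%:R * (2 / a)), d; split=> // [|z hz].
  by rewrite mulr_gt0// ?ltr0n// divr_gt0.
have az : a / 2 <= nc (ev (mderiv j f) z).
  have := hd z hz; have := nc_sub_ge (ev (mderiv j f) p) (ev (mderiv j f) z).
  rewrite nc_sym -/a; lra.
have az0 : 0 < nc (ev (mderiv j f) z) by exact: lt_le_trans az.
split; first by rewrite -nc_gt0.
have [P [sP eP dP]] := hN z.
have uz : upd z j (z 0 j) = z.
  by apply/rowP => k; rewrite mxE; case: eqP => [->|].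
have dP0 : P^`().[z 0 j] != 0 by rewrite dP uz -nc_gt0.
have [r r0 hr] := poly_root_near dP0.
exists r; first by rewrite -eP.
rewrite dP eP uz in hr.
have sPN : (size P)%:R <= N.+1%:R :> R by rewrite ler_nat (leq_trans sP).
have -> : N.+1%:R * (2 / a) * nc (ev f z) = N.+1%:R * nc (ev f z) / (a / 2).
  by field; rewrite gt_eqF.
rewrite ler_pdivlMr//.
have h1 : nc (r - z 0 j) * (a / 2) <= N.+1%:R * nc (ev f z).
  apply: (le_trans (ler_wpM2l (nc_ge0 _) az)); apply: (le_trans hr).
  by rewrite ler_wpM2r// nc_ge0.
exact: h1.
Qed.

(** Where the j-th partial derivative does not vanish, V is the graph of a
    Lipschitz function of the other coordinates. *)
Lemma graph_lipschitz f p (j : 'I_n) : ev (mderiv j f) p != 0 ->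
  exists C d : R, [/\ 0 < C, 0 < d & forall z w, cbox p d z -> cbox p d w ->
    ev f z = 0 -> ev f w = 0 ->
    nc (w 0 j - z 0 j) <= C * \sum_(k | k != j) nc (w 0 k - z 0 k)].
Proof.
move=> dp; have a0 : 0 < nc (ev (mderiv j f) p) by rewrite nc_gt0.
have a20 : 0 < nc (ev (mderiv j f) p) / 2 by rewrite divr_gt0.
have [d d0 hd] := meval_strictly_differentiable f p a20.
have [L L0 hL] := differential_bound f p.
set a := nc _ in a0 a20 hd.
exists ((L + a / 2) * (2 / a)), d; split=> //.
  by rewrite mulr_gt0// ?addr_gt0// divr_gt0.
move=> z w hz hw fz fw; have := hd z w hz hw.
rewrite fz fw subrr sub0r ncN dist1.unlock (bigD1 j)//=; set S := \sum_(_ | _) _.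
have S0 : 0 <= S by apply: sumr_ge0 => k _; exact: nc_ge0.
pose w' := upd w j (z 0 j).
have -> : differential f p (w - z) =
    ev (mderiv j f) p * (w 0 j - z 0 j) + differential f p (w' - z).
  have wj : (w' - z) 0 j = 0 by rewrite !mxE eqxx subrr.
  have wk k : k != j -> (w' - z) 0 k = (w - z) 0 k.
    by move=> kj; rewrite !mxE (negbTE kj).
  rewrite (differential_split _ _ j) (differential_split _ _ j (w' - z)) wj mulr0 add0r.
  have -> : (w - z) 0 j = w 0 j - z 0 j by rewrite !mxE.
  by congr (_ + _); apply: eq_bigr => k /wk ->.
have h1 : nc (differential f p (w' - z)) <= L * S.
  rewrite (le_trans (hL _ _))// ler_pM2l// dist1.unlock (bigD1 j)//= updE eqxx subrr nc0 add0r.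
  by apply: ler_sum => k kj; rewrite updE (negbTE kj).
move=> h2.
have h3 : a * nc (w 0 j - z 0 j) <= a / 2 * (nc (w 0 j - z 0 j) + S) + L * S.
  rewrite /a -ncM.
  set X := _ * _ in h2 *; set Y := differential _ _ _ in h1 h2.
  have -> : X = (X + Y) - Y by ring.
  by rewrite (le_trans (ncB _ _))// lerD.
have -> : (L + a / 2) * (2 / a) * S = (L + a / 2) * S / (a / 2) by field; rewrite gt_eqF.
rewrite ler_pdivlMr//; lra.
Qed.

End PolynomialEstimates.

(** * Second-order estimates for the exponential and the logarithm *)

Section RealEstimates.
Context {R : realType}.
Implicit Types (a s t : R).

Lemma expR_taylor1 a : `|a| <= 2^-1 -> `|expR a - 1 - a| <= 2 * `|a| ^+ 2.
Proof.
move=> ha; have [h1 h2] : - 2^-1 <= a /\ a <= 2^-1 by apply/andP; rewrite -ler_norml.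
have := expR_ge1Dx a; have := expR_ge1Dx (- a).
rewrite expRN; have e0 := expR_gt0 a.
move=> k1 k2; have k3 : expR a * (1 - a) <= 1.
  by rewrite -ler_pdivlMl// mulr1.
rewrite real_normK ?num_real// ger0_norm; last by lra.
nra.
Qed.

Lemma expR_taylor2 a : `|a| <= 2^-1 -> `|expR a - 1 - a - a ^+ 2 / 2| <= 2 * `|a| ^+ 3.
Proof.
move=> ha; pose g (t : R) := expR t - 1 - t - t ^+ 2 / 2.
have dg t : is_derive t 1 g (expR t - 1 - t).
  rewrite /g; apply: is_derive_eq.
  by rewrite ?scaler0 /GRing.scale/=; field.
have cg (x y : R) : {within `[x, y], continuous g}.
  apply: continuous_subspaceT => t; apply/differentiable_continuous/derivable1_diffP.
  by case: (dg t).
have g0 : g 0 = 0 by rewrite /g expR0; ring.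
have [c hc E] : exists2 c, `|c| <= `|a| & g a = (expR c - 1 - c) * a.
  have [a0|a0] := leP 0 a.
    have [c + ] := MVT_segment a0 (fun t _ => dg t) (cg 0 a).
    rewrite in_itv/= g0 !subr0 => /andP[c0 ca] ->; exists c => //.
    by rewrite !ger0_norm.
  have [c + ] := MVT_segment (ltW a0) (fun t _ => dg t) (cg a 0).
  rewrite in_itv/= g0 !sub0r => /andP[ca c0] E; exists c.
    by rewrite !ler0_norm ?lerN2// ltW.
  by apply: oppr_inj; rewrite E mulrN.
rewrite -/(g a) E normrM exprSr mulrA ler_wpM2r// (le_trans (expR_taylor1 (le_trans hc ha)))//.
by rewrite ler_pM2l// lerXn2r// ?nnegrE.
Qed.

Lemma ln_1D_bound s : `|s| <= 2^-1 -> `|ln (1 + s) - s| <= 2 * `|s| ^+ 2.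
Proof.
move=> hs; have [h1 h2] : - 2^-1 <= s /\ s <= 2^-1 by apply/andP; rewrite -ler_norml.
have s0 : 0 < 1 + s by lra.
have k1 : ln (1 + s) <= s by apply: le_ln1Dx; lra.
have k2 : - ln (1 + s) <= (1 + s)^-1 - 1.
  rewrite -lnV ?posrE// -[X in ln X](subrK 1) addrC; apply: le_ln1Dx.
  by rewrite ltrBrDr addNr invr_gt0.
have k3 : s - 2 * s ^+ 2 <= 1 - (1 + s)^-1.
  rewrite -subr_ge0; have -> : 1 - (1 + s)^-1 - (s - 2 * s ^+ 2) = s ^+ 2 * (1 + 2 * s) / (1 + s).
    by field; rewrite gt_eqF.
  have k4 : 0 <= 1 + 2 * s by lra.
  by apply: divr_ge0; [apply: mulr_ge0; [exact: sqr_ge0|]|exact: ltW].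
rewrite real_normK ?num_real// ler_norml; lra.
Qed.

Lemma nc_sqr (w : Cx R) : nc w ^+ 2 = complex.Re w ^+ 2 + complex.Im w ^+ 2.
Proof. by rewrite nc.unlock; case: w => a b /=; rewrite sqr_sqrtr// addr_ge0// sqr_ge0. Qed.

(** The expansion log |1 + w| = Re w + O(|w|^2). *)
Lemma ln_nc_1D (w : Cx R) : nc w <= 8^-1 ->
  `|ln (nc (1 + w)) - complex.Re w| <= 10 * nc w ^+ 2.
Proof.
move=> hw; have w0 := nc_ge0 w; have hr := nc_Re w.
pose s := 2 * complex.Re w + nc w ^+ 2.
have e : nc (1 + w) ^+ 2 = 1 + s.
  by rewrite /s !nc_sqr; case: w {hw w0 hr s} => a b /=; ring.
have n2 : nc w ^+ 2 <= 8^-1 * nc w by rewrite expr2 ler_wpM2r.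
have hs : `|s| <= 3 * nc w.
  move: hr (sqr_ge0 (nc w)); rewrite /s !ler_norml => /andP[? ?] ?; lra.
have hs2 : `|s| <= 2^-1 by lra.
have p1 : 0 < nc (1 + w).
  have := nc_sub_ge 1 (- w); rewrite opprK ncN nc1; lra.
have -> : ln (nc (1 + w)) = ln (1 + s) / 2.
  by rewrite -e lnXn// mulr2n; field.
have := ln_1D_bound hs2.
have : `|s| ^+ 2 <= 9 * nc w ^+ 2.
  have -> : 9 * nc w ^+ 2 = (3 * nc w) ^+ 2 by ring.
  by rewrite lerXn2r// nnegrE// mulr_ge0.
move=> h1 h2.
have -> : ln (1 + s) / 2 - complex.Re w = (ln (1 + s) - s) / 2 + nc w ^+ 2 / 2.
  by rewrite /s; field.
move: h2 (sqr_ge0 (nc w)); rewrite !ler_norml => /andP[? ?] ?; lra.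
Qed.

End RealEstimates.

(** A parametrization of the unit circle near 1 by the Cayley transform.  It agrees
    with exp (i t) up to order 2 at t = 0, and plays its role. *)
HB.lock Definition cay (R : realType) (t : R) : Cx R :=
  (1 + ii * rc (t / 2)) / (1 - ii * rc (t / 2)).

Section Cayley.
Context {R : realType}.
Implicit Types (a s t : R) (l : Cx R).

Lemma iir a : ii * rc a = Complex 0 a :> Cx R.
Proof. by cplx. Qed.

Lemma nc_iir a : nc (ii * rc a : Cx R) = `|a|.
Proof. by rewrite ncM nc_ii mul1r nc_rc. Qed.

Lemma nc_cay_den t : 1 <= nc (1 - ii * rc t : Cx R).
Proof.
have := nc_Re (1 - ii * rc t); rewrite iir /= subr0 normr1; exact.
Qed.

Lemma cay_den_neq0 t : 1 - ii * rc t != 0 :> Cx R.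
Proof. by rewrite -nc_gt0 (lt_le_trans ltr01) ?nc_cay_den. Qed.

Lemma nc_cay t : nc (cay t) = 1.
Proof.
rewrite cay.unlock ncM ncV; have d0 : 0 < nc (1 - ii * rc (t / 2) : Cx R).
  by rewrite nc_gt0 cay_den_neq0.
have -> : nc (1 + ii * rc (t / 2) : Cx R) = nc (1 - ii * rc (t / 2) : Cx R).
  apply: (@pexpIrn _ 2) => //; rewrite ?nnegrE ?nc_ge0//.
  by rewrite !nc_sqr !iir /=; ring.
by rewrite divff// gt_eqF.
Qed.

Lemma rc_half t : rc t = rc (t / 2) * 2 :> Cx R.
Proof. by cplx; field. Qed.

Lemma rc_sqr t : rc (t ^+ 2 / 2) = - (2 * (ii * rc (t / 2)) ^+ 2) :> Cx R.
Proof. by rewrite iir; cplx; field. Qed.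

Lemma nc2 : nc (2 : Cx R) = 2.
Proof. by have -> : 2 = rc 2 :> Cx R; [cplx|rewrite nc_rc ger0_norm]. Qed.

(** The data on x = i t / 2 needed to expand (1 + x) / (1 - x). *)
Lemma cay_half t : exists x : Cx R, [/\ ii * rc (t / 2) = x, ii * rc t = x * 2,
  nc x = `|t| / 2, 1 <= nc (1 - x) & 1 - x != 0 /\ rc (t ^+ 2 / 2) = - (2 * x ^+ 2)].
Proof.
exists (ii * rc (t / 2)); split=> //.
- by rewrite -mulrA -rc_half.
- by rewrite nc_iir normrM [`|2^-1|]ger0_norm.
- exact: nc_cay_den.
- by split; [exact: cay_den_neq0|exact: rc_sqr].
Qed.

Lemma cay_taylor1 t : nc (cay t - 1 - ii * rc t) <= `|t| ^+ 2.
Proof.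
rewrite cay.unlock; have [x [-> -> nx h [d _]]] := cay_half t.
have -> : (1 + x) / (1 - x) - 1 - x * 2 = 2 * x ^+ 2 / (1 - x) by field.
rewrite expr2 !ncM ncV nx nc2 ler_pdivrMr ?(lt_le_trans ltr01)//.
have := normr_ge0 t; set b := `|t|; nra.
Qed.

Lemma cay_taylor2 t : nc (cay t - 1 - ii * rc t + rc (t ^+ 2 / 2)) <= `|t| ^+ 3.
Proof.
rewrite cay.unlock; have [x [-> -> nx h [d ->]]] := cay_half t.
have -> : (1 + x) / (1 - x) - 1 - x * 2 + - (2 * x ^+ 2) = 2 * x ^+ 3 / (1 - x) by field.
rewrite !exprS expr0 !mulr1 !ncM ncV nx nc2 ler_pdivrMr ?(lt_le_trans ltr01)//.
have := normr_ge0 t; set b := `|t| => b0.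
have : 0 <= b * (b * b) by rewrite !mulr_ge0.
nra.
Qed.

Lemma cay_lip s t : nc (cay s - cay t) <= `|s - t|.
Proof.
rewrite cay.unlock; set x := ii * rc (s / 2); set y := ii * rc (t / 2).
have dx : 1 - x != 0 := cay_den_neq0 _.
have dy : 1 - y != 0 := cay_den_neq0 _.
have -> : (1 + x) / (1 - x) - (1 + y) / (1 - y) = (x - y) * 2 / ((1 - x) * (1 - y)).
  by field; rewrite dx dy.
have -> : (x - y) * 2 = ii * rc (s - t) by rewrite /x /y !iir; cplx; field.
rewrite ncM nc_iir ncV ncM; have := nc_cay_den (t / 2); have := nc_cay_den (s / 2).
rewrite -/x -/y => h1 h2; have h3 : 1 <= nc (1 - x) * nc (1 - y) by nra.
by rewrite ler_pdivrMr ?(lt_le_trans ltr01)// ler_peMr.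
Qed.

Lemma cay_surj (w : Cx R) : nc w = 1 -> nc (w - 1) <= 1 ->
  exists2 t, cay t = w & `|t| <= 2 * nc (w - 1).
Proof.
case: w => a b h1 h2.
have hab : a ^+ 2 + b ^+ 2 = 1.
  by have := nc_sqr (Complex a b : Cx R); rewrite h1 expr1n /= => <-.
have a0 : 0 <= a.
  have := le_trans (nc_Re _) h2; rewrite /= ler_norml; lra.
have a1 : 1 + a != 0 by rewrite gt_eqF//; lra.
pose t := 2 * (b / (1 + a)).
exists t.
  rewrite cay.unlock; have -> : t / 2 = b / (1 + a) by rewrite /t; field.
  apply: (mulIf (cay_den_neq0 (b / (1 + a)))); rewrite divfK ?cay_den_neq0//.
  have key : b * (b / (1 + a)) = 1 - a.
    by rewrite mulrA; apply: (mulIf a1); rewrite divfK//; nra.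
  rewrite iir; apply/eqP; rewrite eq_complex /=; apply/andP; split; apply/eqP.
    by rewrite addr0 subr0 mulr1 sub0r mulrN opprK key; ring.
  by rewrite add0r oppr0 sub0r; field.
rewrite /t normrM [`|2|]ger0_norm// ler_pM2l//.
have := nc_Im ((Complex a b : Cx R) - 1); rewrite /= subr0 => hb.
rewrite (le_trans _ hb)// normrM normfV [`|1 + a|]ger0_norm; last by lra.
by rewrite ler_pdivrMr ?ler_peMr//; lra.
Qed.

Lemma cay0 : cay 0 = 1 :> Cx R.
Proof. by rewrite cay.unlock mul0r (_ : rc 0 = 0)// mulr0 addr0 subr0 divr1. Qed.

End Cayley.

Section SecondOrder.
Context {R : realType}.
Implicit Types (l : Cx R).

(** The real and the imaginary axes of C. *)
Definition axis (l : Cx R) := exists a : R, l = rc a \/ l = ii * rc a.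

(** A substitute for the complex exponential, correct up to order 2 along the two
    axes, and with the right modulus everywhere. *)
Definition Ec (l : Cx R) : Cx R := rc (expR (complex.Re l)) * cay (complex.Im l).

Lemma nc_Ec l : nc (Ec l) = expR (complex.Re l).
Proof. by rewrite /Ec ncM nc_cay mulr1 nc_rc ger0_norm// expR_ge0. Qed.

Lemma Ec_rc (a : R) : Ec (rc a) = rc (expR a).
Proof. by rewrite /Ec /= cay0 mulr1. Qed.

Lemma Ec_iir (t : R) : Ec (ii * rc t) = cay t.
Proof. by rewrite /Ec iir /= expR0 (_ : rc 1 = 1)// mul1r. Qed.

Lemma axisZ (a : R) l : axis l -> axis (rc a * l).
Proof.
by move=> [b [->|->]]; exists (a * b); [left|right]; rewrite ?iir; cplx.
Qed.

Lemma Ec_taylor2 l : axis l -> nc l <= 2^-1 ->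
  nc (Ec l - (1 + l + l ^+ 2 / 2)) <= 2 * nc l ^+ 3.
Proof.
move=> [a [->|->]]; rewrite ?nc_iir ?nc_rc => ha.
  rewrite Ec_rc; have -> : rc (expR a) - (1 + rc a + rc a ^+ 2 / 2) =
    rc (expR a - 1 - a - a ^+ 2 / 2).
    have -> : rc a ^+ 2 / 2 = rc (a ^+ 2 / 2).
      have -> : rc (a ^+ 2 / 2) = rc a * rc (a / 2) by cplx; field.
      by rewrite [rc a in LHS]rc_half [rc a in RHS]rc_half; field.
    by cplx.
  by rewrite nc_rc expR_taylor2.
rewrite Ec_iir; have -> : cay a - (1 + ii * rc a + (ii * rc a) ^+ 2 / 2) =
  cay a - 1 - ii * rc a + rc (a ^+ 2 / 2).
  have [x [_ -> _ _ [_ ->]]] := cay_half a.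
  by field.
rewrite (le_trans (cay_taylor2 _))//.
have : 0 <= `|a| ^+ 3 by rewrite exprn_ge0. by lra.
Qed.

(** Along the two axes, q has the expansion c0 + c1 l + c2 l^2 + O(|l|^3). *)
Definition second_order (q : Cx R -> Cx R) (c0 c1 c2 : Cx R) := exists K d : R,
  [/\ 0 <= K, 0 < d <= 1 & forall l, axis l -> nc l <= d ->
    nc (q l - (c0 + c1 * l + c2 * l ^+ 2)) <= K * nc l ^+ 3].

Lemma second_order_poly c0 c1 c2 : second_order (fun l => c0 + c1 * l + c2 * l ^+ 2) c0 c1 c2.
Proof.
exists 0, 1; split=> //; first by rewrite ltr01 lexx.
by move=> l _ _; rewrite subrr nc0 mul0r.
Qed.

Lemma second_order_cst c : second_order (fun=> c) c 0 0.
Proof.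
exists 0, 1; split=> //; first by rewrite ltr01 lexx.
by move=> l _ _; rewrite !mul0r !addr0 subrr nc0.
Qed.

Lemma second_order_eq q c0 c1 c2 d0 d1 d2 : second_order q c0 c1 c2 -> c0 = d0 -> c1 = d1 -> c2 = d2 ->
  second_order q d0 d1 d2.
Proof. by move=> h <- <- <-. Qed.

Lemma second_orderD q1 q2 a0 a1 a2 b0 b1 b2 : second_order q1 a0 a1 a2 -> second_order q2 b0 b1 b2 ->
  second_order (fun l => q1 l + q2 l) (a0 + b0) (a1 + b1) (a2 + b2).
Proof.
move=> [K1 [d1 [K10 /andP[d10 d11] h1]]] [K2 [d2 [K20 /andP[d20 d21] h2]]].
exists (K1 + K2), (Num.min d1 d2); split; first exact: addr_ge0.
  by rewrite lt_min d10 d20 ge_min d11.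
move=> l al; rewrite le_min => /andP[l1 l2].
set A := q1 l; set B := q2 l.
have -> : A + B - (a0 + b0 + (a1 + b1) * l + (a2 + b2) * l ^+ 2) =
  (A - (a0 + a1 * l + a2 * l ^+ 2)) + (B - (b0 + b1 * l + b2 * l ^+ 2)) by ring.
by rewrite (le_trans (ncD _ _))// mulrDl lerD ?h1 ?h2.
Qed.

Lemma second_orderM q1 q2 a0 a1 a2 b0 b1 b2 : second_order q1 a0 a1 a2 -> second_order q2 b0 b1 b2 ->
  second_order (fun l => q1 l * q2 l) (a0 * b0) (a0 * b1 + a1 * b0) (a0 * b2 + a1 * b1 + a2 * b0).
Proof.
move=> [K1 [d1 [K10 /andP[d10 d11] h1]]] [K2 [d2 [K20 /andP[d20 d21] h2]]].
pose MA := nc a0 + nc a1 + nc a2; pose MB := nc b0 + nc b1 + nc b2.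
have MA0 : 0 <= MA by rewrite !addr_ge0 ?nc_ge0.
have MB0 : 0 <= MB by rewrite !addr_ge0 ?nc_ge0.
pose C := nc (a1 * b2 + a2 * b1) + nc (a2 * b2).
have C0 : 0 <= C by rewrite addr_ge0 ?nc_ge0.
exists (C + MA * K2 + K1 * (MB + K2)), (Num.min d1 d2); split.
- apply: addr_ge0; last by apply: mulr_ge0 => //; exact: addr_ge0.
  by apply: addr_ge0 => //; exact: mulr_ge0.
- by rewrite lt_min d10 d20 ge_min d11.
move=> l al; rewrite le_min => /andP[l1 l2].
have l0 := nc_ge0 l; have ll1 : nc l <= 1 by rewrite (le_trans l1).
have l3 : nc l ^+ 3 <= 1 by rewrite exprn_ile1.
have ll2 : nc l ^+ 2 <= 1 by rewrite exprn_ile1.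
have l30 : 0 <= nc l ^+ 3 by rewrite exprn_ge0.
have quad c0 c1 c2 : nc (c0 + c1 * l + c2 * l ^+ 2) <= nc c0 + nc c1 + nc c2.
  rewrite (le_trans (ncD _ _))// lerD//; last first.
    by rewrite expr2 !ncM -expr2 ler_piMr ?nc_ge0.
  by rewrite (le_trans (ncD _ _))// lerD// ncM ler_piMr ?nc_ge0.
have {}h1 := h1 l al l1; have {}h2 := h2 l al l2.
have qA := quad a0 a1 a2; have qB := quad b0 b1 b2.
move: h1 h2 qA qB; rewrite -/MA -/MB.
set A := q1 l; set B := q2 l; set PA := a0 + _ + _; set PB := b0 + _ + _ => h1 h2 qA qB.
have -> : A * B - (a0 * b0 + (a0 * b1 + a1 * b0) * l + (a0 * b2 + a1 * b1 + a2 * b0) * l ^+ 2) =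
  (a1 * b2 + a2 * b1 + a2 * b2 * l) * (l * l * l) + PA * (B - PB) + (A - PA) * (PB + (B - PB)).
  by rewrite /PA /PB; ring.
rewrite (le_trans (ncD _ _))// (le_trans (lerD (ncD _ _) (lexx _)))// !ncM.
have e3 : nc l * nc l * nc l = nc l ^+ 3 by rewrite !exprS expr0 mulr1 mulrA.
rewrite e3; set L := nc l ^+ 3 in h1 h2 l3 l30 e3 *.
have t1 : nc (a1 * b2 + a2 * b1 + a2 * b2 * l) * L <= C * L.
  rewrite ler_wpM2r// (le_trans (ncD _ _))// lerD// ncM ler_piMr ?nc_ge0//.
have t2 : nc PA * nc (B - PB) <= MA * K2 * L.
  by rewrite -mulrA ler_pM ?nc_ge0.
have t3 : nc (A - PA) * nc (PB + (B - PB)) <= K1 * (MB + K2) * L.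
  rewrite mulrAC ler_pM ?nc_ge0// (le_trans (ncD _ _))// lerD// (le_trans h2)//.
  by rewrite ler_piMr.
by rewrite !mulrDl in t1 t2 t3 *; lra.
Qed.

Lemma second_order_Ec (a : R) : second_order (fun l => Ec (rc a * l)) 1 (rc a) (rc a ^+ 2 / 2).
Proof.
exists (2 * `|a| ^+ 3), (1 / (2 * (1 + `|a|))).
have a0 := normr_ge0 a.
split; first by rewrite mulr_ge0// exprn_ge0.
  rewrite divr_gt0//= ?ler_pdivrMr; lra.
move=> l al; rewrite ler_pdivlMr; last by lra.
move=> hl; have l0 := nc_ge0 l.
have -> : 1 + rc a * l + rc a ^+ 2 / 2 * l ^+ 2 = 1 + rc a * l + (rc a * l) ^+ 2 / 2.
  by rewrite exprMn mulrAC.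
have := Ec_taylor2 (axisZ a al); rewrite ncM nc_rc => h.
apply: (le_trans (h _)); first by nra.
by rewrite exprMn mulrA.
Qed.

Lemma second_order_lip q c0 c1 c2 : second_order q c0 c1 c2 -> exists K d : R,
  [/\ 0 <= K, 0 < d & forall l, axis l -> nc l <= d -> nc (q l - c0) <= K * nc l].
Proof.
move=> [K [d [K0 /andP[d0 d1] h]]]; exists (nc c1 + nc c2 + K), d; split=> //.
  by rewrite !addr_ge0 ?nc_ge0.
move=> l al ld; have l0 := nc_ge0 l; have l1 := le_trans ld d1.
have -> : q l - c0 = c1 * l + c2 * l ^+ 2 + (q l - (c0 + c1 * l + c2 * l ^+ 2)) by ring.
rewrite (le_trans (ncD _ _))// (le_trans (lerD (ncD _ _) (h l al ld)))// !mulrDl !expr2 !ncM.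
have l2 : nc l * nc l <= nc l by rewrite ler_piMl.
rewrite !lerD//; first by rewrite ler_wpM2l ?nc_ge0.
rewrite ler_wpM2l// !exprS expr0 mulr1; nra.
Qed.

(** The value of f along a curve expanded to order 2.  The contribution Q of the
    second derivatives of f does not depend on the second-order term w2 of the
    curve. *)
Lemma second_order_ev n (f : mpoly n (Cx R)) (z w1 : 'rV[Cx R]_n) : exists Q,
  forall (w2 : 'rV[Cx R]_n) (W : Cx R -> 'rV[Cx R]_n),
  (forall k, second_order (fun l => W l 0 k) (z 0 k) (w1 0 k) (w2 0 k)) ->
  second_order (fun l => ev f (W l)) (ev f z) (differential f z w1) (differential f z w2 + Q).
Proof.
elim/mpoly_ring_ind: f => [c|i|f g [Q1 h1] [Q2 h2]|f g [Q1 h1] [Q2 h2]].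
- exists 0 => w2 W hW; under eq_fun do rewrite evC.
  by apply: second_order_eq (second_order_cst c) _ _ _; rewrite ?evC ?differentialC ?addr0.
- exists 0 => w2 W hW; under eq_fun do rewrite evX.
  by apply: second_order_eq (hW i) _ _ _; rewrite ?evX ?differentialX ?addr0.
- exists (Q1 + Q2) => w2 W hW; under eq_fun do rewrite evD.
  apply: second_order_eq (second_orderD (h1 _ _ hW) (h2 _ _ hW)) _ _ _; rewrite ?evD ?differentialD//.
  by rewrite addrACA.
- exists (ev g z * Q1 + ev f z * Q2 + differential f z w1 * differential g z w1) => w2 W hW.
  under eq_fun do rewrite evM.
  by apply: second_order_eq (second_orderM (h1 _ _ hW) (h2 _ _ hW)) _ _ _; rewrite ?evM ?differentialM//; ring.
Qed.

End SecondOrder.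

(** * Critical points of Log *)

Section LogJacobian.
Context {R : realType} {n : nat}.
Implicit Types (z w : 'rV[Cx R]_n) (u : 'rV[R]_(n + n)).

Lemma real_coordK w : of_real_coord (real_coord w) = w.
Proof.
apply/rowP => k; rewrite !mxE; case: split_ordP => i /eqP; rewrite ?eq_lrshift ?eq_rlshift ?eq_lshift//.
move=> /eqP <-; case: split_ordP => i' /eqP; rewrite ?eq_lrshift ?eq_rlshift ?eq_rshift//.
by move=> /eqP <-; rewrite !mxE; case: (w 0 k).
Qed.

Lemma is_derive_ln_sqrt (s : R) : 0 < s ->
  is_derive s 1 (fun t => ln (Num.sqrt t)) (2 * s)^-1.
Proof.
move=> s0; have r0 : 0 < Num.sqrt s by rewrite sqrtr_gt0.
have h := @is_derive1_comp R (@ln R) Num.sqrt s _ _ (is_derive1_ln r0) (is_derive1_sqrt s0).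
apply: is_derive_eq.
rewrite -[X in _ = (2 * X)^-1](sqr_sqrtr (ltW s0)).
by field; rewrite gt_eqF.
Qed.

Lemma is_diff_coord m (x : 'rV[R]_m) k :
  is_diff x (fun y : 'rV[R]_m => y 0 k) (fun y => y 0 k).
Proof.
have @f : {linear 'rV[R]_m -> R}.
  by exists (fun N : 'rV[R]_m => N 0 k); do 2![eexists]; do ?[constructor];
     rewrite ?mxE// => ? *; rewrite ?mxE//; move=> ?; rewrite !mxE.
rewrite (_ : (fun _ => _) = f)//; apply: DiffDef.
  exact/linear_differentiable/coord_continuous.
by rewrite diff_lin//; exact: coord_continuous.
Qed.

Lemma is_diff_Log_coord (x : 'rV[R]_(n + n)) (k : 'I_n) :
  0 < x 0 (lshift n k) ^+ 2 + x 0 (rshift n k) ^+ 2 ->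
  is_diff x (fun u : 'rV[R]_(n + n) => ln (nc ((of_real_coord u) 0 k)))
   (fun u => (x 0 (lshift n k) * u 0 (lshift n k) + x 0 (rshift n k) * u 0 (rshift n k))
     / (x 0 (lshift n k) ^+ 2 + x 0 (rshift n k) ^+ 2)).
Proof.
move=> s0; set s := _ + _ in s0 *.
pose a u := u 0 (lshift n k); pose b u := u 0 (rshift n k).
have da : is_diff x a a := is_diff_coord _ _.
have db : is_diff x b b := is_diff_coord _ _.
have dg : is_diff x (a ^+ 2 + b ^+ 2 : _ -> R) _ := is_diffD (is_diffX _ _) (is_diffX _ _).
have gx : (a ^+ 2 + b ^+ 2) x = s by [].
have dh := is_derive_ln_sqrt s0.
have dh' : differentiable (fun t => ln (Num.sqrt t) : R) ((a ^+ 2 + b ^+ 2) x).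
  by rewrite gx; apply/derivable1_diffP; case: dh.
have -> : (fun u : 'rV[R]_(n + n) => ln (nc ((of_real_coord u) 0 k))) =
   (fun t => ln (Num.sqrt t)) \o (a ^+ 2 + b ^+ 2).
  by apply/funext => u /=; rewrite nc.unlock mxE.
have [ddg Eg] := dg.
apply: DiffDef; first exact: differentiable_comp.
rewrite diff_comp// Eg deriv1E; last by rewrite gx; case: dh.
rewrite derive1E gx (@derive_val _ _ _ _ _ _ _ dh).
apply/funext => u /=; rewrite /GRing.scale /= !fctE /=.
rewrite !expr1 /GRing.scale /= -/(a x) -/(b x) -/(a u) -/(b u).
by field; rewrite gt_eqF.
Qed.

(** The differential of Log at z sends h to (Re (h_k / z_k))_k. *)
Lemma jacobian_Log z u : (forall k, z 0 k != 0) ->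
  u *m jacobian (Log \o of_real_coord) (real_coord z) =
  \row_k complex.Re ((of_real_coord u) 0 k / z 0 k).
Proof.
move=> z0; set x := real_coord z.
have xl k : x 0 (lshift n k) = complex.Re (z 0 k) by rewrite /x /real_coord row_mxEl mxE.
have xr k : x 0 (rshift n k) = complex.Im (z 0 k) by rewrite /x /real_coord row_mxEr mxE.
have s0 k : 0 < x 0 (lshift n k) ^+ 2 + x 0 (rshift n k) ^+ 2.
  rewrite xl xr; have := z0 k; rewrite -nc_gt0 nc.unlock; case: (z 0 k) => a b /=.
  by rewrite sqrtr_gt0.
have dk k := is_diff_Log_coord (s0 k).
have EL : (Log \o of_real_coord : 'rV[R]_(n + n) -> 'rV[R]_n) =
  \sum_(k < n) (fun u : 'rV[R]_(n + n) => ln (nc ((of_real_coord u) 0 k)) *: delta_mx 0 k).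
  apply/funext => y; rewrite fct_sumE; apply/rowP => k; rewrite mxE summxE (bigD1 k)//= big1 => [|i ik].
    by rewrite !mxE !eqxx addr0 mulr1 nc.unlock.
  by rewrite !mxE eqxx eq_sym (negbTE ik) mulr0.
have dL : differentiable (Log \o of_real_coord) x.
  rewrite EL; apply: differentiable_sum => k; apply: differentiableZl.
  by case: (dk k).
rewrite -deriveEjacobian// derive_mx; last exact: diff_derivable.
apply/rowP => k; rewrite !mxE.
have -> : (fun t => (Log \o of_real_coord) t 0 k) =
  (fun u : 'rV[R]_(n + n) => ln (nc ((of_real_coord u) 0 k))).
  by apply/funext => y; rewrite /= mxE nc.unlock.
rewrite deriveE; last by case: (dk k).
have [_ ->] := dk k.
rewrite xl xr; have := s0 k; rewrite xl xr.
case: (z 0 k) => a b /= ab.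
by field; rewrite gt_eqF.
Qed.

End LogJacobian.

Section CriticalPoints.
Context {R : realType} {n : nat}.
Implicit Types (f : mpoly n (Cx R)) (z : 'rV[Cx R]_n).

(** The homogeneous coordinates z_k df/dz_k of the logarithmic Gauss map. *)
Definition gauss f z (k : 'I_n) : Cx R := z 0 k * ev (mderiv k f) z.

Lemma gradE f z k : (grad f z) 0 k = ev (mderiv k f) z.
Proof. by rewrite mxE ev.unlock. Qed.

Lemma grad_neq0 f z : grad f z != 0 -> exists k, ev (mderiv k f) z != 0.
Proof.
move=> h; apply: contrapT => hn; move: h; rewrite (_ : grad f z = 0) ?eqxx//.
apply/rowP => k; rewrite gradE mxE; apply/eqP/negPn/negP => hk.
by apply: hn; exists k.
Qed.

(** A linear form B vanishes on the kernel of g exactly when it is proportional to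
    g. *)
Lemma kermx_col_eq0 (g : 'rV[Cx R]_n) (B : 'cV[Cx R]_n) (j : 'I_n) : g 0 j != 0 ->
  kermx g^T *m B = 0 <-> forall k, B k 0 = g 0 k * (B j 0 / g 0 j).
Proof.
move=> gj; split=> [h k|h].
  pose t : 'rV[Cx R]_n := g 0 j *: delta_mx 0 k - g 0 k *: delta_mx 0 j.
  have dg i (M : 'cV[Cx R]_n) : (delta_mx 0 i : 'rV[Cx R]_n) *m M = (M i 0)%:M.
    by rewrite -rowE; apply/matrixP => a b; rewrite !ord1 !mxE eqxx mulr1n.
  have tg : t *m g^T = 0.
    rewrite /t mulmxBl -!scalemxAl !dg !mxE.
    by apply/matrixP => a b; rewrite !ord1 !mxE eqxx !mulr1n mulrC subrr.
  have /submxP[D tD] : (t <= kermx g^T)%MS by apply/sub_kermxP.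
  have : t *m B = 0 by rewrite tD -mulmxA h mulmx0.
  rewrite /t mulmxBl -!scalemxAl !dg => /matrixP/(_ 0 0).
  rewrite !mxE eqxx !mulr1n => /eqP; rewrite subr_eq0 => /eqP e.
  apply: (mulfI gj); rewrite e [in RHS]mulrCA; congr (_ * _).
  by rewrite mulrCA mulfV// mulr1.
have -> : B = (B j 0 / g 0 j) *: g^T.
  by apply/colP => k; rewrite !mxE h mulrC.
by rewrite -scalemxAr mulmx_ker scaler0.
Qed.

Lemma rank_ltP m (A : 'M[R]_(m, n)) :
  (\rank A < n)%N <-> exists2 e : 'rV[R]_n, e != 0 & A *m e^T = 0.
Proof.
split=> [h|[e e0 h]].
  have k0 : kermx A^T != 0 by rewrite kermx_eq0 -row_leq_rank mxrank_tr -ltnNge.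
  exists (nz_row (kermx A^T)); first by rewrite nz_row_eq0.
  apply: trmx_inj; rewrite trmx_mul trmxK trmx0; apply/sub_kermxP.
  exact: nz_row_sub.
rewrite ltnNge -mxrank_tr row_leq_rank -kermx_eq0; apply/negP => /eqP k0.
have : (e <= kermx A^T)%MS.
  by apply/sub_kermxP; apply: trmx_inj; rewrite trmx_mul trmxK trmx0.
by rewrite k0 submx0 (negbTE e0).
Qed.

(** Being stable under multiplication by i, the complex tangent space is killed by
    the form sum_k e_k h_k / z_k as soon as it is killed by its real part. *)
Lemma Log_jacobian_kerP f z (e : 'rV[R]_n) : (forall k, z 0 k != 0) ->
  Log_jacobian f z *m e^T = 0 <->
  tangent_space f z *m (\col_k (rc (e 0 k) / z 0 k)) = 0.
Proof.
move=> z0; rewrite /Log_jacobian; set T := tangent_space f z; set J := jacobian _ _.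
set B := \col_k _.
have key (t : 'rV[Cx R]_n) : (real_coord t *m J *m e^T) 0 0 = complex.Re ((t *m B) 0 0).
  rewrite jacobian_Log// !mxE.
  have -> : complex.Re (\sum_k t 0 k * B k 0) = \sum_k complex.Re (t 0 k * B k 0).
    by apply: (big_morph (@complex.Re R)) => // -[a b] [c d].
  apply: eq_bigr => k _; rewrite real_coordK !mxE.
  have -> : t 0 k * (rc (e 0 k) / z 0 k) = t 0 k / z 0 k * rc (e 0 k) by rewrite mulrCA mulrC.
  by case: (_ / _) => a b /=; rewrite mulr0 subr0.
have rowl i : row (lshift n i) (real_span T) = real_coord (row i T).
  rewrite /real_span /real_coord rowKu; apply/rowP => k; rewrite !mxE.
  by case: splitP => j _; rewrite !mxE.
have rowr i : row (rshift n i) (real_span T) = real_coord ((Complex 0 1 : Cx R) *: row i T).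
  rewrite /real_span /real_coord rowKd; apply/rowP => k; rewrite !mxE.
  by case: splitP => j _; rewrite !mxE.
have kr i : (real_span T *m J *m e^T) i 0 = (row i (real_span T) *m J *m e^T) 0 0.
  by rewrite -!row_mul [RHS]mxE.
have kB i : (T *m B) i 0 = (row i T *m B) 0 0 by rewrite -row_mul [RHS]mxE.
split=> [h|h].
  apply/colP => i; rewrite [RHS]mxE kB; apply/eqP; rewrite eq_complex; apply/andP; split.
    by rewrite -key -rowl -kr h mxE.
  have := key ((Complex 0 1 : Cx R) *: row i T).
  rewrite -rowr -kr h mxE -scalemxAl mxE.
  by case: (_ 0 0) => a b /=; rewrite mul0r mul1r sub0r => /eqP; rewrite eq_sym oppr_eq0.
have hB i : (row i T *m B) 0 0 = 0 by rewrite -kB h mxE.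
apply/colP => i; rewrite [RHS]mxE kr.
case: (split_ordP i) => j ->.
  by rewrite rowl key hB.
by rewrite rowr key -scalemxAl mxE hB mulr0.
Qed.

(** A smooth point of V is a critical point of Log if and only if its image by the
    logarithmic Gauss map is a real point of the projective space. *)
Lemma Critp_gauss f z : Critp f z <-> smooth_point f z /\
  exists2 e : 'rV[R]_n, e != 0 & exists c : Cx R, forall k, rc (e 0 k) = c * gauss f z k.
Proof.
split=> -[sm h]; split=> //; have [[z0 fz] gz] := sm.
  have [j gj] := grad_neq0 gz; rewrite -gradE in gj.
  move/rank_ltP: h => [e e0 /(Log_jacobian_kerP _ _ z0)].
  move=> /(kermx_col_eq0 _ gj) h; exists e => //.
  pose B : 'cV[Cx R]_n := \col_k (rc (e 0 k) / z 0 k).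
  exists (B j 0 / grad f z 0 j) => k; have := h k; rewrite [in LHS]mxE -/B => E.
  rewrite /gauss -gradE mulrCA [_ * grad f z 0 k]mulrC -E.
  by rewrite mulrCA mulfV// mulr1.
have [j gj] := grad_neq0 gz; rewrite -gradE in gj.
move: h => [e e0 [c h]]; apply/rank_ltP; exists e => //.
apply/(Log_jacobian_kerP _ _ z0)/(kermx_col_eq0 _ gj) => k.
have hB i : (\col_k (rc (e 0 k) / z 0 k)) i 0 = rc (e 0 i) / z 0 i by rewrite mxE.
rewrite !hB !h /gauss -!gradE.
have zk := z0 k; have zj := z0 j.
by field; rewrite zk zj gj.
Qed.

End CriticalPoints.

(** * Functions of the logarithmic coordinates *)

Section LocallyLipschitz.
Context {R : realType} {n : nat}.
Implicit Types (z w : 'rV[Cx R]_n) (g h : 'rV[Cx R]_n -> R).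

(** The k-th coordinate of Log z. *)
Definition lg z (k : 'I_n) : R := ln (nc (z 0 k)).

Lemma LogE z k : (Log z) 0 k = lg z k.
Proof. by rewrite mxE /lg nc.unlock. Qed.

(** Calmness of g at z: a Lipschitz estimate with one of the two points fixed. *)
Definition lipat g z := exists L d : R, [/\ 0 <= L, 0 < d &
  forall w, cbox z d w -> `|g w - g z| <= L * dist1 z w].

Lemma lipat_cst (a : R) z : lipat (fun=> a) z.
Proof. by exists 0, 1; split=> // w _; rewrite subrr normr0 mul0r. Qed.

Lemma lipatD g h z : lipat g z -> lipat h z -> lipat (fun w => g w + h w) z.
Proof.
move=> [L1 [d1 [L10 d10 h1]]] [L2 [d2 [L20 d20 h2]]].
exists (L1 + L2), (Num.min d1 d2); split; rewrite ?addr_ge0 ?lt_min ?d10//.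
move=> w hw; have := h1 w (cbox_minl hw); have := h2 w (cbox_minr hw) => k2 k1.
have -> : g w + h w - (g z + h z) = (g w - g z) + (h w - h z) by ring.
by rewrite (le_trans (ler_normD _ _))// mulrDl lerD.
Qed.

Lemma lipatZ (a : R) g z : lipat g z -> lipat (fun w => a * g w) z.
Proof.
move=> [L [d [L0 d0 h]]]; exists (`|a| * L), d; split; rewrite ?mulr_ge0//.
move=> w hw; rewrite -mulrBr normrM -mulrA ler_wpM2l//; exact: h.
Qed.

Lemma lipatN g z : lipat g z -> lipat (fun w => - g w) z.
Proof.
move=> /(lipatZ (-1)); congr (lipat _ z); apply/funext => w; exact: mulN1r.
Qed.

Lemma lipatB g h z : lipat g z -> lipat h z -> lipat (fun w => g w - h w) z.
Proof. by move=> hg hh; apply: lipatD => //; exact: lipatN. Qed.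

Lemma lipat_norm g z : lipat g z -> lipat (fun w => `|g w|) z.
Proof.
move=> [L [d [L0 d0 h]]]; exists L, d; split=> // w hw.
exact: le_trans (ler_dist_dist _ _) (h w hw).
Qed.

Lemma lipat_sqr g z : lipat g z -> lipat (fun w => g w ^+ 2) z.
Proof.
move=> [L [d [L0 d0 h]]]; have n0 : (0 : R) <= n%:R by rewrite ler0n.
pose M := L * n%:R + 2 * `|g z|; have M0 : 0 <= M by rewrite addr_ge0// mulr_ge0.
exists (M * L), (Num.min d 1); split; rewrite ?mulr_ge0 ?lt_min ?d0 ?ltr01//.
move=> w hw; have hd := h w (cbox_minl hw); have hn := dist1_cbox (cbox_minr hw).
rewrite mulr1 in hn; have D0 := dist1_ge0 z w.
have -> : g w ^+ 2 - g z ^+ 2 = (g w - g z + 2 * g z) * (g w - g z) by ring.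
rewrite normrM -mulrA ler_pM// (le_trans (ler_normD _ _))// normrM [`|2|]ger0_norm// lerD//.
by rewrite (le_trans hd)// ler_wpM2l.
Qed.

Lemma lipat_sum (I : Type) (r : seq I) (P : pred I) (F : I -> 'rV[Cx R]_n -> R) z :
  (forall i, P i -> lipat (F i) z) -> lipat (fun w => \sum_(i <- r | P i) F i w) z.
Proof.
move=> h; elim: r => [|i r ih].
  by under eq_fun do rewrite big_nil; exact: lipat_cst.
have [Pi|nPi] := boolP (P i).
  by under eq_fun do rewrite big_cons Pi; apply: lipatD => //; exact: h.
by under eq_fun do rewrite big_cons (negbTE nPi).
Qed.

Lemma nc_le_dist1 z w k : nc (w 0 k - z 0 k) <= dist1 z w.
Proof.
rewrite dist1.unlock (bigD1 k)//= lerDl sumr_ge0// => i _; exact: nc_ge0.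
Qed.

Lemma lipat_coord (a : Cx R) k z : lipat (fun w => nc (w 0 k - a)) z.
Proof.
exists 1, 1; split=> // w _; rewrite mul1r (le_trans (nc_dist _ _))//.
by rewrite (_ : w 0 k - a - _ = w 0 k - z 0 k) ?nc_le_dist1//; ring.
Qed.

Lemma lipat_dist1 p z : lipat (dist1 p) z.
Proof.
have -> : dist1 p = fun w => \sum_k nc (w 0 k - p 0 k) by apply/funext => w; rewrite dist1.unlock.
by apply: lipat_sum => k _; exact: lipat_coord.
Qed.

Lemma ln_dist (a b m : R) : 0 < m -> m <= a -> m <= b -> `|ln a - ln b| <= `|a - b| / m.
Proof.
have key (x y : R) : 0 < m -> m <= x -> m <= y -> ln x - ln y <= `|x - y| / m.
  move=> m0 mx my; have x0 := lt_le_trans m0 mx; have y0 := lt_le_trans m0 my.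
  rewrite -ln_div ?posrE//.
  have -> : x / y = 1 + (x - y) / y by field; rewrite gt_eqF.
  have q : -1 < (x - y) / y by rewrite ltr_pdivlMr//; lra.
  rewrite (le_trans (le_ln1Dx q))// (le_trans (ler_norm _))// normrM ler_wpM2l//.
  by rewrite gtr0_norm ?invr_gt0// lef_pV2.
move=> m0 ma mb; rewrite ler_norml; apply/andP; split; last exact: key.
by rewrite lerNl opprB distrC key.
Qed.

Lemma lg_dist z w k (m : R) : 0 < m -> m <= nc (z 0 k) -> m <= nc (w 0 k) ->
  `|lg w k - lg z k| <= nc (w 0 k - z 0 k) / m.
Proof.
move=> m0 mz mw; rewrite (le_trans (ln_dist m0 mw mz))// ler_pM2r ?invr_gt0//.
exact: nc_dist.
Qed.

Lemma lipat_lg k z : z 0 k != 0 -> lipat (fun w => lg w k) z.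
Proof.
rewrite -nc_gt0 => zk; have m0 : 0 < nc (z 0 k) / 2 by rewrite divr_gt0.
exists (nc (z 0 k) / 2)^-1, (nc (z 0 k) / 2); split; rewrite ?invr_ge0 ?(ltW m0)//.
move=> w hw; rewrite (@le_trans _ _ (nc (w 0 k - z 0 k) / (nc (z 0 k) / 2)))//.
  apply: lg_dist => //; first by lra.
  have := hw k; have := nc_sub_ge (z 0 k) (w 0 k); rewrite nc_sym; lra.
by rewrite mulrC ler_wpM2l ?nc_le_dist1// invr_ge0 ltW.
Qed.

Lemma lipat_ev (f : mpoly n (Cx R)) z : lipat (fun w => nc (ev f w)) z.
Proof.
have [d d0 hd] := meval_strictly_differentiable f z ltr01.
have [L L0 hL] := differential_bound f z.
exists (1 + L), d; split=> //; first by rewrite addr_ge0// ltW.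
move=> w hw; rewrite (le_trans (nc_dist _ _))// mulrDl.
have := hd z w (cbox_center _ (ltW d0)) hw; have := hL z w.
set D := differential _ _ _ => h1 h2.
rewrite -[X in nc X](subrK D) (le_trans (ncD _ _))// lerD//.
Qed.

Lemma lipat_continuous g z : lipat g z -> {for z, continuous g}.
Proof.
move=> [L [d [L0 d0 h]]]; apply: cbox_continuous => e e0.
have n0 : (0 : R) <= n%:R by rewrite ler0n.
have K0 : 0 < L * n%:R + 1 by rewrite ltr_wpDl// mulr_ge0.
exists (Num.min d (e / 2 / (L * n%:R + 1))) => [|w hw].
  by rewrite lt_min d0 !divr_gt0.
rewrite -ball_normE /= distrC (le_lt_trans (h w (cbox_minl hw)))//.
have hd := dist1_cbox (cbox_minr hw).
rewrite (le_lt_trans (ler_wpM2l L0 hd))//.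
set K := _ + 1 in K0 *; set q := e / 2 / K.
have qK : q * K = e / 2 by rewrite /q divfK// gt_eqF.
have q0 : 0 < q by rewrite !divr_gt0.
have : L * (n%:R * q) <= q * K by rewrite /K; nra.
by rewrite qK; lra.
Qed.

Lemma compact_sublevel (T : topologicalType) (K : set T) (g : T -> R) :
  compact K -> {in K, continuous g} -> compact [set z | K z /\ g z <= 0].
Proof.
move=> cK cg F FF FS; have FK : F K by apply: filterS FS => z [].
have [z [Kz cz]] := cK F FF FK; exists z; split=> //=; split=> //.
rewrite leNgt; apply/negP => gz0.
have nz : nbhs z (g @^-1` [set t | 0 < t]).
  have /cg cgz : z \in K by rewrite inE.
  by apply: cgz; exact: lt_nbhsr.
have [w [[_ w1] w2]] := cz _ _ FS nz.
by move: w2 => /=; rewrite ltNge w1.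
Qed.

End LocallyLipschitz.

Section FirstOrder.
Context {R : realType} {n : nat}.
Implicit Types (f : mpoly n (Cx R)) (z w q : 'rV[Cx R]_n).

(** First-order expansion of f in logarithmic coordinates, uniform near q: if
    w_k = z_k (1 + om_k) up to a small error, then f w - f z is
    sum_k gauss f q k * om_k up to a small error. *)
Lemma log_first_order f q (e : R) : 0 < e -> exists2 d, 0 < d &
  forall z w (om : 'I_n -> Cx R), cbox q d z -> cbox q d w ->
    (forall k, nc (w 0 k - z 0 k - z 0 k * om k) <= d * \sum_i nc (om i)) ->
    nc (ev f w - ev f z - \sum_k gauss f q k * om k) <= e * \sum_i nc (om i).
Proof.
move=> e0; pose B := \sum_k nc (q 0 k); pose G := \sum_k nc (ev (mderiv k f) q).
have B0 : 0 <= B by apply: sumr_ge0 => k _; exact: nc_ge0.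
have G0 : 0 <= G by apply: sumr_ge0 => k _; exact: nc_ge0.
have n0 : (0 : R) <= n%:R by rewrite ler0n.
pose e1 := e / (2 * (B + 1 + n%:R + 1)).
have e10 : 0 < e1 by rewrite divr_gt0// mulr_gt0// ltr_wpDl// !addr_ge0.
have [d1 d10 h1] := meval_strictly_differentiable f q e10.
pose d2 := e / (4 * (G + 1)).
have d20 : 0 < d2 by rewrite divr_gt0// mulr_gt0// ltr_wpDl.
pose d := Num.min (Num.min d1 1) d2.
have dd1 : d <= d1 by rewrite /d !ge_min lexx.
have dd2 : d <= d2 by rewrite /d !ge_min lexx orbT.
have dl1 : d <= 1 by rewrite /d !ge_min lexx !orbT.
have d0 : 0 < d by rewrite !lt_min d10 d20 ltr01.
exists d => // z w om hz hw herr; set S := \sum_i nc (om i) in herr *.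
have S0 : 0 <= S by apply: sumr_ge0 => k _; exact: nc_ge0.
have omS k : nc (om k) <= S.
  by rewrite /S (bigD1 k)//= lerDl sumr_ge0// => i _; exact: nc_ge0.
have zB k : nc (z 0 k) <= B + 1.
  rewrite -[z 0 k](subrK (q 0 k)) (le_trans (ncD _ _))// addrC lerD//.
    by rewrite /B (bigD1 k)//= lerDl sumr_ge0// => i _; exact: nc_ge0.
  exact: le_trans (hz k) dl1.
have hdist : dist1 z w <= (B + 1 + n%:R) * S.
  rewrite dist1.unlock (@le_trans _ _ (\sum_k ((B + 1) * nc (om k) + S)))//.
    apply: ler_sum => k _; rewrite -[w 0 k - z 0 k](subrK (z 0 k * om k)).
    rewrite (le_trans (ncD _ _))// addrC lerD//; first by rewrite ncM ler_wpM2r ?nc_ge0.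
    by rewrite (le_trans (herr k))// ler_piMl.
  rewrite big_split/= -mulr_sumr -/S sumr_const card_ord.
  have -> : S *+ n = n%:R * S by rewrite mulr_natl.
  lra.
have hdiff : nc (differential f q (w - z) - \sum_k gauss f q k * om k) <= G * (d + d) * S.
  rewrite differential.unlock -sumrB (le_trans (nc_sum _ _))//.
  rewrite /G !mulr_suml ler_sum// => k _.
  have -> : ev (mderiv k f) q * (w - z) 0 k - gauss f q k * om k =
    ev (mderiv k f) q * ((w 0 k - z 0 k - z 0 k * om k) + (z 0 k - q 0 k) * om k).
    have -> : (w - z) 0 k = w 0 k - z 0 k by rewrite !mxE.
    by rewrite /gauss; ring.
  rewrite ncM -mulrA ler_wpM2l ?nc_ge0// (le_trans (ncD _ _))//.
  have -> : (d + d) * S = d * S + d * S by ring.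
  rewrite lerD//.
  by rewrite ncM ler_pM ?nc_ge0.
have := h1 z w (cbox_le dd1 hz) (cbox_le dd1 hw).
set D := differential _ _ _ in hdiff * => h2.
have -> : ev f w - ev f z - \sum_k gauss f q k * om k =
  (ev f w - ev f z - D) + (D - \sum_k gauss f q k * om k) by ring.
rewrite (le_trans (ncD _ _))// (le_trans (lerD h2 hdiff))//.
have k1 : e1 * dist1 z w <= e / 2 * S.
  rewrite (le_trans (ler_wpM2l (ltW e10) hdist))// mulrA ler_wpM2r//.
  rewrite /e1; set M := B + 1 + n%:R; have M0 : 0 <= M by rewrite !addr_ge0.
  have -> : e / (2 * (M + 1)) * M = e / 2 * (M / (M + 1)) by field; rewrite gt_eqF// ltr_wpDl.
  rewrite ler_piMr ?divr_ge0 ?(ltW e0)//.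
  by rewrite ler_pdivrMr ?ltr_wpDl// mul1r lerDl.
have k2 : G * (d + d) * S <= e / 2 * S.
  rewrite ler_wpM2r// (@le_trans _ _ (G * (d2 + d2)))//.
    by rewrite ler_wpM2l// lerD.
  have -> : G * (d2 + d2) = e / 2 * (G / (G + 1)).
    by rewrite /d2; field; rewrite gt_eqF// ltr_wpDl.
  rewrite ler_piMr ?divr_ge0 ?(ltW e0)//.
  by rewrite ler_pdivrMr ?ltr_wpDl// mul1r lerDl.
lra.
Qed.

End FirstOrder.

(** * Moving along a branch of V *)

(** Proves that an expression built from nonnegative terms is nonnegative. *)
Ltac pos := repeat first [ assumption | apply: ltW; assumption | apply: nc_ge0
  | apply: normr_ge0 | apply: ler0n | apply: sqr_ge0 | apply: exprn_ge0
  | apply: addr_ge0 | apply: mulr_ge0 | apply: divr_ge0 | done ].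

Section Small.
Context {R : realType}.

(** Finitely many inequalities a r <= b, with b > 0, hold for some r > 0. *)
Lemma small_radius (s : seq (R * R)) : all (fun x => 0 < x.2) s ->
  exists2 r : R, 0 < r & all (fun x => x.1 * r <= x.2) s.
Proof.
elim: s => [|[a b] s ih] /=; first by exists 1.
move=> /andP[b0 hs]; have [r r0 hr] := ih hs.
exists (Num.min r (b / (`|a| + 1))); first by rewrite lt_min r0 divr_gt0// ltr_wpDl.
set q := Num.min _ _; have q0 : 0 < q by rewrite lt_min r0 divr_gt0// ltr_wpDl.
apply/andP; split.
  have h : q * (`|a| + 1) <= b by rewrite -ler_pdivlMr ?ltr_wpDl// /q ge_min lexx orbT.
  have := ler_norm a; nra.
apply/allP => -[x y] xs; have := allP hr _ xs => /= xr; have [x0|x0] := leP 0 x.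
  by rewrite (le_trans _ xr)// ler_wpM2l// /q ge_min lexx.
have /= y0 := allP hs _ xs.
by rewrite (le_trans _ (ltW y0))// mulr_le0_ge0// ltW.
Qed.

Lemma expR_lip (a : R) : `|a| <= 2^-1 -> `|expR a - 1| <= 2 * `|a|.
Proof.
move=> ha; have h2 := expR_taylor1 ha; have a0 := normr_ge0 a.
have h1 : `|a| ^+ 2 <= 2^-1 * `|a| by rewrite expr2 ler_wpM2r.
have -> : expR a - 1 = (expR a - 1 - a) + a by ring.
rewrite (le_trans (ler_normD _ _))//; lra.
Qed.

Lemma finite_min (I : finType) (d : I -> R) : (forall i, 0 < d i) ->
  exists2 r : R, 0 < r & forall i, r <= d i.
Proof.
move=> d0; have [|r r0 hr] := @small_radius [seq (1, d i) | i <- enum I].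
  by apply/allP => _ /mapP[i _ ->] /=.
exists r => // i; have := allP hr (1, d i) (map_f _ (mem_enum _ i)).
by rewrite /= mul1r.
Qed.

(** The function log |1 + a l + b l^2|. *)
Definition ln_quadratic (a b l : Cx R) : R := ln (nc (1 + a * l + b * l ^+ 2)).

(** The sum over the four points r, -r, ir, -ir of the harmonic function
    log |1 + a l + b l^2| is O(r^3): its values at r and -r add up to
    log |1 + w1|, those at ir and -ir to log |1 + w2|, and the terms of order 2 of w1
    and w2 are opposite. *)
Lemma four_log (a b : Cx R) : exists K d : R, [/\ 0 <= K, 0 < d & forall r : R, 0 < r <= d ->
  `|ln_quadratic a b (rc r) + ln_quadratic a b (- rc r) + ln_quadratic a b (ii * rc r) + ln_quadratic a b (- (ii * rc r))| <= K * r ^+ 3].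
Proof.
pose g := 2 * b - a ^+ 2; pose M := nc g + nc (b ^+ 2).
have M0 : 0 <= M by rewrite addr_ge0 ?nc_ge0.
have [|r1 r10 /= /and3P[hr1 hr2 _]] := @small_radius [:: (1, 1); (M, 8^-1)].
  by rewrite /= !andbT ltr01 invr_gt0 ltr0n.
exists (20 * M ^+ 2 + 2 * M), r1; split=> //.
  by rewrite addr_ge0// mulr_ge0// ?sqr_ge0.
move=> r /andP[r0 rr1]; set P := ln_quadratic a b.
have r1' : r <= 1 by lra.
have rM : M * r <= 8^-1 by rewrite (le_trans _ hr2)// ler_wpM2l.
pose w1 := g * rc r ^+ 2 + b ^+ 2 * rc r ^+ 4.
pose w2 := - (g * rc r ^+ 2) + b ^+ 2 * rc r ^+ 4.
have nr k : nc (rc r ^+ k) = r ^+ k.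
  elim: k => [|k ih]; first by rewrite !expr0 nc1.
  by rewrite !exprS ncM ih nc_rc gtr0_norm.
have rr : r ^+ 4 <= r ^+ 2 by rewrite -[4%N]/(2 + 2)%N exprD ler_piMl ?sqr_ge0// exprn_ile1// ltW.
have nw1 : nc w1 <= M * r ^+ 2.
  rewrite (le_trans (ncD _ _))// [nc (g * _)]ncM [nc (b ^+ 2 * _)]ncM !nr mulrDl lerD// ler_wpM2l ?nc_ge0//.
have nw2 : nc w2 <= M * r ^+ 2.
  rewrite (le_trans (ncD _ _))// ncN [nc (g * _)]ncM [nc (b ^+ 2 * _)]ncM !nr mulrDl lerD// ler_wpM2l ?nc_ge0//.
have Mr2 : M * r ^+ 2 <= 8^-1.
  by rewrite expr2 mulrA (le_trans _ rM)// ler_piMr// mulr_ge0// ltW.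
have prod x y w : nc w <= 8^-1 -> x * y = 1 + w -> ln (nc x) + ln (nc y) = ln (nc (1 + w)) :> R.
  move=> hw xy; have w0 : 0 < nc (1 + w).
    by have := nc_sub_ge 1 (- w); rewrite opprK ncN nc1; lra.
  have : x * y != 0 by rewrite xy -nc_gt0.
  rewrite mulf_eq0 negb_or => /andP[x0 y0].
  by rewrite -xy ncM lnM// posrE nc_gt0.
have e1 : P (rc r) + P (- rc r) = ln (nc (1 + w1)).
  rewrite /P /ln_quadratic; apply: prod; first exact: le_trans nw1 Mr2.
  by rewrite /w1 /g; ring.
have e2 : P (ii * rc r) + P (- (ii * rc r)) = ln (nc (1 + w2)).
  rewrite /P /ln_quadratic; apply: prod; first exact: le_trans nw2 Mr2.
  have i2 : (ii * rc r) ^+ 2 = - rc r ^+ 2 by rewrite exprMn [ii ^+ 2]expr2 ii2 mulN1r.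
  rewrite sqrrN; have -> : 1 + a * (ii * rc r) + b * (ii * rc r) ^+ 2 = (1 - b * rc r ^+ 2) + a * (ii * rc r).
    by rewrite i2; ring.
  have -> : 1 + a * - (ii * rc r) + b * (ii * rc r) ^+ 2 = (1 - b * rc r ^+ 2) - a * (ii * rc r).
    by rewrite i2; ring.
  have -> : (1 - b * rc r ^+ 2 + a * (ii * rc r)) * (1 - b * rc r ^+ 2 - a * (ii * rc r)) =
    (1 - b * rc r ^+ 2) ^+ 2 - a ^+ 2 * (ii * rc r) ^+ 2 by ring.
  by rewrite i2 /w2 /g; ring.
have -> : P (rc r) + P (- rc r) + P (ii * rc r) + P (- (ii * rc r)) =
  ln (nc (1 + w1)) + ln (nc (1 + w2)) by rewrite -e1 -e2; ring.
have h1 := ln_nc_1D (le_trans nw1 Mr2); have h2 := ln_nc_1D (le_trans nw2 Mr2).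
have hRe : `|complex.Re w1 + complex.Re w2| <= 2 * M * r ^+ 4.
  have -> : complex.Re w1 + complex.Re w2 = complex.Re (2 * (b ^+ 2 * rc r ^+ 4)).
    have -> : 2 * (b ^+ 2 * rc r ^+ 4) = w1 + w2 by rewrite /w1 /w2; ring.
    by case: (w1) => ? ?; case: (w2).
  rewrite (le_trans (nc_Re _))// [nc (2 * _)]ncM [nc (b ^+ 2 * _)]ncM nr nc2 mulrA ler_wpM2r ?exprn_ge0 ?(ltW r0)//.
  by rewrite ler_wpM2l// /M lerDr nc_ge0.
have q1 : nc w1 ^+ 2 <= M ^+ 2 * r ^+ 4.
  by rewrite (exprM r 2 2) -exprMn lerXn2r// nnegrE ?nc_ge0// mulr_ge0// sqr_ge0.
have q2 : nc w2 ^+ 2 <= M ^+ 2 * r ^+ 4.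
  by rewrite (exprM r 2 2) -exprMn lerXn2r// nnegrE ?nc_ge0// mulr_ge0// sqr_ge0.
have r43 : r ^+ 4 <= r ^+ 3.
  by rewrite [in leLHS]exprS ler_piMl// exprn_ge0// ltW.
have s1 : (20 * M ^+ 2 + 2 * M) * r ^+ 4 <= (20 * M ^+ 2 + 2 * M) * r ^+ 3.
  by rewrite ler_wpM2l// addr_ge0// mulr_ge0// ?sqr_ge0.
apply: le_trans s1; move: h1 h2 hRe; rewrite !ler_norml => /andP[? ?] /andP[? ?] /andP[? ?].
by apply/andP; split; lra.
Qed.

End Small.

Lemma clamp_lip (R : realFieldType) (s t : R) :
  `|Num.min 1 (Num.max 0 s) - Num.min 1 (Num.max 0 t)| <= `|s - t|.
Proof.
pose cl (a : R) := Num.min 1 (Num.max 0 a); rewrite -/(cl s) -/(cl t).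
have cc a : [\/ a <= 0 /\ cl a = 0, 0 <= a <= 1 /\ cl a = a | 1 <= a /\ cl a = 1].
  rewrite /cl; have [a0|a0] := leP a 0.
    by apply: Or31; rewrite (min_idPr ler01).
  have [a1|a1] := leP a 1; [apply: Or32|apply: Or33]; split=> //; try lra.
have h3 := ler_norm (s - t); have h4 := ler_norm (t - s); rewrite distrC in h4.
by case: (cc s) => -[? ->]; case: (cc t) => -[? ->]; rewrite ler_norml; apply/andP; split; lra.
Qed.

(** The data used on V in the polydisc of radius r0 around p: a real multiple eta
    of the Gauss vector, a coordinate j with eta_j != 0 and constants C and B
    such that V is a C-Lipschitz graph over the coordinates other than j, points
    where f is small can be corrected into points of V by moving coordinate j, and
    the moduli of the coordinates lie between r0 and B. *)
Record branch_chart (R : realType) n (f : mpoly n (Cx R)) (p : 'rV[Cx R]_n)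
    (eta : 'I_n -> R) (c : Cx R) (j : 'I_n) (C r0 B : R) : Prop := BranchChart {
  chart_zero : ev f p = 0;
  chart_eta : forall k, rc (eta k) = c * gauss f p k;
  chart_j : eta j != 0;
  chart_C : 1 <= C;
  chart_r : 0 < r0;
  chart_nz : forall z, cbox p r0 z -> forall k, r0 <= nc (z 0 k);
  chart_root : forall z, cbox p r0 z -> ev (mderiv j f) z != 0 /\
    exists2 c', ev f (upd z j c') = 0 & nc (c' - z 0 j) <= C * nc (ev f z);
  chart_graph : forall z w, cbox p r0 z -> cbox p r0 w -> ev f z = 0 -> ev f w = 0 ->
    nc (w 0 j - z 0 j) <= C * \sum_(k | k != j) nc (w 0 k - z 0 k);
  chart_lip : forall z w, cbox p r0 z -> cbox p r0 w -> nc (ev f w - ev f z) <= C * dist1 z w;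
  chart_bound : forall z k, cbox p r0 z -> nc (z 0 k) <= B }.

(** How much larger than a polydisc one has to take the domain of a chart for any
    two points of V in that polydisc, in the same slice, to be joined in the chart;
    see [path_ivt]. *)
Definition ivt_const (R : realType) (n : nat) (C : R) := 5 + C * (C * (n%:R * 4)).

Section Branch.
Context {R : realType} {n : nat}.
Variables (f : mpoly n (Cx R)) (p : 'rV[Cx R]_n) (eta : 'I_n -> R) (c : Cx R).
Variables (j : 'I_n) (C r0 : R).
Variable B : R.
Hypothesis chart : branch_chart f p eta c j C r0 B.

Implicit Types (z w : 'rV[Cx R]_n) (u v y : 'I_n -> R).

Let Heta k : rc (eta k) = c * gauss f p k. Proof. by case: chart. Qed.
Let Hj : eta j != 0. Proof. by case: chart. Qed.
Let C1 : 1 <= C. Proof. by case: chart. Qed.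
Let r00 : 0 < r0. Proof. by case: chart. Qed.
Let Hnz z : cbox p r0 z -> forall k, r0 <= nc (z 0 k). Proof. by case: chart => ? ? ? ? ? h *; exact: h. Qed.
Let Hroot z : cbox p r0 z -> ev (mderiv j f) z != 0 /\
  exists2 c', ev f (upd z j c') = 0 & nc (c' - z 0 j) <= C * nc (ev f z).
Proof. by case: chart => ? ? ? ? ? ? h *; exact: h. Qed.
Let Hlip z w : cbox p r0 z -> cbox p r0 w -> ev f z = 0 -> ev f w = 0 ->
  nc (w 0 j - z 0 j) <= C * \sum_(k | k != j) nc (w 0 k - z 0 k).
Proof. by case: chart => ? ? ? ? ? ? ? h *; exact: h. Qed.
Let Hflip z w : cbox p r0 z -> cbox p r0 w -> nc (ev f w - ev f z) <= C * dist1 z w.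
Proof. by case: chart => ? ? ? ? ? ? ? ? h *; exact: h. Qed.
Let boundB z k : cbox p r0 z -> nc (z 0 k) <= B.
Proof. by case: chart => ? ? ? ? ? ? ? ? ? h; exact: h. Qed.
Let C0 : 0 < C. Proof. exact: lt_le_trans C1. Qed.
Let n0 : (0 : R) <= n%:R. Proof. by rewrite ler0n. Qed.
Let B0 : 0 < B.
Proof.
have h := cbox_center p (ltW r00).
exact: lt_le_trans r00 (le_trans (Hnz h j) (boundB j h)).
Qed.

Local Ltac sec := have ? := r00; have ? := C0; have ? := B0; have ? := n0.

(** The triangle inequality for polydiscs. *)
Lemma cboxD z w (a b : R) : cbox p a z -> cbox z b w -> cbox p (a + b) w.
Proof.
move=> hz hw k; have -> : w 0 k - p 0 k = (z 0 k - p 0 k) + (w 0 k - z 0 k) by ring.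
by rewrite (le_trans (ncD _ _))// lerD.
Qed.

(** From a point z of V to a point of V with prescribed coordinates w_k, k != j. *)
Lemma slice_lift z w : cbox p r0 z -> ev f z = 0 -> cbox p r0 w -> w 0 j = z 0 j ->
  exists2 c', ev f (upd w j c') = 0 & nc (c' - z 0 j) <= C * (C * dist1 z w).
Proof.
move=> hz fz hw wj; have [_ [c' fc hc]] := Hroot hw; exists c' => //.
rewrite -wj (le_trans hc)// ler_wpM2l ?(ltW C0)//.
by have := Hflip hz hw; rewrite fz subr0.
Qed.

(** Any small change of the moduli, the j-th one excepted, is realized on V at a
    proportional distance. *)
Lemma move_moduli : exists2 K, 1 <= K & forall z u d, cbox p (r0 / 2) z -> ev f z = 0 ->
  (forall k, `|u k| <= d) -> K * d <= r0 / 2 ->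
  exists z', [/\ ev f z' = 0, cbox z (K * d) z' &
    forall k, k != j -> lg z' k = lg z k + u k].
Proof.
have X0 : 0 <= C * (C * (n%:R * (2 * B))).
  by do 2 (apply: mulr_ge0; first exact: ltW); rewrite !mulr_ge0// ltW.
have [X EX] : exists X, X = C * (C * (n%:R * (2 * B))) by exists (C * (C * (n%:R * (2 * B)))).
rewrite -EX in X0.
have [K EK] : exists K, K = 1 + r0 + 2 * B + X by exists (1 + r0 + 2 * B + X).
have K1 : 1 <= K.
  by rewrite EK; sec; lra.
exists K => // z u d hz fz hu Kd.
have d0 : 0 <= d by apply: le_trans (hu j).
have d2 : d <= 2^-1.
  have : r0 * d <= K * d by rewrite ler_wpM2r// EK; sec; lra.
  move=> h; have : r0 * d <= r0 * 2^-1 by sec; lra.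
  by rewrite ler_pM2l.
have hz' : cbox p r0 z by apply: cbox_le hz; sec; lra.
pose w : 'rV[Cx R]_n := \row_k (if k == j then z 0 j else z 0 k * rc (expR (u k))).
have hzw : cbox z (2 * B * d) w.
  move=> k; rewrite mxE; case: eqP => [->|_].
    by rewrite subrr nc0 !mulr_ge0// ltW.
  have -> : z 0 k * rc (expR (u k)) - z 0 k = z 0 k * rc (expR (u k) - 1).
    have -> : rc (expR (u k) - 1) = rc (expR (u k)) - 1 by cplx.
    by rewrite mulrBr mulr1.
  rewrite ncM nc_rc; have h1 := expR_lip (le_trans (hu k) d2).
  have h2 : 2 * `|u k| <= 2 * d by rewrite ler_pM2l.
  have -> : 2 * B * d = B * (2 * d) by ring.
  by apply: ler_pM; rewrite ?nc_ge0 ?boundB// (le_trans h1).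
have KB : 2 * B * d <= K * d by rewrite ler_wpM2r// EK; sec; lra.
have hw : cbox p r0 w.
  by apply: cbox_le (cboxD hz hzw); sec; lra.
have wj : w 0 j = z 0 j by rewrite mxE eqxx.
have [c' fc hc] := slice_lift hz' fz hw wj.
exists (upd w j c'); split=> //.
  move=> k; rewrite updE; case: eqP => [->|kj].
    rewrite (le_trans hc)// (@le_trans _ _ (X * d))//.
      have -> : X * d = C * (C * (n%:R * (2 * B * d))) by rewrite EX; ring.
      by rewrite !ler_wpM2l ?(ltW C0)// dist1_cbox.
    by rewrite ler_wpM2r// EK; sec; lra.
  exact: le_trans (hzw k) KB.
move=> k kj; rewrite /lg updE (negbTE kj) mxE (negbTE kj) ncM nc_rc ger0_norm ?expR_ge0//.
by rewrite lnM ?posrE ?expR_gt0// ?expRK// (lt_le_trans r00)// Hnz.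
Qed.

(** Two points of V with the same |z_k| for k != j are joined, within V, by rotating
    these coordinates; along the path log |z_j| takes all intermediate values. *)
Lemma path_ivt e z1 z2 h : ivt_const n C * e <= r0 -> cbox p e z1 -> cbox p e z2 ->
  ev f z1 = 0 -> ev f z2 = 0 -> (forall k, k != j -> lg z1 k = lg z2 k) ->
  lg z1 j <= h <= lg z2 j ->
  exists z, [/\ ev f z = 0, cbox p r0 z, forall k, k != j -> lg z k = lg z1 k & lg z j = h].
Proof.
move=> Ke h1 h2 f1 f2 h12 /andP[hl hu].
have e0 : 0 <= e by apply: le_trans (h1 j); exact: nc_ge0.
have X0 : 0 <= C * (C * (n%:R * 4)) by do 2 (apply: mulr_ge0; first exact: ltW); rewrite mulr_ge0.
have e5 : 5 * e <= r0 by apply: le_trans Ke; rewrite ler_wpM2r// /ivt_const; sec; lra.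
have eX : e + C * (C * (n%:R * (4 * e))) <= r0.
  have -> : C * (C * (n%:R * (4 * e))) = C * (C * (n%:R * 4)) * e by ring.
  by move: Ke; rewrite /ivt_const mulrDl; sec; lra.
have er : e <= r0 by sec; lra.
have h1r := cbox_le er h1; have h2r := cbox_le er h2.
have p1 k : 0 < nc (z1 0 k) by exact: lt_le_trans (Hnz h1r k).
have p2 k : 0 < nc (z2 0 k) by exact: lt_le_trans (Hnz h2r k).
have d12 k : nc (z2 0 k - z1 0 k) <= 2 * e.
  have -> : z2 0 k - z1 0 k = (z2 0 k - p 0 k) - (z1 0 k - p 0 k) by ring.
  by rewrite (le_trans (ncB _ _))//; have := h1 k; have := h2 k; sec; lra.
have /choice[tau htau] : forall k, exists t : R, k != j ->
    z1 0 k * cay t = z2 0 k /\ nc (z1 0 k) * `|t| <= 2 * nc (z2 0 k - z1 0 k).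
  move=> k; have [->|kj] := eqVneq k j; first by exists 0.
  have z10 : z1 0 k != 0 by rewrite -nc_gt0.
  pose om := z2 0 k / z1 0 k.
  have om1 : nc om = 1.
    rewrite /om ncM ncV; have -> : nc (z2 0 k) = nc (z1 0 k).
      by apply: ln_inj; rewrite ?posrE//; have := h12 k kj.
    by rewrite divff// gt_eqF.
  have om2 : nc (om - 1) = nc (z2 0 k - z1 0 k) / nc (z1 0 k).
    by rewrite /om -ncV -ncM; congr nc; field.
  have om3 : nc (om - 1) <= 1.
    rewrite om2 ler_pdivrMr// mul1r (le_trans (d12 k))// (le_trans _ (Hnz h1r k))//; sec; lra.
  have [t ct ht] := cay_surj om1 om3; exists t => _; split.
    by rewrite ct /om mulrCA mulfV// mulr1.
  have -> : 2 * nc (z2 0 k - z1 0 k) = nc (z1 0 k) * (2 * nc (om - 1)).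
    by rewrite om2; field; rewrite gt_eqF.
  by rewrite ler_wpM2l// ltW.
(* The path, before its coordinate j is corrected into a point of V.  Its parameter is
   clamped to [0, 1], which makes Z Lipschitz on the whole line. *)
pose w (t : R) : 'rV[Cx R]_n := \row_k (if k == j then z1 0 j else z1 0 k * cay (t * tau k)).
pose cl (t : R) : R := Num.min 1 (Num.max 0 t).
have clP t : 0 <= cl t <= 1.
  by rewrite /cl le_min ge_min lexx ler01 le_max lexx.
have cl01 t : 0 <= t <= 1 -> cl t = t.
  move=> /andP[t0 t1]; rewrite /cl; have /max_idPr -> := t0.
  by apply/min_idPr.
have cl_lip s t : `|cl s - cl t| <= `|s - t| by exact: clamp_lip.
have cay_bd k s t : k != j -> nc (z1 0 k * cay (s * tau k) - z1 0 k * cay (t * tau k)) <=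
    nc (z1 0 k) * `|tau k| * `|s - t|.
  move=> kj; rewrite -mulrBr ncM -mulrA ler_wpM2l ?nc_ge0// (le_trans (cay_lip _ _))//.
  by rewrite -mulrBl normrM mulrC.
have w1 t : 0 <= t <= 1 -> cbox z1 (4 * e) (w t).
  move=> /andP[t0 t1] k; rewrite mxE; case: (eqVneq k j) => [->|kj].
    by rewrite subrr nc0 mulr_ge0.
  have := cay_bd k t 0 kj; rewrite mul0r cay0 mulr1 subr0 (ger0_norm t0) => h3.
  have [_ h4] := htau k kj; have h5 := d12 k.
  have h6 : 0 <= nc (z1 0 k) * `|tau k| by rewrite mulr_ge0 ?nc_ge0.
  have : nc (z1 0 k) * `|tau k| * t <= nc (z1 0 k) * `|tau k| by rewrite ler_piMr.
  sec; lra.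
have hw t : 0 <= t <= 1 -> cbox p r0 (w t).
  by move=> /w1 h3; apply: cbox_le (cboxD h1 h3); sec; lra.
have wj t : w t 0 j = z1 0 j by rewrite mxE eqxx.
have /choice[Z hZ] : forall t, exists x, ev f (upd (w (cl t)) j x) = 0 /\
    cbox p r0 (upd (w (cl t)) j x).
  move=> t; have [x fx hx] := slice_lift h1r f1 (hw _ (clP t)) (wj _); exists x; split=> // k.
  rewrite updE; case: (eqVneq k j) => [->|kj]; last exact: hw.
  apply: le_trans eX; have -> : x - p 0 j = (z1 0 j - p 0 j) + (x - z1 0 j) by ring.
  rewrite (le_trans (ncD _ _))// lerD//.
  rewrite (le_trans hx)// !ler_wpM2l ?(ltW C0)// dist1_cbox//; exact: w1.
pose L := C * \sum_(k | k != j) nc (z1 0 k) * `|tau k|.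
have Zlip s t : `|nc (Z s) - nc (Z t)| <= L * `|s - t|.
  have [fs bs] := hZ s; have [ft bt] := hZ t.
  have := Hlip bt bs ft fs; rewrite !updE eqxx => hh.
  rewrite (le_trans (nc_dist _ _))// (le_trans hh)// /L -mulrA ler_wpM2l ?(ltW C0)//.
  rewrite mulr_suml ler_sum// => k kj; rewrite !updE (negbTE kj) !mxE (negbTE kj).
  rewrite (le_trans (cay_bd k _ _ kj))// ler_wpM2l ?mulr_ge0 ?nc_ge0//.
have Zuniq t z : ev f z = 0 -> cbox p r0 z -> (forall k, k != j -> z 0 k = w (cl t) 0 k) ->
    Z t = z 0 j.
  move=> fz bz zk; have [ft bt] := hZ t; have := Hlip bz bt fz ft.
  rewrite updE eqxx big1 => [|k kj]; last by rewrite updE (negbTE kj) zk// subrr nc0.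
  rewrite mulr0 => hh; apply/eqP; rewrite -subr_eq0 -nc_eq0 eq_le hh nc_ge0//.
have Z0 : Z 0 = z1 0 j.
  apply: Zuniq => // k kj; rewrite cl01 ?lexx ?ler01// mxE (negbTE kj) mul0r cay0 mulr1//.
have Z1 : Z 1 = z2 0 j.
  apply: Zuniq => // k kj; rewrite cl01 ?lexx ?ler01// mxE (negbTE kj) mul1r.
  by have [] := htau k kj.
have cZ : continuous (fun t => nc (Z t)).
  move=> t A /nbhs_ballP[a /= a0 aA].
  have L0 : 0 <= L by rewrite mulr_ge0 ?(ltW C0)// sumr_ge0// => k _; rewrite mulr_ge0 ?nc_ge0.
  have q0 : 0 < a / (L + 1) by rewrite divr_gt0// ltr_wpDl.
  apply/nbhs_ballP; exists (a / (L + 1)) => //= s; rewrite -ball_normE/= => hh.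
  apply: aA; rewrite -ball_normE/= (le_lt_trans (Zlip _ _))//.
  by move: hh; rewrite ltr_pdivlMr ?ltr_wpDl// => hh; have := normr_ge0 (t - s); nra.
have hv : Num.min (nc (Z 0)) (nc (Z 1)) <= expR h <= Num.max (nc (Z 0)) (nc (Z 1)).
  rewrite Z0 Z1 ge_min le_max.
  have -> : nc (z1 0 j) <= expR h by rewrite -[nc _]lnK ?posrE// ler_expR.
  have -> : expR h <= nc (z2 0 j) by rewrite -[nc (z2 0 j)]lnK ?posrE// ler_expR.
  by rewrite orbT.
have [t _ ht] := IVT ler01 (continuous_subspaceT cZ) hv.
have [ft bt] := hZ t; exists (upd (w (cl t)) j (Z t)); split=> //.
  move=> k kj; rewrite /lg updE (negbTE kj) mxE (negbTE kj) ncM nc_cay mulr1//.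
by rewrite /lg updE eqxx ht expRK.
Qed.

Lemma coef_neq0 : c != 0.
Proof.
apply: contra Hj => /eqP c0; have := Heta j; rewrite c0 mul0r => /eqP.
by rewrite eq_complex /= => /andP[].
Qed.

(** The vectors orthogonal to eta are tangent to V in logarithmic coordinates. *)
Lemma gauss_ortho v : \sum_k eta k * v k = 0 -> \sum_k gauss f p k * rc (v k) = 0.
Proof.
move=> h; apply: (mulfI coef_neq0); rewrite mulr0 mulr_sumr.
have -> : \sum_k c * (gauss f p k * rc (v k)) = \sum_k rc (eta k * v k).
  by apply: eq_bigr => k _; rewrite mulrA -Heta; cplx.
have <- : rc (\sum_k eta k * v k) = \sum_k rc (eta k * v k).
  by apply: (big_morph rc) => // x y; cplx.
by rewrite h.
Qed.

(** A small displacement v of Log z, orthogonal to eta, is realized on V exactly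
    for the coordinates other than j and up to o(|v|) for coordinate j. *)
Lemma tangent_move (e : R) : 0 < e -> exists2 d, 0 < d & forall z v, ev f z = 0 -> cbox p d z ->
  (forall k, `|v k| <= d) -> \sum_k eta k * v k = 0 ->
  exists z', [/\ ev f z' = 0, cbox p e z', forall k, k != j -> lg z' k = lg z k + v k &
    `|lg z' j - (lg z j + v j)| <= e * \sum_k `|v k|].
Proof.
move=> e0; pose e1 := e * r0 / C.
have e10 : 0 < e1 by rewrite /e1 divr_gt0// mulr_gt0.
have [d1 d10 h1] := log_first_order f p e10.
pose M := 1 + 2 * B + C * (e1 * n%:R).
have X0 : 0 <= C * (e1 * n%:R) by pos.
have M1 : 1 <= M by rewrite /M; sec; lra.
have [|d d0 /= /and5P[hd1 hd2 hd3 hd4 _]] := @small_radius _ [:: (M, d1); (M, r0); (M, e); (1, 2^-1)].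
  by rewrite /= d10 r00 e0 invr_gt0 ltr0n.
exists d => // z v fz hz hv ortho; set S := \sum_k `|v k|.
have dM : (1 + 2 * B) * d <= M * d by rewrite ler_wpM2r ?(ltW d0)// /M; lra.
have dle a : M * d <= a -> d <= a.
  by move=> h; apply: le_trans h; rewrite ler_peMl// ltW.
have dr0 := dle _ hd2; have hzr := cbox_le dr0 hz.
pose w : 'rV[Cx R]_n := \row_k (z 0 k * rc (expR (v k))).
have v2 k : `|v k| <= 2^-1 by rewrite (le_trans (hv k))//; lra.
have hzw : cbox z (2 * B * d) w.
  move=> k; rewrite mxE.
  have -> : z 0 k * rc (expR (v k)) - z 0 k = z 0 k * rc (expR (v k) - 1).
    have -> : rc (expR (v k) - 1) = rc (expR (v k)) - 1 by cplx.
    by rewrite mulrBr mulr1.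
  rewrite ncM nc_rc; have h2 := expR_lip (v2 k); have h3 := hv k.
  have -> : 2 * B * d = B * (2 * d) by ring.
  by apply: ler_pM; rewrite ?nc_ge0 ?boundB// (le_trans h2)// ler_pM2l.
have hw : cbox p ((1 + 2 * B) * d) w.
  by rewrite mulrDl mul1r; exact: cboxD hz hzw.
have hwr : cbox p r0 w by apply: cbox_le hw; lra.
have Sn : S <= n%:R * d.
  rewrite /S (le_trans (ler_sum _ (fun k _ => hv k)))//.
  by rewrite sumr_const card_ord mulr_natl.
have vS k : `|v k| <= S.
  by rewrite /S (bigD1 k)//= lerDl sumr_ge0.
have S0 : 0 <= S by apply: sumr_ge0.
have nS : \sum_k nc (rc (v k) : Cx R) = S by apply: eq_bigr => k _; rewrite nc_rc.
have hfw : nc (ev f w) <= e1 * S.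
  have hwd : cbox p d1 w by apply: cbox_le hw; lra.
  have := h1 z w (fun k => rc (v k)) (cbox_le (dle _ hd1) hz) hwd.
  rewrite nS fz gauss_ortho// !subr0; apply=> k; rewrite mxE.
  have -> : z 0 k * rc (expR (v k)) - z 0 k - z 0 k * rc (v k) = z 0 k * rc (expR (v k) - 1 - v k).
    have -> : rc (expR (v k) - 1 - v k) = rc (expR (v k)) - 1 - rc (v k) by cplx.
    by ring.
  rewrite ncM nc_rc (le_trans (ler_pM (nc_ge0 _) (normr_ge0 _) (boundB k hzr) (expR_taylor1 (v2 k))))//.
  rewrite expr2; have -> : B * (2 * (`|v k| * `|v k|)) = 2 * B * `|v k| * `|v k| by ring.
  rewrite ler_pM ?mulr_ge0 ?(ltW B0)//.
  apply: le_trans (_ : 2 * B * d <= _); first by rewrite ler_wpM2l ?mulr_ge0 ?(ltW B0)//; exact: hv.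
  lra.
have [_ [c' fc hc]] := Hroot hwr.
have hc' : nc (c' - w 0 j) <= C * (e1 * S) by rewrite (le_trans hc)// ler_wpM2l ?(ltW C0).
have hbox a : M * d <= a -> cbox p a (upd w j c').
  move=> ha k; apply: le_trans ha; rewrite updE; case: eqP => [->|_]; last exact: le_trans (hw k) dM.
  have -> : c' - p 0 j = (w 0 j - p 0 j) + (c' - w 0 j) by ring.
  have h3 := hw j; have h4 : C * (e1 * S) <= C * (e1 * n%:R) * d.
    have -> : C * (e1 * n%:R) * d = C * (e1 * (n%:R * d)) by ring.
    apply: ler_wpM2l; first exact: ltW.
    by apply: ler_wpM2l => //; exact: ltW.
  by rewrite (le_trans (ncD _ _))// /M mulrDl; lra.
have lgw k : lg w k = lg z k + v k.
  rewrite /lg mxE ncM nc_rc ger0_norm ?expR_ge0// lnM ?posrE ?expR_gt0// ?expRK//.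
  by rewrite (lt_le_trans r00)// Hnz.
exists (upd w j c'); split=> //; first exact: hbox.
  by move=> k kj; rewrite /lg updE (negbTE kj) -/(lg w k).
rewrite -lgw (le_trans (lg_dist r00 (Hnz hwr j) (Hnz (hbox _ hd2) j)))//.
rewrite updE eqxx ler_pdivrMr// (le_trans hc')//.
have -> : C * (e1 * S) = e * S * r0; last by [].
by rewrite /e1; field; rewrite gt_eqF.
Qed.

Lemma gauss_neq0 z : cbox p r0 z -> gauss f z j != 0.
Proof.
move=> hz; have [dj _] := Hroot hz; rewrite /gauss mulf_neq0//.
by rewrite -nc_gt0 (lt_le_trans r00)// Hnz.
Qed.

(** Multiplying z_k by [cay t] and correcting z_j to stay on V keeps |z_i| for all
    i != j, and moves log |z_j| at the speed Im (G_k / G_j), G being the Gauss vector at z. *)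
Lemma rotate_coordinate z k (e : R) : cbox p (r0 / 2) z -> ev f z = 0 -> k != j -> 0 < e ->
  exists2 t0, 0 < t0 & forall t, `|t| <= t0 -> exists z',
   [/\ ev f z' = 0, cbox z e z', forall i, i != j -> lg z' i = lg z i &
    `|lg z' j - lg z j - t * complex.Im (gauss f z k / gauss f z j)| <= e * `|t|].
Proof.
move=> hz fz kj e0; set beta := _ / _; pose b := nc beta.
have b0 : 0 <= b := nc_ge0 _.
have hzr : cbox p r0 z by apply: cbox_le hz; sec; lra.
have gj := gauss_neq0 hzr.
pose e1 := e * r0 / (2 * C * (1 + b)).
have b1 : 0 < 1 + b by rewrite ltr_pwDl.
have e10 : 0 < e1 by rewrite /e1 divr_gt0 ?mulr_gt0.
have [d1 d10 h1] := log_first_order f z e10.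
pose M := B * (1 + b) + C * (e1 * (1 + b)).
have X0 : 0 <= C * (e1 * (1 + b)) by pos.
have Y0 : 0 <= B * b by rewrite mulr_ge0 ?(ltW B0).
have [|t0 t00 /= /and5P[hd1 hd2 hd3 hd4 /andP[hd5 _]]] :=
  @small_radius _ [:: (M, d1); (M, r0 / 2); (M, e); (b, 8^-1); (10 * b ^+ 2, e / 2)].
  by rewrite /= d10 e0 invr_gt0 ltr0n !divr_gt0.
exists t0 => // t tt0; have a0 := normr_ge0 t.
have Mt : M * `|t| <= M * t0 by rewrite ler_wpM2l// /M; sec; lra.
(* The relative variations of the coordinates, tangent to V at z. *)
pose om (i : 'I_n) : Cx R := if i == k then ii * rc t else if i == j then - (ii * rc t * beta) else 0.
pose w : 'rV[Cx R]_n := \row_i (if i == k then z 0 k * cay t else if i == j then z 0 j * (1 + om j) else z 0 i).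
have jk : (j == k) = false by rewrite eq_sym (negbTE kj).
have nomk : nc (om k) = `|t| by rewrite /om eqxx nc_iir.
have nomj : nc (om j) = `|t| * b by rewrite /om jk eqxx ncN ncM nc_iir.
have S : \sum_i nc (om i) = `|t| * (1 + b).
  rewrite (bigD1 k)//= (bigD1 j) ?jk//= big1 => [|i /andP[ik ij]].
    by rewrite nomk nomj; ring.
  by rewrite /om (negbTE ik) (negbTE ij) nc0.
have Sg : \sum_i gauss f z i * om i = 0.
  rewrite (bigD1 k)//= (bigD1 j) ?jk//= big1 => [|i /andP[ik ij]].
    rewrite /om eqxx jk eqxx /beta; move: (gauss f z k) (gauss f z j) gj => x y y0.
    by field.
  by rewrite /om (negbTE ik) (negbTE ij) mulr0.
have zwB : cbox z (B * (1 + b) * `|t|) w.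
  move=> i; rewrite mxE; case: eqP => [->|_].
    have -> : z 0 k * cay t - z 0 k = z 0 k * (cay t - cay 0) by rewrite cay0; ring.
    rewrite ncM (le_trans (ler_pM (nc_ge0 _) (nc_ge0 _) (boundB k hzr) (cay_lip _ _)))// subr0.
    by rewrite ler_wpM2r//; sec; lra.
  case: eqP => [->|_]; last by rewrite subrr nc0; pos.
  have -> : z 0 j * (1 + om j) - z 0 j = z 0 j * om j by ring.
  rewrite ncM nomj (le_trans (ler_wpM2r _ (boundB j hzr))) ?mulr_ge0//.
  have -> : B * (`|t| * b) = B * b * `|t| by ring.
  by rewrite ler_wpM2r//; sec; lra.
have BM : B * (1 + b) * `|t| <= M * `|t| by rewrite ler_wpM2r// /M; lra.
have zw a : M * t0 <= a -> cbox z a w by move=> ha; apply: cbox_le zwB; lra.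
have hwr : cbox p r0 w.
  have -> : r0 = r0 / 2 + r0 / 2 by field.
  exact: cboxD hz (zw _ hd2).
have hfw : nc (ev f w) <= e1 * (`|t| * (1 + b)).
  have := h1 z w om (cbox_center _ (ltW d10)) (zw _ hd1).
  rewrite S fz Sg !subr0; apply=> i; rewrite mxE.
  have R0 : 0 <= d1 * (`|t| * (1 + b)) by pos.
  case: eqP => [->|/eqP ik].
    have -> : z 0 k * cay t - z 0 k - z 0 k * om k = z 0 k * (cay t - 1 - ii * rc t).
      by rewrite /om eqxx; ring.
    rewrite ncM (le_trans (ler_pM (nc_ge0 _) (nc_ge0 _) (boundB k hzr) (cay_taylor1 _)))//.
    rewrite expr2; have -> : B * (`|t| * `|t|) = (B * `|t|) * `|t| by ring.
    have -> : d1 * (`|t| * (1 + b)) = d1 * (1 + b) * `|t| by ring.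
    rewrite ler_wpM2r//.
    have q1 : B * `|t| <= M * `|t| by rewrite ler_wpM2r// /M; sec; lra.
    have q2 : d1 <= d1 * (1 + b) by rewrite ler_peMr ?(ltW d10)//; lra.
    lra.
  case: eqP => [->|/eqP ij].
    have -> : z 0 j * (1 + om j) - z 0 j - z 0 j * om j = 0 by ring.
    by rewrite nc0.
  by rewrite /om (negbTE ik) (negbTE ij) mulr0 !subr0 subrr nc0.
have [_ [c' fc hc]] := Hroot hwr.
have hc' : nc (c' - w 0 j) <= C * (e1 * (1 + b)) * `|t|.
  rewrite (le_trans hc)// (le_trans (ler_wpM2l (ltW C0) hfw))//.
  have -> : C * (e1 * (`|t| * (1 + b))) = C * (e1 * (1 + b)) * `|t| by ring.
  exact: lexx.
have zz a : M * t0 <= a -> cbox z a (upd w j c').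
  move=> ha i; apply: le_trans ha; apply: le_trans Mt.
  rewrite updE; case: eqP => [->|_]; last exact: le_trans (zwB i) BM.
  have -> : c' - z 0 j = (w 0 j - z 0 j) + (c' - w 0 j) by ring.
  by rewrite (le_trans (ncD _ _))// /M mulrDl lerD//.
have hzz : cbox p r0 (upd w j c').
  have -> : r0 = r0 / 2 + r0 / 2 by field.
  exact: cboxD hz (zz _ hd2).
exists (upd w j c'); split=> //; first exact: zz.
  move=> i ij; rewrite /lg updE (negbTE ij) mxE (negbTE ij); case: eqP => [->|//].
  by rewrite ncM nc_cay mulr1.
have w1 : `|lg (upd w j c') j - lg w j| <= e / 2 * `|t|.
  rewrite (le_trans (lg_dist r00 (Hnz hwr j) (Hnz hzz j)))// updE eqxx ler_pdivrMr//.
  rewrite (le_trans hc')//.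
  have -> : C * (e1 * (1 + b)) * `|t| = e / 2 * `|t| * r0; last by [].
  by rewrite /e1; field; rewrite !gt_eqF.
have nz1 : 0 < nc (z 0 j) by rewrite (lt_le_trans r00)// Hnz.
have omj8 : nc (om j) <= 8^-1.
  by rewrite nomj mulrC (le_trans _ hd4)// ler_wpM2l.
have lw : lg w j = lg z j + ln (nc (1 + om j)).
  rewrite /lg mxE jk eqxx ncM lnM ?posrE//.
  by have := nc_sub_ge 1 (- om j); rewrite opprK ncN nc1; lra.
have w2 := ln_nc_1D omj8.
have Reom : complex.Re (om j) = t * complex.Im beta.
  by rewrite /om jk eqxx; case: (beta) => x y /=; ring.
have w3 : 10 * nc (om j) ^+ 2 <= e / 2 * `|t|.
  rewrite nomj; have -> : 10 * (`|t| * b) ^+ 2 = (10 * b ^+ 2 * `|t|) * `|t| by ring.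
  by rewrite ler_wpM2r// (le_trans _ hd5)// ler_wpM2l// mulr_ge0// sqr_ge0.
rewrite -Reom; move: w1 w2; rewrite lw !ler_norml => /andP[? ?] /andP[? ?].
by apply/andP; split; lra.
Qed.

(** A curve in V, approximated to order 2 by an analytic one, along which
    log |z_k| is affine of slope u_k in Re l for k != j, and log |z_j| is the
    logarithm of the modulus of a quadratic polynomial, up to order 3. *)
Lemma second_order_curve z u : cbox p (r0 / 2) z -> ev f z = 0 -> exists (a b : Cx R) (K d : R),
  [/\ 0 <= K, 0 < d & forall l, axis l -> nc l <= d -> exists z',
    [/\ ev f z' = 0, cbox z (K * nc l) z',
      forall k, k != j -> lg z' k = lg z k + complex.Re l * u k &
      `|lg z' j - lg z j - ln_quadratic a b l| <= K * nc l ^+ 3]].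
Proof.
move=> hz fz.
have hzr : cbox p r0 z by apply: cbox_le hz; sec; lra.
have [dj _] := Hroot hzr; set D := ev (mderiv j f) z in dj.
have zj : z 0 j != 0 by rewrite -nc_gt0 (lt_le_trans r00)// Hnz.
(* The values of a and b cancel the terms of order 1 and 2 of f along W. *)
pose a := - (\sum_(k | k != j) ev (mderiv k f) z * (z 0 k * rc (u k))) / (D * z 0 j).
pose w1 : 'rV[Cx R]_n := \row_k (if k == j then z 0 j * a else z 0 k * rc (u k)).
have [Q hQ] := second_order_ev f z w1.
pose b := - (\sum_(k | k != j) ev (mderiv k f) z * (z 0 k * (rc (u k) ^+ 2 / 2)) + Q) / (D * z 0 j).
pose w2 : 'rV[Cx R]_n := \row_k (if k == j then z 0 j * b else z 0 k * (rc (u k) ^+ 2 / 2)).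
pose W (l : Cx R) : 'rV[Cx R]_n := \row_k (if k == j then z 0 j * (1 + a * l + b * l ^+ 2)
  else z 0 k * Ec (rc (u k) * l)).
have hW k : second_order (fun l => W l 0 k) (z 0 k) (w1 0 k) (w2 0 k).
  rewrite !mxE; case: (eqVneq k j) => [->|kj].
    have -> : (fun l => W l 0 j) = (fun l => z 0 j * (1 + a * l + b * l ^+ 2)).
      by apply/funext => l; rewrite mxE eqxx.
    by apply: second_order_eq (second_orderM (second_order_cst (z 0 j)) (second_order_poly 1 a b)) _ _ _; ring.
  have -> : (fun l => W l 0 k) = (fun l => z 0 k * Ec (rc (u k) * l)).
    by apply/funext => l; rewrite mxE (negbTE kj).
  by apply: second_order_eq (second_orderM (second_order_cst (z 0 k)) (second_order_Ec (u k))) _ _ _; ring.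
have D1 : differential f z w1 = 0.
  rewrite (differential_split _ _ j) mxE eqxx.
  have -> : \sum_(k | k != j) ev (mderiv k f) z * w1 0 k =
     \sum_(k | k != j) ev (mderiv k f) z * (z 0 k * rc (u k)).
    by apply: eq_bigr => k kj; rewrite mxE (negbTE kj).
  rewrite /a -/D; set X := \sum_(_ | _) _.
  by field; rewrite dj zj.
have D2 : differential f z w2 + Q = 0.
  rewrite (differential_split _ _ j) mxE eqxx.
  have -> : \sum_(k | k != j) ev (mderiv k f) z * w2 0 k =
     \sum_(k | k != j) ev (mderiv k f) z * (z 0 k * (rc (u k) ^+ 2 / 2)).
    by apply: eq_bigr => k kj; rewrite mxE (negbTE kj).
  rewrite /b -/D; set X := \sum_(_ | _) _.
  by field; rewrite dj zj.
have [Kf [df [Kf0 /andP[df0 df1] hf]]] := hQ w2 W hW.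
rewrite fz D1 D2 in hf.
have /choice[Kk hKk] := fun k => second_order_lip (hW k).
have /choice[dk hdk] := hKk.
have [dm dm0 hdm] : exists2 r : R, 0 < r & forall k, r <= dk k.
  by apply: finite_min => k; have [] := hdk k.
pose KW := \sum_k Kk k.
have KW0 : 0 <= KW by apply: sumr_ge0 => k _; have [] := hdk k.
have Wlip l : axis l -> nc l <= dm -> cbox z (KW * nc l) (W l).
  move=> al hl k; have [Kk0 _ h] := hdk k.
  rewrite (le_trans (h l al (le_trans hl (hdm k))))// ler_wpM2r ?nc_ge0//.
  by rewrite /KW (bigD1 k)//= lerDl sumr_ge0// => i _; have [] := hdk i.
pose K := KW + C * Kf + C * Kf / r0.
have P1 : 0 <= C * Kf by rewrite mulr_ge0 ?(ltW C0).
have P2 : 0 <= C * Kf / r0 by rewrite divr_ge0 ?(ltW r00).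
have K0 : 0 <= K by rewrite !addr_ge0.
have [|d d0 /= /and4P[hd1 hd2 hd3 _]] := @small_radius _ [:: (1, dm); (1, df); (K, r0 / 2)].
  by rewrite /= dm0 df0 divr_gt0.
exists a, b, K, d; split=> // l al hl; have l0 := nc_ge0 l.
have l1 : nc l <= 1 by lra.
have l3 : nc l ^+ 3 <= nc l by rewrite exprS ler_piMr// exprn_ile1.
have l30 : 0 <= nc l ^+ 3 by rewrite exprn_ge0.
have ldm : nc l <= dm by lra.
have Kl : K * nc l <= r0 / 2 by rewrite (le_trans _ hd3)// ler_wpM2l.
have hfl : nc (ev f (W l)) <= Kf * nc l ^+ 3.
  by have := hf l al; rewrite !mul0r !addr0 subr0; apply; lra.
have hzW := Wlip l al ldm.
have KWl : KW * nc l <= K * nc l by rewrite ler_wpM2r// /K; lra.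
have rr : r0 = r0 / 2 + r0 / 2 by field.
have hWr : cbox p r0 (W l) by rewrite rr; apply: cboxD hz (cbox_le _ hzW); lra.
have [_ [c' fc hc]] := Hroot hWr.
have hc' : nc (c' - W l 0 j) <= C * Kf * nc l ^+ 3.
  by rewrite (le_trans hc)// -mulrA ler_wpM2l ?(ltW C0).
have zz : cbox z (K * nc l) (upd (W l) j c').
  move=> k; rewrite updE; case: eqP => [->|_]; last exact: le_trans (hzW k) KWl.
  have -> : c' - z 0 j = (W l 0 j - z 0 j) + (c' - W l 0 j) by ring.
  have q : C * Kf * nc l ^+ 3 <= C * Kf * nc l by rewrite ler_wpM2l.
  have q2 : 0 <= C * Kf / r0 * nc l by rewrite mulr_ge0.
  rewrite (le_trans (ncD _ _))// /K; have := hzW j; lra.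
have hzz : cbox p r0 (upd (W l) j c') by rewrite rr; apply: cboxD hz (cbox_le Kl zz).
exists (upd (W l) j c'); split=> //.
  move=> k kj; rewrite /lg updE (negbTE kj) mxE (negbTE kj) ncM nc_Ec lnM ?posrE ?expR_gt0//.
    by rewrite expRK; congr (_ + _); case: (l) => x y /=; ring.
  by rewrite (lt_le_trans r00)// Hnz.
have Wj : W l 0 j = z 0 j * (1 + a * l + b * l ^+ 2) by rewrite mxE eqxx.
have Wj0 : 0 < nc (W l 0 j) by rewrite (lt_le_trans r00)// Hnz.
rewrite /ln_quadratic; have -> : lg (upd (W l) j c') j - lg z j - ln (nc (1 + a * l + b * l ^+ 2)) =
  lg (upd (W l) j c') j - lg (W l) j.
  have nzj : 0 < nc (z 0 j) by rewrite nc_gt0.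
  have nzP : 0 < nc (1 + a * l + b * l ^+ 2) by move: Wj0; rewrite Wj ncM pmulr_rgt0.
  by rewrite [lg (W l) j]/lg Wj ncM lnM ?posrE// opprD addrA.
rewrite (le_trans (lg_dist r00 (Hnz hWr j) (Hnz hzz j)))// updE eqxx ler_pdivrMr//.
rewrite (le_trans hc')//.
have -> : C * Kf * nc l ^+ 3 = C * Kf / r0 * nc l ^+ 3 * r0 by field; rewrite gt_eqF.
rewrite ler_wpM2r ?(ltW r00)// ler_wpM2r// /K; lra.
Qed.

End Branch.

(** * A branch lying on one side of its tangent hyperplane *)

(** A quantity moving at a nonzero speed I changes sign: D1 and D2 are its values
    at the times s0 and - s0. *)
Lemma opposite_displacements (R : realFieldType) (h I s0 D1 D2 : R) :
  h != 0 -> I != 0 -> 0 < s0 -> 0 <= h * D1 -> 0 <= h * D2 ->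
  `|D1 - s0 * I| <= `|I| / 2 * s0 -> `|D2 - - s0 * I| <= `|I| / 2 * s0 -> False.
Proof.
move=> h0 I0 s00 h1 h2 g1 g2.
have aI : 0 < `|I| / 2 by rewrite divr_gt0// normr_gt0.
move: g1 g2; rewrite !ler_norml => /andP[g11 g12] /andP[g21 g22].
have [jp|jn] := ltP 0 h.
  have D1p : 0 <= D1 by rewrite -(pmulr_rge0 _ jp).
  have D2p : 0 <= D2 by rewrite -(pmulr_rge0 _ jp).
  have [Ip|In] := leP 0 I.
    rewrite ger0_norm// in g11 g12 g21 g22 aI.
    have : 0 < I / 2 * s0 by rewrite mulr_gt0.
    by lra.
  rewrite ltr0_norm// in g11 g12 g21 g22 aI.
  have : 0 < - I / 2 * s0 by rewrite mulr_gt0.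
  by lra.
have jn' : h < 0 by rewrite lt_neqAle h0.
have D1p : D1 <= 0 by rewrite -(nmulr_rge0 _ jn').
have D2p : D2 <= 0 by rewrite -(nmulr_rge0 _ jn').
have [Ip|In] := leP 0 I.
  rewrite ger0_norm// in g11 g12 g21 g22 aI.
  have : 0 < I / 2 * s0 by rewrite mulr_gt0.
  by lra.
rewrite ltr0_norm// in g11 g12 g21 g22 aI.
have : 0 < - I / 2 * s0 by rewrite mulr_gt0.
by lra.
Qed.

Lemma add_unit_itv (R : realFieldType) (a s r : R) :
  1 * r <= a -> 1 * r <= 1 - a -> - r <= s -> s <= r -> 0 <= a + s <= 1.
Proof. by move=> *; apply/andP; split; lra. Qed.

(** The contradiction between a minimum and subharmonicity.  The x_i are the
    variations of log |z_j| at the points r, -r, ir, -ir of a curve through a minimum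
    of H - al t - al t^2, and the y_i their approximations by a harmonic function.
    As t^2 contributes 2 r^2 at the four points together, the sum of the e x_i is
    at least 2 al r^2, whereas it is O(r^3). *)
Lemma four_points_absurd (R : realFieldType) (e E al t r K K' : R)
    (x1 x2 x3 x4 y1 y2 y3 y4 : R) :
  - (r * E) + al * r + 2 * al * t * r + al * r ^+ 2 <= e * x1 ->
  - (- r * E) + al * - r + 2 * al * t * - r + al * (- r) ^+ 2 <= e * x2 ->
  - (0 * E) + al * 0 + 2 * al * t * 0 + al * 0 ^+ 2 <= e * x3 ->
  - (0 * E) + al * 0 + 2 * al * t * 0 + al * 0 ^+ 2 <= e * x4 ->
  `|x1 - y1| <= K * r ^+ 3 -> `|x2 - y2| <= K * r ^+ 3 ->
  `|x3 - y3| <= K * r ^+ 3 -> `|x4 - y4| <= K * r ^+ 3 ->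
  `|y1 + y2 + y3 + y4| <= K' * r ^+ 3 ->
  0 < al -> 0 < r -> `|e| * (4 * K + K') * r <= al -> False.
Proof.
move=> i1 i2 i3 i4 g1 g2 g3 g4 g5 al0 r0 hr.
have sx : `|x1 + x2 + x3 + x4| <= (4 * K + K') * r ^+ 3.
  move: g1 g2 g3 g4 g5 {i1 i2 i3 i4 hr}; rewrite !ler_norml.
  move=> /andP[? ?] /andP[? ?] /andP[? ?] /andP[? ?] /andP[? ?].
  by apply/andP; split; lra.
have sum_ge : 2 * al * r ^+ 2 <= e * (x1 + x2 + x3 + x4).
  by rewrite !expr0n /= !mulr0 in i3 i4; rewrite sqrrN in i2; lra.
have : e * (x1 + x2 + x3 + x4) <= al * r ^+ 2.
  rewrite (le_trans (ler_norm _))// normrM (le_trans (ler_wpM2l (normr_ge0 _) sx))//.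
  have -> : `|e| * ((4 * K + K') * r ^+ 3) = `|e| * (4 * K + K') * r * r ^+ 2 by ring.
  by rewrite ler_wpM2r// sqr_ge0.
have : 0 < al * r ^+ 2 by rewrite mulr_gt0// exprn_gt0.
by lra.
Qed.

Section OneSided.
Context {R : realType} {n : nat}.
Variables (f : mpoly n (Cx R)) (p : 'rV[Cx R]_n) (eta : 'I_n -> R) (c : Cx R).
Variables (j : 'I_n) (C r0 B eps : R).
Hypothesis chart : branch_chart f p eta c j C r0 B.
Implicit Types (z w : 'rV[Cx R]_n) (u v y : 'I_n -> R).

(** The function H, whose differential along V vanishes at p. *)
Definition height z : R := \sum_k eta k * (lg z k - lg p k).

(* The branch satisfies H >= 0 on the slice of p, and p is isolated in its fibre. *)
Hypothesis eps0 : 0 < eps.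
Hypothesis epsr : eps <= r0 / 2.
Hypothesis Hpos : forall z, ev f z = 0 -> cbox p eps z ->
  (forall k, k != j -> lg z k = lg p k) -> 0 <= height z.
Hypothesis Hiso : forall z, ev f z = 0 -> cbox p eps z ->
  (forall k, lg z k = lg p k) -> z = p.

Let r00 : 0 < r0. Proof. by case: chart. Qed.
Let Hj : eta j != 0. Proof. by case: chart. Qed.
Let aj0 : 0 < `|eta j|. Proof. by rewrite normr_gt0. Qed.
Let Hnz z : cbox p r0 z -> forall k, r0 <= nc (z 0 k). Proof. by case: chart => ? ? ? ? ? h *; exact: h. Qed.
Let epsr0 : eps <= r0. Proof. by have := r00; have := epsr; lra. Qed.
Let Hnz0 z : cbox p eps z -> forall k, z 0 k != 0.
Proof. by move=> /(cbox_le epsr0) hz k; rewrite -nc_gt0 (lt_le_trans r00)// Hnz. Qed.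
Let fp0 : ev f p = 0. Proof. by case: chart. Qed.
Let pbox : cbox p eps p. Proof. exact: cbox_center (ltW eps0). Qed.

Lemma height_split z : height z = eta j * (lg z j - lg p j) +
  \sum_(k | k != j) eta k * (lg z k - lg p k).
Proof. by rewrite /height (bigD1 j). Qed.

(** On a slice, H and eta_j log |z_j| differ by a constant. *)
Lemma height_slice z u : (forall k, k != j -> lg z k = lg p k + u k) ->
  height z = eta j * (lg z j - lg p j) + \sum_(k | k != j) eta k * u k.
Proof.
move=> h; rewrite height_split; congr (_ + _); apply: eq_bigr => k kj.
by rewrite h// addrC addKr.
Qed.

Lemma height0 z : (forall k, k != j -> lg z k = lg p k) -> height z = eta j * (lg z j - lg p j).
Proof.
move=> h; rewrite height_split big1 ?addr0// => k kj; by rewrite h// subrr mulr0.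
Qed.

(** A tangential displacement brings z to the slice of p, where H is nonnegative. *)
Lemma lower_bound (e : R) : 0 < e -> exists2 d : R, 0 < d & forall z, ev f z = 0 -> cbox p d z ->
  - (e * \sum_(k | k != j) `|lg z k - lg p k|) <= height z.
Proof.
move=> e0; pose M := (\sum_k `|eta k|) / `|eta j|.
have M0 : 0 <= M by rewrite divr_ge0// sumr_ge0.
pose e1 := Num.min eps (e / (`|eta j| * (1 + M))).
have M1 : 0 < 1 + M by rewrite ltr_pwDl.
have e10 : 0 < e1 by rewrite lt_min eps0 divr_gt0// mulr_gt0.
have [d1 d10 h1] := tangent_move chart e10.
have n0 : (0 : R) <= n%:R by rewrite ler0n.
have [|d d0 /= /and4P[hd1 hd2 hd3 _]] := @small_radius _ [:: (1, d1); (1, r0); ((1 + M) * (n%:R / r0), d1)].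
  by rewrite /= d10 r00.
exists d => // z fz hz; pose y k := lg z k - lg p k.
set Y := \sum_(_ | _) _; have Y0 : 0 <= Y by apply: sumr_ge0.
have hzr : cbox p r0 z by apply: cbox_le hz; lra.
have yd k : `|y k| <= d / r0.
  rewrite (le_trans (lg_dist r00 (Hnz (cbox_center _ (ltW r00)) k) (Hnz hzr k)))//.
  by rewrite ler_pM2r ?invr_gt0.
have yY k : k != j -> `|y k| <= Y.
  by move=> kj; rewrite /Y (bigD1 k)//= lerDl sumr_ge0.
have Yn : Y <= n%:R / r0 * d.
  rewrite /Y (@le_trans _ _ (\sum_(k < n) d / r0))//.
    rewrite [leRHS](bigD1 j)//=; apply: ler_wpDl; first by rewrite divr_ge0// ltW.
    by apply: ler_sum => k _; exact: yd.
  have -> : n%:R / r0 * d = n%:R * (d / r0) by ring.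
  by rewrite sumr_const card_ord mulr_natl.
(* v is orthogonal to eta, and moves z to the slice of p. *)
pose a := (\sum_(k | k != j) eta k * y k) / eta j.
have aY : `|a| <= M * Y.
  rewrite /a normrM normfV /M mulrAC ler_pM2r ?invr_gt0//.
  rewrite (le_trans (ler_norm_sum _ _ _))// (@le_trans _ _ (\sum_(k | k != j) `|eta k| * Y))//.
    by apply: ler_sum => k kj; rewrite normrM ler_wpM2l// yY.
  by rewrite -mulr_suml ler_wpM2r// [leRHS](bigD1 j)//= lerDr.
pose v k := if k == j then a else - y k.
have vj : v j = a by rewrite /v eqxx.
have vk k : k != j -> v k = - y k by move=> kj; rewrite /v (negbTE kj).
have MY : (1 + M) * Y <= d1.
  rewrite (le_trans _ hd3)// -mulrA ler_wpM2l ?(ltW M1)//.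
have vd k : `|v k| <= d1.
  apply: le_trans MY; rewrite mulrDl mul1r; have MY0 : 0 <= M * Y by rewrite mulr_ge0.
  case: (eqVneq k j) => [->|kj]; first by rewrite vj; lra.
  by rewrite vk// normrN; have := yY k kj; lra.
have vS : \sum_k `|v k| <= (1 + M) * Y.
  rewrite (bigD1 j)//= vj mulrDl mul1r addrC lerD//.
  by rewrite /Y; apply: ler_sum => k kj; rewrite vk// normrN.
have ve : \sum_k eta k * v k = 0.
  rewrite (bigD1 j)//= vj /a [eta j * _]mulrC divfK//.
  by rewrite -big_split/= big1// => k kj; rewrite vk// mulrN subrr.
have hz1 : cbox p d1 z by apply: cbox_le hz; lra.
have [z' [fz' bz' lz' lj']] := h1 z v fz hz1 vd ve.
have ez : cbox p eps z' by apply: cbox_le bz'; rewrite /e1 ge_min lexx.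
have sz' k : k != j -> lg z' k = lg p k by move=> kj; rewrite lz'// vk// /y; ring.
have := Hpos fz' ez sz'; rewrite (height0 sz') => h2.
have -> : height z = eta j * (lg z j + v j - lg p j).
  rewrite height_split vj /a; set X := \sum_(_ | _) _; by field.
have h3 : `|eta j * (lg z' j - lg p j) - eta j * (lg z j + v j - lg p j)| <= e * Y.
  rewrite -mulrBr; have -> : lg z' j - lg p j - (lg z j + v j - lg p j) = lg z' j - (lg z j + v j) by ring.
  rewrite normrM (le_trans (ler_wpM2l (normr_ge0 _) lj'))//.
  rewrite (@le_trans _ _ (`|eta j| * (e1 * ((1 + M) * Y))))//.
    by rewrite ler_wpM2l// ler_wpM2l ?(ltW e10).
  have : e1 * (`|eta j| * (1 + M)) <= e by rewrite -ler_pdivlMr ?mulr_gt0// /e1 ge_min lexx orbT.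
  move=> h4; have -> : `|eta j| * (e1 * ((1 + M) * Y)) = e1 * (`|eta j| * (1 + M)) * Y by ring.
  by rewrite ler_wpM2r.
by move: h3; rewrite ler_norml => /andP[? ?]; lra.
Qed.

Lemma upper_bound u (e : R) : 0 < e -> exists2 t0 : R, 0 < t0 & forall t, 0 < t <= t0 ->
  exists z, [/\ ev f z = 0, cbox p e z, forall k, k != j -> lg z k = lg p k + t * u k &
    height z <= e * t].
Proof.
move=> e0; pose a := - (\sum_(k | k != j) eta k * u k) / eta j.
pose v k := if k == j then a else u k; pose S := \sum_k `|v k|.
have S0 : 0 <= S by apply: sumr_ge0.
have S1 : 0 < S + 1 by rewrite ltr_wpDl.
pose e1 := Num.min e (e / (`|eta j| * (S + 1))).
have e10 : 0 < e1 by rewrite lt_min e0 divr_gt0// mulr_gt0.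
have [d1 d10 h1] := tangent_move chart e10.
have [|t0 t00 /= /andP[ht _]] := @small_radius _ [:: (S, d1)]; first by rewrite /= d10.
exists t0 => // t /andP[tp tt0].
have vS k : `|v k| <= S by rewrite /S (bigD1 k)//= lerDl sumr_ge0.
have vt k : `|t * v k| <= d1.
  rewrite normrM gtr0_norm// (le_trans _ ht)// mulrC.
  by apply: ler_pM => //; exact: ltW.
have ve : \sum_k eta k * (t * v k) = 0.
  have -> : \sum_k eta k * (t * v k) = t * \sum_k eta k * v k.
    by rewrite mulr_sumr; apply: eq_bigr => k _; ring.
  rewrite (bigD1 j)//= /v eqxx /a.
  have -> : \sum_(k | k != j) eta k * (if k == j then - (\sum_(k0 | k0 != j) eta k0 * u k0) / eta j else u k) =
    \sum_(k | k != j) eta k * u k by apply: eq_bigr => k kj; rewrite (negbTE kj).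
  by set X := \sum_(_ | _) _; field.
have [z [fz bz lz lj]] := h1 p (fun k => t * v k) fp0 (cbox_center _ (ltW d10)) vt ve.
have sl k : k != j -> lg z k = lg p k + t * u k by move=> kj; rewrite lz// /v (negbTE kj).
exists z; split=> //; first by apply: cbox_le bz; rewrite /e1 ge_min lexx.
rewrite (height_slice sl).
have -> : \sum_(k | k != j) eta k * (t * u k) = - (eta j * (t * v j)).
  have -> : \sum_(k | k != j) eta k * (t * u k) = t * \sum_(k | k != j) eta k * u k.
    by rewrite mulr_sumr; apply: eq_bigr => k _; ring.
  by rewrite /v eqxx /a; set X := \sum_(_ | _) _; field.
have -> : eta j * (lg z j - lg p j) - eta j * (t * v j) = eta j * (lg z j - (lg p j + t * v j)) by ring.
rewrite (le_trans (ler_norm _))// normrM (le_trans (ler_wpM2l (normr_ge0 _) lj))//.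
have -> : \sum_k `|t * v k| = t * S.
  by rewrite /S mulr_sumr; apply: eq_bigr => k _; rewrite normrM gtr0_norm.
have h4 : e1 * (`|eta j| * (S + 1)) <= e by rewrite -ler_pdivlMr ?mulr_gt0// /e1 ge_min lexx orbT.
have h5 : `|eta j| * (e1 * (t * S)) <= e1 * (`|eta j| * (S + 1)) * t.
  have -> : `|eta j| * (e1 * (t * S)) = e1 * `|eta j| * t * S by ring.
  have -> : e1 * (`|eta j| * (S + 1)) * t = e1 * `|eta j| * t * (S + 1) by ring.
  by rewrite ler_wpM2l ?lerDl// !mulr_ge0// ltW.
by rewrite (le_trans h5)// ler_wpM2r// ltW.
Qed.

(** The distance of Log z to the slice log |z_k| = log |p_k| + u_k, k != j. *)
Definition slice_dev u z : R := \sum_(k | k != j) `|lg z k - lg p k - u k|.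

Lemma slice_dev_ge0 u z : 0 <= slice_dev u z. Proof. exact: sumr_ge0. Qed.

Lemma slice_devP u z : slice_dev u z <= 0 <-> forall k, k != j -> lg z k = lg p k + u k.
Proof.
split=> [h k kj|h].
  have s0 : slice_dev u z = 0 by apply/eqP; rewrite eq_le h slice_dev_ge0.
  have : `|lg z k - lg p k - u k| <= 0.
    by rewrite -s0 /slice_dev (bigD1 k)//= lerDl sumr_ge0.
  rewrite normr_le0 => /eqP e.
  have -> : lg z k = lg z k - lg p k - u k + (lg p k + u k) by ring.
  by rewrite e add0r.
by rewrite /slice_dev big1// => k kj; rewrite h// addrAC addrK subrr normr0.
Qed.

Lemma lipat_lg_box k z : cbox p eps z -> lipat (fun w => lg w k) z.
Proof. by move=> hz; apply: lipat_lg; exact: Hnz0. Qed.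

Lemma lipat_height z : cbox p eps z -> lipat height z.
Proof.
move=> hz; apply: lipat_sum => k _; apply: lipatZ; apply: lipatB; last exact: lipat_cst.
exact: lipat_lg_box.
Qed.

Lemma lipat_slice_dev u z : cbox p eps z -> lipat (slice_dev u) z.
Proof.
move=> hz; apply: lipat_sum => k _; apply: lipat_norm; do 2 (apply: lipatB; last exact: lipat_cst).
exact: lipat_lg_box.
Qed.

(** The branch of V at p, in the polydisc of radius eps. *)
Definition box_branch : set 'rV[Cx R]_n := [set z | cbox p eps z /\ ev f z = 0].

Lemma compact_box_branch : compact box_branch.
Proof.
have -> : box_branch = [set z | cbox p eps z /\ nc (ev f z) <= 0].
  apply/seteqP; split=> z [hz h]; split=> //; first by rewrite h nc0.
  by apply/eqP; rewrite -nc_eq0 eq_le h nc_ge0.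
apply: compact_sublevel; first exact: compact_cbox.
by move=> z _; apply: lipat_continuous; exact: lipat_ev.
Qed.

Lemma compact_box_sublevel (K : set 'rV[Cx R]_n) (g : 'rV[Cx R]_n -> R) :
  compact K -> K `<=` cbox p eps -> (forall z, cbox p eps z -> lipat g z) ->
  compact [set z | K z /\ g z <= 0].
Proof.
move=> cK sK hg; apply: compact_sublevel => // z; rewrite inE => /sK hz.
by apply: lipat_continuous; exact: hg.
Qed.

(** p is the only point of the branch on the slice of p where H <= 0; so, by
    compactness, low points on nearby slices are near p. *)
Lemma low_points_near (d : R) : 0 < d -> exists2 m : R, 0 < m & forall z, box_branch z ->
  slice_dev (fun=> 0) z < m -> height z < m -> dist1 p z < d.
Proof.
move=> d0; pose g z := slice_dev (fun=> 0) z + (height z + `|height z|) / 2.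
pose K := [set z | box_branch z /\ d - dist1 p z <= 0].
have cK : compact K.
  apply: compact_box_sublevel; [exact: compact_box_branch|by move=> z []|move=> z hz].
  by apply: lipatB; [exact: lipat_cst|exact: lipat_dist1].
have cg : {in K, continuous g}.
  move=> z; rewrite inE => -[[hz _] _]; apply: lipat_continuous; apply: lipatD; first exact: lipat_slice_dev.
  have := lipatZ 2^-1 (lipatD (lipat_height hz) (lipat_norm (lipat_height hz))).
  by congr (lipat _ z); apply/funext => w; rewrite mulrC.
have gpos z : K z -> 0 < g z.
  move=> [[hz fz] dz]; have s0 := slice_dev_ge0 (fun=> 0) z.
  have hn := ler_norm (- height z); rewrite normrN in hn.
  have hn2 := normr_ge0 (height z).
  rewrite /g; have [sp|sn] := ltP 0 (slice_dev (fun=> 0) z); first by lra.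
  have sl k : k != j -> lg z k = lg p k.
    by move/slice_devP: sn => sn kj; rewrite sn// addr0.
  have h0 := Hpos fz hz sl; have [h1|h1] := ltP 0 (height z); first by lra.
  have : height z = 0 by lra.
  rewrite (height0 sl) => /eqP; rewrite mulf_eq0 (negbTE Hj)/= subr_eq0 => /eqP ej.
  have zp : z = p by apply: Hiso => // k; have [->//|kj] := eqVneq k j; exact: sl.
  move: dz; rewrite zp; have -> : dist1 p p = 0.
    by rewrite dist1.unlock big1// => k _; rewrite subrr nc0.
  lra.
have [m m0 hm] := compact_pos cK cg gpos.
exists (m / 2); first by rewrite divr_gt0.
move=> z pz s1 h1; rewrite ltNge; apply/negP => dz.
have kz : K z by split=> //; lra.
have := hm z kz; rewrite /g.
have [h0|h0] := leP 0 (height z); first by rewrite ger0_norm//; lra.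
by rewrite ltr0_norm//; lra.
Qed.

Lemma slice_min u : (exists z, box_branch z /\ slice_dev u z <= 0) ->
  exists z, [/\ box_branch z, slice_dev u z <= 0 & forall w, box_branch w -> slice_dev u w <= 0 -> height z <= height w].
Proof.
move=> [z0 hz0]; pose K := [set z | box_branch z /\ slice_dev u z <= 0].
have cK : compact K.
  by apply: compact_box_sublevel; [exact: compact_box_branch|move=> z []|exact: lipat_slice_dev].
have ch : {within K, continuous height}.
  apply: continuous_in_subspaceT => z; rewrite inE => -[[hz _] _].
  by apply: lipat_continuous; exact: lipat_height.
have K0 : K !=set0 by exists z0.
have [z kz hz] := compact_EVT_min K0 cK ch.
rewrite inE in kz; case: kz => pz sz; exists z; split=> // w pw sw.
by apply: hz; rewrite inE.
Qed.

Lemma dist1_cbox_lt z (d : R) : dist1 p z < d -> cbox p d z.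
Proof. by move=> h k; rewrite (le_trans (nc_le_dist1 p z k))// ltW. Qed.

(** A minimum of H on a slice is a critical point of Log: otherwise some rotation of
    a coordinate decreases H.  Being close to p, it satisfies the lower bound. *)
Lemma critical_near u (e : R) : 0 < e -> exists2 t0 : R, 0 < t0 & forall t, 0 < t <= t0 ->
  exists z, [/\ ev f z = 0, cbox p e z, forall k, k != j -> lg z k = lg p k + t * u k,
    `|height z| <= e * t & forall k, complex.Im (gauss f z k / gauss f z j) = 0].
Proof.
move=> e0; pose U := \sum_(k | k != j) `|u k|; have U0 : 0 <= U by apply: sumr_ge0.
have U1 : 0 < U + 1 by rewrite ltr_wpDl.
have eU : 0 < e / (U + 1) by rewrite divr_gt0.
have [d1 d10 hlow] := lower_bound eU.
pose d := Num.min (Num.min (eps / 2) e) d1.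
have d0 : 0 < d by rewrite !lt_min divr_gt0// e0 d10.
have dl1 : d <= eps / 2 by rewrite /d !ge_min lexx.
have dl2 : d <= e by rewrite /d !ge_min lexx orbT.
have dl3 : d <= d1 by rewrite /d !ge_min lexx !orbT.
have [m m0 hnear] := low_points_near d0.
pose e2 := Num.min eps e; have e20 : 0 < e2 by rewrite lt_min eps0.
have [t1 t10 hup] := upper_bound u e20.
have [|t0 t00 /= /and4P[ht1 ht2 ht3 _]] := @small_radius _ [:: (1, t1); (e, m / 2); (U, m / 2)].
  by rewrite /= t10 !divr_gt0.
exists t0 => // t /andP[tp tt0].
have [|z1 [fz1 bz1 sz1 hz1]] := hup t; first by rewrite tp; lra.
have e2t : e2 * t <= e * t by rewrite ler_wpM2r ?(ltW tp)// /e2 ge_min lexx orbT.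
have et0 : e * t <= e * t0 by rewrite ler_wpM2l// ltW.
have pz1 : box_branch z1 by split=> //; apply: cbox_le bz1; rewrite /e2 ge_min lexx.
have [|z [pz sz hmin]] := @slice_min (fun k => t * u k).
  by exists z1; split=> //; exact/slice_devP.
have [bz fz] := pz; have hz : height z <= e * t.
  by rewrite (le_trans (hmin z1 pz1 _))//; [exact/slice_devP|lra].
have sl : forall k, k != j -> lg z k = lg p k + t * u k by apply/slice_devP.
have abs_sl : \sum_(k | k != j) `|lg z k - lg p k| = t * U.
  rewrite /U mulr_sumr; apply: eq_bigr => k kj.
  by rewrite sl// addrC addKr normrM gtr0_norm.
have tU : U * t <= U * t0 by rewrite ler_wpM2l.
have dz : dist1 p z < d.
  apply: hnear => //; last by lra.
  have -> : slice_dev (fun=> 0) z = t * U.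
    by rewrite -abs_sl; apply: eq_bigr => k _; rewrite subr0.
  by lra.
have bzd := dist1_cbox_lt dz.
exists z; split=> //; first exact: cbox_le bzd.
  have := hlow z fz (cbox_le dl3 bzd); rewrite abs_sl => hl.
  have : e / (U + 1) * (t * U) <= e * t.
    have -> : e / (U + 1) * (t * U) = e * t * (U / (U + 1)) by field; rewrite gt_eqF.
    rewrite ler_piMr ?mulr_ge0 ?(ltW e0) ?(ltW tp)//.
    by rewrite ler_pdivrMr// mul1r lerDl.
  by move=> h; rewrite ler_norml hz andbT; lra.
move=> k; have [->|kj] := eqVneq k j.
  rewrite mulfV//; exact: gauss_neq0 chart _ (cbox_le epsr0 bz).
apply/eqP/negPn/negP => I0; set I := complex.Im _ in I0.
have aI : 0 < `|I| / 2 by rewrite divr_gt0// normr_gt0.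
pose er := Num.min (eps / 2) (`|I| / 2).
have er0 : 0 < er by rewrite lt_min aI divr_gt0.
have bz2 : cbox p (r0 / 2) z.
  by apply: cbox_le bzd; have := epsr; have := eps0; lra.
have [s0 s00 hrot] := rotate_coordinate chart bz2 fz kj er0.
have var s : `|s| <= s0 -> exists2 D : R, 0 <= eta j * D & `|D - s * I| <= `|I| / 2 * `|s|.
  move=> /hrot[z' [fz' bz' sz' lz']]; exists (lg z' j - lg z j).
    have bz'e : cbox p eps z'.
      have -> : eps = eps / 2 + eps / 2 by field.
      apply: cboxD (cbox_le dl1 bzd) (cbox_le _ bz'); by rewrite /er ge_min lexx.
    have sl' : forall k, k != j -> lg z' k = lg p k + t * u k by move=> i ij; rewrite sz'// sl.
    have := hmin z' (conj bz'e fz'); rewrite (height_slice sl) (height_slice sl') => h.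
    by have := h ((slice_devP _ _).2 sl'); lra.
  by rewrite (le_trans lz')// ler_wpM2r// /er ge_min lexx orbT.
have [|D1 h1 g1] := var s0; first by rewrite gtr0_norm.
have [|D2 h2 g2] := var (- s0); first by rewrite normrN gtr0_norm.
rewrite normrN in g2; rewrite (gtr0_norm s00) in g1 g2.
exact: (opposite_displacements Hj I0 s00 h1 h2 g1 g2).
Qed.

(** The minimum of H on any nearby slice is nonpositive.  The function Psi is
    minimized over the slices t u with 0 <= t <= 1: its minimum is negative by
    [upper_bound], hence not at t = 0, where H >= 0, nor at t = 1, where H would be
    large; at an interior minimum, the four points of [second_order_curve] give a
    contradiction. *)
Lemma low_point_on_slice : exists2 dl : R, 0 < dl & forall u, (forall k, `|u k| <= dl) ->
  exists z, [/\ ev f z = 0, cbox p eps z, forall k, k != j -> lg z k = lg p k + u k &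
    height z <= 0].
Proof.
have n0 : (0 : R) <= n%:R by rewrite ler0n.
have e20 : 0 < eps / 2 by rewrite divr_gt0.
have [m m0 hnear] := low_points_near e20.
have [|dl dl0 /= /andP[hdl _]] := @small_radius _ [:: (n%:R, m / 2)]; first by rewrite /= divr_gt0.
exists dl => // u hu; apply: contrapT => hn.
have {}hn z : box_branch z -> slice_dev u z <= 0 -> 0 < height z.
  move=> [bz fz] /slice_devP sz; rewrite ltNge; apply/negP => hz.
  by apply: hn; exists z.
have [k0 k0j u0] : exists2 k0, k0 != j & u k0 != 0.
  apply: contrapT => h; have sp : slice_dev u p <= 0.
    apply/slice_devP => k kj.
    have -> : u k = 0 by apply/eqP/negPn/negP => uk; apply: h; exists k.
    by rewrite addr0.
  by have := hn p (conj pbox fp0) sp; rewrite (height0 (fun _ _ => erefl)) subrr mulr0 ltxx.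
have [ka ka0 hka] : exists2 ka : R, 0 < ka & forall z, box_branch z /\ slice_dev u z <= 0 -> ka <= height z.
  apply: compact_pos.
  - by apply: compact_box_sublevel; [exact: compact_box_branch|move=> z []|exact: lipat_slice_dev].
  - move=> z; rewrite inE => -[[bz _] _]; apply: lipat_continuous; exact: lipat_height.
  - by move=> z [pz sz]; exact: hn.
(* With this al, Psi is positive at t = 1, and the points where H <= 2 al are near p. *)
pose al := Num.min ka m / 4.
have al0 : 0 < al by rewrite divr_gt0// lt_min ka0.
have al1 : 4 * al <= ka.
  by rewrite /al mulrCA divff// mulr1 ge_min lexx.
have al2 : 4 * al <= m.
  by rewrite /al mulrCA divff// mulr1 ge_min lexx orbT.
(* The parameter of a slice, read off a coordinate k0 where u does not vanish. *)
pose t z := (u k0)^-1 * (lg z k0 - lg p k0).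
have tE z s : lg z k0 = lg p k0 + s * u k0 -> t z = s.
  by move=> h; rewrite /t h addrC addKr mulrC mulfK.
pose T z := \sum_(k | k != j) `|lg z k - lg p k - t z * u k|.
have lt z : cbox p eps z -> lipat t z.
  move=> hz; apply: lipatZ; apply: lipatB; last exact: lipat_cst.
  exact: lipat_lg_box.
have lT z : cbox p eps z -> lipat T z.
  move=> hz; apply: lipat_sum => k _; apply: lipat_norm; apply: lipatB; last first.
    have := lipatZ (u k) (lt z hz); congr (lipat _ z).
    by apply/funext => w; rewrite mulrC.
  by apply: lipatB; [exact: lipat_lg_box|exact: lipat_cst].
have TP z s : (forall k, k != j -> lg z k = lg p k + s * u k) -> t z = s /\ T z <= 0.
  move=> h; have ts : t z = s by exact: tE (h k0 k0j).
  by split=> //; rewrite /T ts big1// => k kj; rewrite h// addrAC addrK subrr normr0.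
have TQ z : T z <= 0 -> forall k, k != j -> lg z k = lg p k + t z * u k.
  by move=> h; apply/(@slice_devP (fun k => t z * u k)).
(* D is the part of the branch lying over the slices t u, 0 <= t <= 1. *)
pose D1 := [set z | box_branch z /\ T z <= 0].
pose D2 := [set z | D1 z /\ - t z <= 0].
pose D := [set z | D2 z /\ t z - 1 <= 0].
have cD1 : compact D1 by apply: compact_box_sublevel; [exact: compact_box_branch|move=> z []|exact: lT].
have cD2 : compact D2.
  by apply: compact_box_sublevel; [exact: cD1|move=> z [[]]|move=> z hz; apply: lipatN; exact: lt].
have cD : compact D.
  apply: compact_box_sublevel; [exact: cD2|by move=> z [[[]]]|move=> z hz].
  by apply: lipatB; [exact: lt|exact: lipat_cst].
pose Psi z := height z - al * t z - al * (t z) ^+ 2.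
have cPsi : {within D, continuous Psi}.
  apply: continuous_in_subspaceT => z; rewrite inE => -[[[[bz _] _] _] _].
  apply: lipat_continuous; apply: lipatB.
    by apply: lipatB; [exact: lipat_height|apply: lipatZ; exact: lt].
  by apply: lipatZ; exact: lipat_sqr (lt z bz).
have DP z s : 0 <= s <= 1 -> box_branch z -> (forall k, k != j -> lg z k = lg p k + s * u k) -> D z /\ t z = s.
  move=> /andP[s0 s1] pz /TP[ts Tz]; split=> //.
  have h1 : D1 z by [].
  have h2 : D2 z by split=> //; rewrite ts; lra.
  by split=> //; rewrite ts; lra.
pose e1 := Num.min eps (al / 2).
have e10 : 0 < e1 by rewrite lt_min eps0 divr_gt0.
have [t1 t10 hup] := upper_bound u e10.
pose s1 := Num.min t1 1.
have s10 : 0 < s1 by rewrite lt_min t10 ltr01.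
have [|z1 [fz1 bz1 sz1 hz1]] := hup s1; first by rewrite s10 /s1 ge_min lexx.
have hs1 : 0 <= s1 <= 1 by rewrite (ltW s10) /s1 ge_min lexx orbT.
have pz1 : box_branch z1 by split=> //; apply: cbox_le bz1; rewrite /e1 ge_min lexx.
have [Dz1 ts1] := DP z1 s1 hs1 pz1 sz1.
have Psi1 : Psi z1 < 0.
  rewrite /Psi ts1; have : e1 * s1 <= al / 2 * s1.
    by rewrite ler_wpM2r ?(ltW s10)// /e1 ge_min lexx orbT.
  have : 0 < al * s1 by rewrite mulr_gt0.
  have : 0 <= al * s1 ^+ 2 by rewrite mulr_ge0 ?sqr_ge0 ?ltW.
  by lra.
have D0 : D !=set0 by exists z1.
have [z] := compact_EVT_min D0 cD cPsi; rewrite inE => Dz hmin.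
have {}hmin w : D w -> Psi z <= Psi w by move=> Dw; apply: hmin; rewrite inE.
have Psiz : Psi z < 0 by apply: le_lt_trans Psi1; exact: hmin.
have [[[[bz fz] Tz] tz0] tz1] := Dz.
have pz : box_branch z by [].
have sz := TQ z Tz.
set tz := t z in tz0 tz1 sz; have tz0' : 0 <= tz by lra.
have tz1' : tz <= 1 by lra.
have tz2 : tz ^+ 2 <= 1 by rewrite expr2 -[leRHS]mulr1 ler_pM.
have tz20 : 0 <= tz ^+ 2 by exact: sqr_ge0.
have hzm : height z <= 2 * al.
  have q1 : al * tz <= al by rewrite ler_piMr// ltW.
  have q2 : al * tz ^+ 2 <= al by rewrite ler_piMr// ltW.
  by move: Psiz; rewrite /Psi -/tz; lra.
have tz1s : tz < 1.
  rewrite lt_neqAle tz1' andbT; apply/eqP => e.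
  have : ka <= height z.
    by apply: hka; split=> //; apply/slice_devP => k kj; rewrite sz// e mul1r.
  by lra.
have tz0s : 0 < tz.
  rewrite lt_neqAle tz0' andbT eq_sym; apply/eqP => e.
  have sl k : k != j -> lg z k = lg p k by move=> kj; rewrite sz// e mul0r addr0.
  have := Hpos fz bz sl; move: Psiz; rewrite /Psi -/tz e expr0n/= !mulr0; lra.
have dz : dist1 p z < eps / 2.
  apply: hnear => //; last by lra.
  apply: le_lt_trans (_ : n%:R * dl < m); last by lra.
  rewrite /slice_dev (@le_trans _ _ (\sum_(k < n) dl))//; last by rewrite sumr_const card_ord mulr_natl.
  rewrite [leRHS](bigD1 j)//=; apply: ler_wpDl; first exact: ltW.
  apply: ler_sum => k kj; rewrite subr0 sz// addrC addKr normrM ger0_norm//.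
  by rewrite (le_trans _ (hu k))// ler_piMl.
have bz2 := dist1_cbox_lt dz.
have bzr : cbox p (r0 / 2) z.
  by apply: cbox_le bz2; have := epsr; have := eps0; lra.
have [a [b [K [d [K0 d0 hcurve]]]]] := second_order_curve chart u bzr fz.
have [K' [d' [K'0 d'0 hlog]]] := four_log a b.
have tz1p : 0 < 1 - tz by rewrite subr_gt0.
have [|r r00' /= /and5P[hr1 hr2 hr3 hr4 /and3P[hr5 hr6 _]]] := @small_radius _
  [:: (1, d); (1, d'); (1, tz); (1, 1 - tz); (K, eps / 2); (`|eta j| * (4 * K + K'), al)].
  by rewrite /= d0 d'0 tz0s tz1p e20 al0.
pose E := \sum_(k | k != j) eta k * u k.
have hE w s : (forall k, k != j -> lg w k = lg p k + s * u k) ->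
    height w = eta j * (lg w j - lg p j) + s * E.
  move=> h; rewrite (height_slice h); congr (_ + _).
  by rewrite /E mulr_sumr; apply: eq_bigr => k _; ring.
have step l s : axis l -> nc l = r -> complex.Re l = s -> `|s| <= r -> exists2 dl : R,
    - (s * E) + al * s + 2 * al * tz * s + al * s ^+ 2 <= eta j * dl &
    `|dl - ln_quadratic a b l| <= K * r ^+ 3.
  move=> al' nl Rl; rewrite ler_norml => /andP[s1' s2'].
  have [|w [fw bw sw lw]] := hcurve l al'; first by rewrite nl -[leLHS]mul1r.
  rewrite nl in bw lw; exists (lg w j - lg z j) => //.
  have bwe : cbox p eps w.
    have -> : eps = eps / 2 + eps / 2 by field.
    by apply: cboxD bz2 (cbox_le _ bw).
  have sw' k : k != j -> lg w k = lg p k + (tz + s) * u k.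
    by move=> kj; rewrite sw// sz// Rl; ring.
  have hs : 0 <= tz + s <= 1 := add_unit_itv hr3 hr4 s1' s2'.
  have [Dw tw] := DP w (tz + s) hs (conj bwe fw) sw'.
  have := hmin w Dw; rewrite /Psi tw -/tz (hE w _ sw') (hE z _ sz) => h.
  rewrite -subr_ge0 in h; rewrite -subr_ge0.
  by move: h; congr (is_true (0 <= _)); ring.
have nr : nc (rc r : Cx R) = r by rewrite nc_rc gtr0_norm.
have nir : nc (ii * rc r : Cx R) = r by rewrite nc_iir gtr0_norm.
have A1 : axis (rc r : Cx R) by exists r; left.
have A2 : axis (- rc r : Cx R) by exists (- r); left; cplx.
have A3 : axis (ii * rc r : Cx R) by exists r; right.
have A4 : axis (- (ii * rc r) : Cx R) by exists (- r); right; rewrite !iir; cplx.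
have N1 : `|r| <= r by rewrite gtr0_norm.
have N2 : `|- r| <= r by rewrite normrN.
have N3 : `|0 : R| <= r by rewrite normr0 ltW.
have nr2 : nc (- rc r : Cx R) = r by rewrite ncN.
have nr4 : nc (- (ii * rc r) : Cx R) = r by rewrite ncN.
have R3 : complex.Re (ii * rc r : Cx R) = 0 by rewrite iir.
have R4 : complex.Re (- (ii * rc r) : Cx R) = 0 by rewrite iir /= oppr0.
have [x1 i1 g1] := step _ r A1 nr erefl N1.
have [x2 i2 g2] := step _ (- r) A2 nr2 erefl N2.
have [x3 i3 g3] := step _ 0 A3 nir R3 N3.
have [x4 i4 g4] := step _ 0 A4 nr4 R4 N3.
have hr : 0 < r <= d' by rewrite r00' -[leLHS]mul1r.
exact: (four_points_absurd i1 i2 i3 i4 g1 g2 g3 g4 (hlog r hr) al0 r00' hr6).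
Qed.

(** The local amoeba contains a half-ball: on the slice through y there are a point
    where H <= 0 and, by moving zb, a point where H >= eta . y; [path_ivt] yields a
    point where H = eta . y. *)
Lemma fill zb : ivt_const n C * eps <= r0 -> ev f zb = 0 -> cbox p (eps / 2) zb ->
  (forall k, k != j -> lg zb k = lg p k) -> zb != p ->
  exists2 dl : R, 0 < dl & forall y, (forall k, `|y k| <= dl) -> 0 <= \sum_k eta k * y k ->
    exists z, [/\ ev f z = 0, cbox p r0 z & forall k, lg z k = lg p k + y k].
Proof.
move=> Ke fb bb sb bp.
have bbe : cbox p eps zb by apply: cbox_le bb; have := eps0; lra.
have hb : 0 < height zb.
  rewrite lt_neqAle Hpos// andbT eq_sym (height0 sb) mulf_eq0 (negbTE Hj)/= subr_eq0.
  apply: contra bp => /eqP ej; apply/eqP; apply: Hiso => // k.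
  by have [->//|kj] := eqVneq k j; exact: sb.
have [dl dl0 hlow] := low_point_on_slice.
have [K K1 hpert] := move_moduli chart.
have K0 : 0 < K by lra.
have [|d d0 /= /and4P[hd1 hd2 hd3 _]] := @small_radius _
  [:: (1, dl); (K, eps / 2); (`|eta j| * (K / r0 + 1), height zb)].
  by rewrite /= dl0 hb divr_gt0.
exists d => // y hy hpos.
have hy1 k : `|y k| <= dl by rewrite (le_trans (hy k))//; lra.
have [z1 [f1 b1 s1 h1]] := hlow y hy1.
have bbr : cbox p (r0 / 2) zb by apply: cbox_le bb; have := epsr; have := eps0; lra.
have Kd : K * d <= r0 / 2 by have := epsr; have := eps0; lra.
have [z2 [f2 b2 s2]] := hpert zb y d bbr fb hy Kd.
have b2e : cbox p eps z2.
  have -> : eps = eps / 2 + eps / 2 by field.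
  exact: cboxD bb (cbox_le hd2 b2).
have s2' k : k != j -> lg z2 k = lg p k + y k by move=> kj; rewrite s2// sb.
pose g := lg p j + y j.
have q1 : eta j * (lg z1 j - g) <= 0.
  rewrite (height_slice s1) in h1; rewrite (bigD1 j)//= in hpos; rewrite /g; lra.
have lz2 : `|lg z2 j - lg zb j| <= K * d / r0.
  have hzr := cbox_le epsr0 b2e; have hbr := cbox_le epsr0 bbe.
  rewrite (le_trans (lg_dist r00 (Hnz hbr j) (Hnz hzr j)))// ler_pM2r ?invr_gt0//.
have q2 : 0 <= eta j * (lg z2 j - g).
  have q3 : `|eta j * (lg z2 j - lg zb j - y j)| <= height zb.
    rewrite normrM (le_trans _ hd3)// -mulrA ler_wpM2l//.
    rewrite (le_trans (ler_normB _ _))//.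
    have -> : (K / r0 + 1) * d = K * d / r0 + d by ring.
    by rewrite lerD.
  move: q3; rewrite (height0 sb) ler_norml => /andP[q3 _]; rewrite /g; lra.
have fin za zc : ev f za = 0 -> ev f zc = 0 -> cbox p eps za -> cbox p eps zc ->
    (forall k, k != j -> lg za k = lg p k + y k) -> (forall k, k != j -> lg zc k = lg p k + y k) ->
    lg za j <= g <= lg zc j ->
    exists z, [/\ ev f z = 0, cbox p r0 z & forall k, lg z k = lg p k + y k].
  move=> fa fc ba bc sa sc hg.
  have [|z [fz bz sz lz]] := path_ivt chart Ke ba bc fa fc _ hg.
    by move=> k kj; rewrite sa// sc.
  exists z; split=> // k; have [->|kj] := eqVneq k j; first exact: lz.
  by rewrite sz// sa.
have [jp|jn] := ltP 0 (eta j).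
  apply: (fin z1 z2) => //; apply/andP; split.
    by rewrite -subr_le0 -(pmulr_rle0 _ jp).
  by rewrite -subr_ge0 -(pmulr_rge0 _ jp).
have jn' : eta j < 0 by rewrite lt_neqAle Hj.
apply: (fin z2 z1) => //; apply/andP; split.
  by rewrite -subr_le0 -(nmulr_rge0 _ jn').
by rewrite -subr_ge0 -(nmulr_rle0 _ jn').
Qed.

End OneSided.

(** * The normal vector of a branch *)

Section RealBoxes.
Context {R : realType} {n : nat}.
Implicit Types (x y v : 'rV[R]_n).

Lemma nbhs_rboxP x (U : set 'rV[R]_n) : nbhs x U <->
  exists2 d : R, 0 < d & forall y, (forall k, `|y 0 k - x 0 k| <= d) -> U y.
Proof.
split=> [/nbhs_ballP[e /= e0 eU]|[d d0 h]].
  exists (e / 2); first by rewrite divr_gt0.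
  move=> y hy; apply: eU; split=> // i k; rewrite (ord1 i) -ball_normE /= distrC.
  by rewrite (le_lt_trans (hy k))// ltr_pdivrMr// ltr_pMr// ltr1n.
apply/nbhs_ballP; exists d => //= y [_ hy]; apply: h => k.
by have := hy 0 k; rewrite -ball_normE /= distrC => /ltW.
Qed.

(** A sequence converges as soon as its coordinates do at the speed 1/m. *)
Lemma rate_cvg (u : nat -> 'rV[R]_n) x (K : R) :
  (forall m k, `|u m 0 k - x 0 k| <= K / m.+1%:R) -> u m @[m --> \oo] --> x.
Proof.
move=> h A /nbhs_rboxP[d d0 hd].
have q0 : 0 < d / (`|K| + 1) by rewrite divr_gt0// ltr_wpDl.
have [N _ hN] := near_infty_natSinv_lt (PosNum q0).
exists N => // m Nm; apply: hd => k; rewrite (le_trans (h m k))//.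
have /= := hN m Nm; rewrite ltr_pdivlMr ?ltr_wpDl// => hm.
have i0 : 0 <= m.+1%:R^-1 :> R by rewrite invr_ge0.
set q := m.+1%:R^-1 in hm i0 *.
have : K * q <= `|K| * q by rewrite ler_wpM2r// ler_norm.
lra.
Qed.

Lemma points_inside_ex (A : set 'rV[R]_n) x v (d : R) : 0 < d -> points_inside A x v ->
  exists2 t : R, 0 < t < d & A (x + t *: v).
Proof.
move=> d0 hA.
have h : \forall t \near (0 : R)^'+, [/\ A (x + t *: v), t < d & 0 < t].
  by near=> t; split; near: t; [exact: hA|exact: nbhs_right_lt|exact: nbhs_right_gt].
by have [t [t1 t2 t3]] := filter_ex h; exists t; rewrite ?t2 ?t3.
Unshelve. all: by end_near. Qed.

Lemma points_insideI (A : set 'rV[R]_n) x v (d : R) : 0 < d ->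
  (forall t, 0 < t <= d -> A (x + t *: v)) -> points_inside A x v.
Proof.
move=> d0 h; rewrite /points_inside; near=> t; apply: h.
by apply/andP; split; near: t; [exact: nbhs_right_gt|exact: nbhs_right_le].
Unshelve. all: by end_near. Qed.

End RealBoxes.

Section Charts.
Context {R : realType} {n : nat}.
Implicit Types (f : mpoly n (Cx R)) (z p : 'rV[Cx R]_n).

Lemma hypersurfaceP f z : hypersurface f z <-> (forall k, z 0 k != 0) /\ ev f z = 0.
Proof. by rewrite ev.unlock. Qed.

(** A point of V with a real Gauss vector has charts of arbitrarily small radius. *)
Lemma chart_exists f p (eta : 'I_n -> R) (c : Cx R) (j : 'I_n) (r : R) :
  hypersurface f p -> (forall k, rc (eta k) = c * gauss f p k) -> eta j != 0 -> 0 < r ->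
  exists (C r0 B : R), r0 <= r /\ branch_chart f p eta c j C r0 B.
Proof.
move=> /hypersurfaceP[tp fp] he hj r_gt0.
have dj : ev (mderiv j f) p != 0.
  apply: contra hj => /eqP d0; have := he j; rewrite /gauss d0 !mulr0 => /eqP.
  by rewrite eq_complex /= => /andP[].
have [C1 [d1 [C10 d10 h1]]] := root_near dj.
have [C2 [d2 [C20 d20 h2]]] := graph_lipschitz dj.
have [L L0 hL] := differential_bound f p.
have [d3 d30 h3] := meval_strictly_differentiable f p ltr01.
have [m m0 hm] : exists2 m : R, 0 < m & forall k, m <= nc (p 0 k) / 2.
  by apply: finite_min => k; rewrite divr_gt0// nc_gt0.
pose C := 1 + C1 + C2 + L.
pose r0 := Num.min (Num.min (Num.min r m) (Num.min d1 d2)) d3.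
have r00 : 0 < r0 by rewrite !lt_min r_gt0 m0 d10 d20 d30.
have q1 : r0 <= r by rewrite /r0 !ge_min lexx.
have q2 : r0 <= m by rewrite /r0 !ge_min lexx !orbT.
have q3 : r0 <= d1 by rewrite /r0 !ge_min lexx !orbT.
have q4 : r0 <= d2 by rewrite /r0 !ge_min lexx !orbT.
have q5 : r0 <= d3 by rewrite /r0 !ge_min lexx !orbT.
exists C, r0, (\sum_k nc (p 0 k) + r0); split=> //; split=> //.
- by rewrite /C; lra.
- move=> z hz k; have := hz k; have := nc_sub_ge (p 0 k) (z 0 k).
  by rewrite nc_sym; have := hm k; lra.
- move=> z hz; have [dz [c' fc hc]] := h1 z (cbox_le q3 hz); split=> //; exists c' => //.
  by rewrite (le_trans hc)// ler_wpM2r ?nc_ge0// /C; lra.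
- move=> z w hz hw fz fw; rewrite (le_trans (h2 z w (cbox_le q4 hz) (cbox_le q4 hw) fz fw))//.
  rewrite ler_wpM2r ?sumr_ge0// => [k _|]; [exact: nc_ge0|rewrite /C; lra].
- move=> z w hz hw; have := h3 z w (cbox_le q5 hz) (cbox_le q5 hw); have := hL z w.
  set D := differential _ _ _ => k1 k2.
  have D0 := dist1_ge0 z w.
  rewrite -[X in nc X](subrK D) (le_trans (ncD _ _))// (le_trans (lerD k2 k1))//.
  by rewrite -mulrDl ler_wpM2r// /C; lra.
- move=> z k hz; rewrite -[z 0 k](subrK (p 0 k)) (le_trans (ncD _ _))// addrC lerD//.
  by rewrite (bigD1 k)//= lerDl sumr_ge0// => i _; exact: nc_ge0.
Qed.

Lemma chart_opp f p (eta : 'I_n -> R) (c : Cx R) (j : 'I_n) (C r0 B : R) :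
  branch_chart f p eta c j C r0 B -> branch_chart f p (fun k => - eta k) (- c) j C r0 B.
Proof.
case=> h1 h2 h3 h4 h5 h6 h7 h8 h9 h10; split=> //; last by rewrite oppr_eq0.
by move=> k; rewrite mulNr -h2; cplx.
Qed.

Lemma chart_hypersurface f p (eta : 'I_n -> R) (c : Cx R) (j : 'I_n) (C r0 B : R) z :
  branch_chart f p eta c j C r0 B -> cbox p r0 z -> ev f z = 0 -> hypersurface f z.
Proof.
case=> _ _ _ _ r00 hnz _ _ _ _ hz fz; apply/hypersurfaceP; split=> // k.
by rewrite -nc_gt0 (lt_le_trans r00)// hnz.
Qed.

Lemma ivt_const_gt0 (C : R) : 0 <= C -> 0 < ivt_const n C.
Proof. by move=> C0; rewrite /ivt_const ltr_pwDl// !mulr_ge0. Qed.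

(** If log |z_j| takes values on both sides of log |p_j| on the slice of p, then the
    branch covers a neighbourhood of Log p. *)
Lemma both_sides f p (eta : 'I_n -> R) (c : Cx R) (j : 'I_n) (C r0 B : R) :
  branch_chart f p eta c j C r0 B ->
  (forall e : R, 0 < e -> exists z, [/\ ev f z = 0, cbox p e z,
     forall k, k != j -> lg z k = lg p k & lg z j < lg p j]) ->
  (forall e : R, 0 < e -> exists z, [/\ ev f z = 0, cbox p e z,
     forall k, k != j -> lg z k = lg p k & lg p j < lg z j]) ->
  exists2 d : R, 0 < d & forall y : 'I_n -> R, (forall k, `|y k| <= d) ->
    exists z, [/\ ev f z = 0, cbox p r0 z & forall k, lg z k = lg p k + y k].
Proof.
move=> ch hlo hhi; have [_ _ _ C1 r00 hnz _ _ _ _] := ch.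
have C0 : 0 <= C by lra.
have K10 := ivt_const_gt0 C0.
pose e := Num.min (r0 / 2) (r0 / ivt_const n C).
have e0 : 0 < e by rewrite lt_min !divr_gt0.
have eK : ivt_const n C * e <= r0 by rewrite mulrC -ler_pdivlMr// /e ge_min lexx orbT.
have er : e <= r0 / 2 by rewrite /e ge_min lexx.
have e20 : 0 < e / 2 by rewrite divr_gt0.
have [za [fa ba sa la]] := hlo _ e20; have [zc [fc bc sc lc]] := hhi _ e20.
have [K K1 hpert] := move_moduli ch.
have da : 0 < lg p j - lg za j by rewrite subr_gt0.
have dc : 0 < lg zc j - lg p j by rewrite subr_gt0.
have [|d d0 /= /and5P[hd1 hd2 hd3 _ _]] := @small_radius _
  [:: (K, e / 2); (K / r0 + 1, lg p j - lg za j); (K / r0 + 1, lg zc j - lg p j); (1, 1)].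
  by rewrite /= e20 da dc ltr01.
exists d => // y hy.
have bar : cbox p (r0 / 2) za by apply: cbox_le ba; lra.
have bcr : cbox p (r0 / 2) zc by apply: cbox_le bc; lra.
have Kd : K * d <= r0 / 2 by lra.
have ee : e = e / 2 + e / 2 by field.
have [z1 [f1 b1 s1]] := hpert za y d bar fa hy Kd.
have [z2 [f2 b2 s2]] := hpert zc y d bcr fc hy Kd.
have b1e : cbox p e z1 by rewrite ee; exact: cboxD ba (cbox_le hd1 b1).
have b2e : cbox p e z2 by rewrite ee; exact: cboxD bc (cbox_le hd1 b2).
have rr : r0 / 2 <= r0 by lra.
have l1 : `|lg z1 j - lg za j| <= K * d / r0.
  rewrite (le_trans (lg_dist r00 (hnz _ (cbox_le rr bar) j) (hnz _ (cbox_le (le_trans er rr) b1e) j)))//.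
  by rewrite ler_pM2r ?invr_gt0.
have l2 : `|lg z2 j - lg zc j| <= K * d / r0.
  rewrite (le_trans (lg_dist r00 (hnz _ (cbox_le rr bcr) j) (hnz _ (cbox_le (le_trans er rr) b2e) j)))//.
  by rewrite ler_pM2r ?invr_gt0.
have Kd' : (K / r0 + 1) * d = K * d / r0 + d by ring.
have yj := hy j; rewrite Kd' in hd2 hd3.
move: l1 l2 yj; rewrite !ler_norml => /andP[? ?] /andP[? ?] /andP[? ?].
have s12 k : k != j -> lg z1 k = lg z2 k by move=> kj; rewrite s1// s2// sa// sc.
have [|z [fz bz sz lz]] := path_ivt (h := lg p j + y j) ch eK b1e b2e f1 f2 s12.
  by apply/andP; split; lra.
exists z; split=> // k; have [->|kj] := eqVneq k j; first exact: lz.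
by rewrite sz// s1// sa.
Qed.

(** If the ratios of the coordinates of the Gauss vector are real, the point is a
    critical point of Log. *)
Lemma chart_Critp f p (eta : 'I_n -> R) (c : Cx R) (j : 'I_n) (C r0 B : R) z :
  branch_chart f p eta c j C r0 B -> cbox p r0 z -> ev f z = 0 ->
  (forall k, complex.Im (gauss f z k / gauss f z j) = 0) -> Critp f z.
Proof.
move=> ch hz fz him; apply/Critp_gauss.
have hV := chart_hypersurface ch hz fz.
have [dj _] := chart_root ch hz.
have gj : gauss f z j != 0 := gauss_neq0 ch hz.
split.
  split=> //; apply: contra dj => /eqP g0; rewrite -gradE g0 mxE//.
exists (\row_k complex.Re (gauss f z k / gauss f z j)).
  apply/eqP => /rowP/(_ j); rewrite !mxE mulfV//= => /eqP; rewrite oner_eq0//.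
exists (gauss f z j)^-1 => k; rewrite mxE [RHS]mulrC.
by have := him k; case: (_ / _) => a b /= ->.
Qed.

End Charts.

Section OneSidedBranch.
Context {R : realType} {n : nat}.
Variables (f : mpoly n (Cx R)) (p : 'rV[Cx R]_n) (eta : 'I_n -> R) (c : Cx R).
Variables (j : 'I_n) (C r0 B e0 : R) (v : 'rV[R]_n).
Hypothesis chart : branch_chart f p eta c j C r0 B.
Hypothesis e00 : 0 < e0.
(* The branch lies on one side on the slice of p, p is isolated in its fibre, and v is
   a normal vector pointing inside. *)
Hypothesis Hside : forall z, ev f z = 0 -> cbox p e0 z ->
  (forall k, k != j -> lg z k = lg p k) -> 0 <= eta j * (lg z j - lg p j).
Hypothesis Hiso : forall z, ev f z = 0 -> cbox p r0 z ->
  (forall k, lg z k = lg p k) -> z = p.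
Hypothesis v0 : v != 0.
Hypothesis Hnormal : forall w, tangent_cone (critical_branch f (cbox p r0)) (Log p) w ->
  v *m w^T = 0.
Hypothesis Hin : forall r : R, 0 < r <= r0 ->
  points_inside (local_amoeba f (cbox p r)) (Log p) v.

Let r00 : 0 < r0. Proof. by case: chart. Qed.
Let Hj : eta j != 0. Proof. by case: chart. Qed.
Let fp0 : ev f p = 0. Proof. by case: chart. Qed.
Let C1 : 1 <= C. Proof. by case: chart. Qed.
Let Hnz z : cbox p r0 z -> forall k, r0 <= nc (z 0 k). Proof. by case: chart => ? ? ? ? ? h *; exact: h. Qed.
Let C0 : 0 <= C. Proof. exact: le_trans ler01 C1. Qed.

Let eps := Num.min e0 (Num.min (r0 / 2) (r0 / ivt_const n C)).
Let eps0 : 0 < eps. Proof. by rewrite !lt_min e00 !divr_gt0// ivt_const_gt0. Qed.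
Let epsr : eps <= r0 / 2. Proof. by rewrite /eps !ge_min lexx orbT. Qed.
Let epse : eps <= e0. Proof. by rewrite /eps ge_min lexx. Qed.
Let epsK : ivt_const n C * eps <= r0.
Proof. by rewrite mulrC -ler_pdivlMr ?ivt_const_gt0// /eps !ge_min lexx !orbT. Qed.
Let epsr0 : eps <= r0. Proof. by have := r00; have := epsr; lra. Qed.

Let Hpos z : ev f z = 0 -> cbox p eps z -> (forall k, k != j -> lg z k = lg p k) ->
  0 <= height p eta z.
Proof. by move=> fz bz sz; rewrite (height0 _ sz); apply: Hside => //; exact: (cbox_le epse). Qed.

Let Hiso' z : ev f z = 0 -> cbox p eps z -> (forall k, lg z k = lg p k) -> z = p.
Proof. by move=> fz bz; apply: Hiso => //; exact: (cbox_le epsr0). Qed.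

Lemma dot_mx (w : 'rV[R]_n) : (v *m w^T) 0 0 = \sum_k v 0 k * w 0 k.
Proof. by rewrite mxE; apply: eq_bigr => k _; rewrite mxE. Qed.

Lemma Log_point z t : Log z = Log p + t *: v -> forall k, lg z k = lg p k + t * v 0 k.
Proof. by move=> h k; rewrite -[lg z k]LogE h [LHS]mxE [X in _ + X]mxE LogE. Qed.

(** In dimension 1 the branch would be the point p, and no direction would point
    inside its amoeba. *)
Lemma other_index : exists k, k != j.
Proof.
apply: contrapT => hn.
have rr : 0 < r0 <= r0 by rewrite r00 lexx.
have [t /andP[t0 _] [z [hz bz] ez]] := points_inside_ex ltr01 (Hin rr).
have [_ fz] := (hypersurfaceP f z).1 hz.
have pp := cbox_center p (ltW r00).
have := chart_graph chart pp bz fp0 fz.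
rewrite big1 => [|k kj]; last by case: hn; exists k.
rewrite mulr0 => zj; have ej : z 0 j = p 0 j.
  by apply/eqP; rewrite -subr_eq0 -nc_eq0 eq_le zj nc_ge0.
have zp : z = p.
  apply/rowP => k; have [->//|kj] := eqVneq k j; first by case: hn; exists k.
move/negP: v0; apply.
have := Log_point ez; rewrite zp => h; apply/eqP/rowP => k; rewrite mxE.
have : t * v 0 k = 0 by have := h k; lra.
by move=> /eqP; rewrite mulf_eq0 (gt_eqF t0) => /eqP.
Qed.

Lemma cay_neq1 (t : R) : t != 0 -> cay t != 1.
Proof.
move=> t0; apply: contra t0 => /eqP ct; have [x [E1 E2 E3 _ [d _]]] := cay_half t.
move: ct; rewrite cay.unlock E1 => /(congr1 (fun y => y * (1 - x))).
rewrite divfK// mul1r => /eqP; rewrite -subr_eq0.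
have -> : 1 + x - (1 - x) = 2 * x by ring.
rewrite mulf_eq0 -nc_eq0 nc2 (gt_eqF (ltr0Sn _ 1))/= -nc_eq0 E3 mulf_eq0 normr_eq0 invr_eq0.
by rewrite (gt_eqF (ltr0Sn _ 1)) orbF.
Qed.

(** Rotating a coordinate k != j yields points other than p on the slice of p. *)
Lemma slice_point (e : R) : 0 < e -> exists z, [/\ ev f z = 0, cbox p e z,
  forall k, k != j -> lg z k = lg p k & z != p].
Proof.
move=> ep; have [k kj] := other_index.
have pp := cbox_center p (ltW r00).
have B0 : 0 <= B by apply: le_trans (nc_ge0 (p 0 j)) _; exact: (chart_bound chart).
have [|t t0 /= /and3P[ht1 ht2 _]] := @small_radius _ [:: (B, Num.min r0 e); (C * (C * B), e)].
  by rewrite /= lt_min r00 ep.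
pose w := upd p k (p 0 k * cay t).
have wk : nc (w 0 k - p 0 k) <= B * t.
  rewrite updE eqxx; have -> : p 0 k * cay t - p 0 k = p 0 k * (cay t - cay 0) by rewrite cay0; ring.
  rewrite ncM; apply: ler_pM; rewrite ?nc_ge0 ?(chart_bound chart)//.
  by rewrite (le_trans (cay_lip _ _))// subr0 gtr0_norm.
have wi i : i != k -> w 0 i = p 0 i by move=> ik; rewrite updE (negbTE ik).
have bw : cbox p (B * t) w.
  move=> i; have [->//|ik] := eqVneq i k.
  by rewrite wi// subrr nc0 mulr_ge0// ltW.
have bwr : cbox p r0 w by apply: cbox_le bw; rewrite (le_trans ht1)// ge_min lexx.
have bwe : cbox p e w by apply: cbox_le bw; rewrite (le_trans ht1)// ge_min lexx orbT.
have wj : w 0 j = p 0 j by rewrite wi// eq_sym.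
have [c' fc hc] := slice_lift chart pp fp0 bwr wj.
have dw : dist1 p w <= B * t.
  rewrite dist1.unlock (bigD1 k)//= big1 ?addr0// => i ik.
  by rewrite wi// subrr nc0.
exists (upd w j c'); split=> //.
- move=> i; rewrite updE; case: eqP => [->|_]; last exact: bwe.
  rewrite (le_trans hc)// (le_trans _ ht2)//.
  by rewrite -!mulrA !ler_wpM2l.
- move=> i ij; rewrite /lg updE (negbTE ij); have [->|ik] := eqVneq i k; last by rewrite wi.
  by rewrite updE eqxx ncM nc_cay mulr1.
- apply/eqP => /rowP/(_ k); rewrite updE (negbTE kj) updE eqxx => /eqP.
  rewrite -subr_eq0; have -> : p 0 k * cay t - p 0 k = p 0 k * (cay t - 1) by ring.
  rewrite mulf_eq0 -nc_eq0 (gt_eqF (lt_le_trans r00 (Hnz pp k)))/= subr_eq0.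
  by rewrite (negbTE (cay_neq1 _))// gt_eqF.
Qed.

(** The tangent cone to the branch of critical values contains the hyperplane
    orthogonal to eta. *)
Lemma tangent_eta (w : 'rV[R]_n) : \sum_k eta k * w 0 k = 0 ->
  tangent_cone (critical_branch f (cbox p r0)) (Log p) w.
Proof.
move=> ew; pose em (m : nat) : R := Num.min r0 m.+1%:R^-1.
have em0 m : 0 < em m by rewrite lt_min r00 invr_gt0 ltr0Sn.
have aj0 : 0 < `|eta j| by rewrite normr_gt0.
have /choice[zt hzt] : forall m, exists zt : 'rV[Cx R]_n * R, [/\ 0 < zt.2 <= m.+1%:R^-1,
    ev f zt.1 = 0 /\ cbox p r0 zt.1, forall k, k != j -> lg zt.1 k = lg p k + zt.2 * w 0 k,
    `|lg zt.1 j - lg p j - zt.2 * w 0 j| <= m.+1%:R^-1 / `|eta j| * zt.2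
    & forall k, complex.Im (gauss f zt.1 k / gauss f zt.1 j) = 0].
  move=> m; have [t0 t00 h] := critical_near chart eps0 epsr Hpos Hiso' (fun k => w 0 k) (em0 m).
  pose t := Num.min t0 m.+1%:R^-1.
  have tp : 0 < t by rewrite lt_min t00 invr_gt0 ltr0Sn.
  have [|z [fz bz sz hz gz]] := h t; first by rewrite tp /t ge_min lexx.
  exists (z, t); split=> //=.
  - by rewrite tp /t ge_min lexx orbT.
  - by split=> //; apply: cbox_le bz; rewrite /em ge_min lexx.
  - have hs := height_slice eta sz.
    have e1 : \sum_(k | k != j) eta k * (t * w 0 k) = - (eta j * (t * w 0 j)).
      have -> : \sum_(k | k != j) eta k * (t * w 0 k) = t * \sum_(k | k != j) eta k * w 0 k.
        by rewrite mulr_sumr; apply: eq_bigr => k _; ring.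
      move: ew; rewrite (bigD1 j)//= => ew.
      have -> : \sum_(k | k != j) eta k * w 0 k = - (eta j * w 0 j) by lra.
      by ring.
    have -> : lg z j - lg p j - t * w 0 j = height p eta z / eta j.
      by rewrite hs e1; field.
    rewrite normrM normfV mulrAC ler_pM2r ?invr_gt0// (le_trans hz)// ler_wpM2r ?(ltW tp)//.
    by rewrite /em ge_min lexx orbT.
exists (fun m => Log (zt m).1), (fun m => (zt m).2^-1); split.
- move=> m; have [/andP[t0 _] [fz bz] sz lz gz] := hzt m; split; last by rewrite invr_gt0.
  exists (zt m).1 => //; split; first by split=> //; exact: chart_hypersurface chart bz fz.
  exact: chart_Critp chart bz fz gz.
- pose W := \sum_k `|w 0 k| + 1 / `|eta j|.
  apply: (@rate_cvg _ _ _ _ W) => m k; have [/andP[t0 t1] _ sz lz _] := hzt m.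
  have Wk : `|w 0 k| <= \sum_i `|w 0 i| by rewrite (bigD1 k)//= lerDl sumr_ge0.
  have ie : 0 <= 1 / `|eta j| by rewrite divr_ge0.
  have tw : `|(zt m).2 * w 0 k| <= (\sum_i `|w 0 i|) / m.+1%:R.
    by rewrite normrM gtr0_norm// mulrC ler_pM// ltW.
  rewrite !LogE mulrDl; have [kj|kj] := eqVneq k j; last first.
    rewrite sz// addrC addKr (le_trans tw)// lerDl mulr_ge0// invr_ge0//.
  rewrite kj in tw *; have -> : lg (zt m).1 j - lg p j = (zt m).2 * w 0 j + (lg (zt m).1 j - lg p j - (zt m).2 * w 0 j) by ring.
  rewrite (le_trans (ler_normD _ _))// lerD// (le_trans lz)//.
  have m1 : m.+1%:R^-1 <= 1 :> R by rewrite invf_le1// ler1n.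
  have -> : 1 / `|eta j| / m.+1%:R = m.+1%:R^-1 / `|eta j| * 1 by rewrite mulr1 mul1r mulrC.
  rewrite ler_wpM2l ?(le_trans t1)// mulr_ge0 ?invr_ge0//.
- apply: (@rate_cvg _ _ _ _ (1 / `|eta j|)) => m k.
  have [/andP[t0 t1] _ sz lz _] := hzt m.
  have -> : ((zt m).2^-1 *: (Log (zt m).1 - Log p)) 0 k = (zt m).2^-1 * (lg (zt m).1 k - lg p k).
    rewrite mxE; congr (_ * _); rewrite -!LogE; by rewrite [LHS]mxE [X in _ + X]mxE.
  have -> : (zt m).2^-1 * (lg (zt m).1 k - lg p k) - w 0 k =
      (zt m).2^-1 * (lg (zt m).1 k - lg p k - (zt m).2 * w 0 k) by field; rewrite gt_eqF.
  rewrite normrM gtr0_norm ?invr_gt0// mulrC ler_pdivrMr//.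
  have [->|kj] := eqVneq k j.
    by have -> : 1 / `|eta j| / m.+1%:R = m.+1%:R^-1 / `|eta j| by rewrite mul1r mulrC.
  rewrite sz// addrAC addrK subrr normr0 !mulr_ge0 ?invr_ge0// ltW//.
Qed.

(** The normal vector is a multiple of eta by the previous lemma, and the factor is
    positive because v points inside an amoeba satisfying [lower_bound]. *)
Lemma normal_parallel : exists2 ka : R, 0 < ka & forall k, v 0 k = ka * eta k.
Proof.
have vk k : v 0 k * eta j = v 0 j * eta k.
  have [->//|kj] := eqVneq k j; pose w : 'rV[R]_n := eta j *: delta_mx 0 k - eta k *: delta_mx 0 j.
  have wE i : w 0 i = eta j * (i == k)%:R - eta k * (i == j)%:R by rewrite !mxE !eqxx.
  have dot (a : 'I_n -> R) : \sum_i a i * w 0 i = a k * eta j - a j * eta k.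
    have wk : w 0 k = eta j by rewrite wE eqxx (negbTE kj) mulr1 mulr0 subr0.
    have wj : w 0 j = - eta k.
      by rewrite wE eqxx eq_sym (negbTE kj) mulr1 mulr0 sub0r.
    rewrite (bigD1 k)//= (bigD1 j) 1?eq_sym//= big1 => [|i /andP[ik ij]].
      by rewrite wk wj addr0 mulrN.
    by rewrite wE (negbTE ik) (negbTE ij) !mulr0 subrr mulr0.
  have := Hnormal (tangent_eta _ : _ w); rewrite dot mulrC subrr => /(_ erefl).
  by move=> /matrixP/(_ 0 0); rewrite dot_mx dot mxE => /eqP; rewrite subr_eq0 => /eqP.
pose ka := v 0 j / eta j.
have vE k : v 0 k = ka * eta k.
  by apply: (mulIf Hj); rewrite vk /ka; field.
exists ka => //; rewrite ltNge; apply/negP => ka_le.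
pose N := \sum_k eta k ^+ 2; pose S := \sum_(k | k != j) `|eta k|.
have N0 : 0 < N.
  rewrite /N (bigD1 j)//= ltr_pwDl ?sumr_ge0// => [|k _]; last exact: sqr_ge0.
  by rewrite lt_neqAle sqr_ge0 andbT eq_sym expf_neq0.
have S0 : 0 <= S by apply: sumr_ge0.
have ka0 : ka < 0.
  rewrite lt_neqAle ka_le andbT; apply: contra v0 => /eqP k0.
  by apply/eqP/rowP => k; rewrite vE k0 mul0r mxE.
pose e := N / (2 * (S + 1)).
have e_gt0 : 0 < e by rewrite divr_gt0// mulr_gt0// ltr_wpDl.
have [d d0 hlow] := lower_bound chart eps0 Hpos e_gt0.
pose d' := Num.min d r0.
have dd : 0 < d' <= r0 by rewrite lt_min d0 r00 ge_min lexx orbT.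
have [t /andP[t0 _] [z [hz bz] ez]] := points_inside_ex ltr01 (Hin dd).
have [_ fz] := (hypersurfaceP f z).1 hz.
have lz := Log_point ez.
have bzd : cbox p d z by apply: cbox_le bz; rewrite /d' ge_min lexx.
have := hlow z fz bzd.
have -> : height p eta z = t * (ka * N).
  rewrite /height /N !mulr_sumr; apply: eq_bigr => k _.
  by rewrite lz vE; ring.
have -> : \sum_(k | k != j) `|lg z k - lg p k| = t * (- ka * S).
  rewrite /S !mulr_sumr; apply: eq_bigr => k _.
  by rewrite lz vE addrC addKr 2!normrM (gtr0_norm t0) (ltr0_norm ka0).
have -> : - (e * (t * (- ka * S))) = t * (ka * (e * S)) by ring.
rewrite ler_pM2l// ler_nM2l// => NeS.
have : e * S <= N / 2.
  have -> : e * S = N / 2 * (S / (S + 1)) by rewrite /e; field; rewrite gt_eqF// ltr_wpDl.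
  rewrite ler_piMr ?divr_ge0 ?(ltW N0)//.
  by rewrite ler_pdivrMr ?ltr_wpDl// mul1r lerDl.
by lra.
Qed.

Lemma sided_lower (e : R) : 0 < e -> exists2 d : R, 0 < d & forall z, ev f z = 0 -> cbox p d z ->
  - (e * \sum_k `|lg z k - lg p k|) <= \sum_k v 0 k * (lg z k - lg p k).
Proof.
move=> ep; have [ka ka0 vE] := normal_parallel.
have eka : 0 < e / ka by rewrite divr_gt0.
have [d d0 hlow] := lower_bound chart eps0 Hpos eka.
exists d => // z fz bz; have := hlow z fz bz.
have -> : \sum_k v 0 k * (lg z k - lg p k) = ka * height p eta z.
  by rewrite /height mulr_sumr; apply: eq_bigr => k _; rewrite vE mulrA.
rewrite -(ler_pM2l ka0); apply: le_trans.
have -> : ka * - (e / ka * \sum_(k | k != j) `|lg z k - lg p k|) =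
  - (e * \sum_(k | k != j) `|lg z k - lg p k|) by field; rewrite gt_eqF.
by rewrite lerN2 ler_wpM2l ?(ltW ep)// [leRHS](bigD1 j)//= lerDr.
Qed.

Lemma sided_fill : exists2 d : R, 0 < d & forall y : 'I_n -> R, (forall k, `|y k| <= d) ->
  0 <= \sum_k v 0 k * y k -> exists z, [/\ ev f z = 0, cbox p r0 z & forall k, lg z k = lg p k + y k].
Proof.
have [ka ka0 vE] := normal_parallel.
have e20 : 0 < eps / 2 by rewrite divr_gt0.
have [zb [fb bb sb nb]] := slice_point e20.
have [d d0 h] := fill chart eps0 epsr Hpos Hiso' epsK fb bb sb nb.
exists d => // y hy hv; apply: h => //.
rewrite -(pmulr_rge0 _ ka0) mulr_sumr.
by have -> : \sum_k ka * (eta k * y k) = \sum_k v 0 k * y k;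
  [apply: eq_bigr => k _; rewrite vE mulrA|].
Qed.

End OneSidedBranch.

(** * Inward normals and the local amoeba *)

Section BranchBounds.
Context {R : realType} {n : nat}.
Implicit Types (f : mpoly n (Cx R)) (z p : 'rV[Cx R]_n) (v : 'rV[R]_n).

(** The small neighbourhoods used to define inward normals can be taken to be
    polydiscs. *)
Lemma inward_normal_cbox f p v : inward_normal f p v -> exists2 r1 : R, 0 < r1 &
  forall r, 0 < r <= r1 -> [/\ normal_to (critical_branch f (cbox p r)) (Log p) v,
    points_inside (local_amoeba f (cbox p r)) (Log p) v
    & ~ points_inside (local_amoeba f (cbox p r)) (Log p) (- v)].
Proof.
case=> M [M1 M2 [U MU]] hM; have [r1 r10 rU] := (nbhs_cboxP p U).1 (M1 U MU).
exists r1 => // r /andP[r0 rr]; apply: (hM (cbox p r)).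
apply: (M2 U) => //; first exact: nbhs_cbox.
by apply: subset_trans rU; apply: cbox_le.
Qed.

(** The local amoeba at p contains a half-ball of inner normal v, and is contained in
    it to first order. *)
Lemma branch_bounds f p v (r : R) : 0 < r -> Critp f p ->
  (forall z, hypersurface f z -> cbox p r z -> (forall k, lg z k = lg p k) -> z = p) ->
  inward_normal f p v ->
  (forall e : R, 0 < e -> exists2 d : R, 0 < d & forall z, hypersurface f z -> cbox p d z ->
     - (e * \sum_k `|lg z k - lg p k|) <= \sum_k v 0 k * (lg z k - lg p k)) /\
  (exists2 d : R, 0 < d & forall y : 'I_n -> R, (forall k, `|y k| <= d) ->
     0 <= \sum_k v 0 k * y k ->
     exists2 z, hypersurface f z & forall k, lg z k = lg p k + y k).
Proof.
move=> r_gt0 /Critp_gauss[[hp _] [e e0 [c ec]]] iso /inward_normal_cbox[r1 r10 hin].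
have [j ej] : exists j, e 0 j != 0.
  by apply: contrapT => hn; case/rowP: (elimN eqP e0) => k; rewrite mxE;
     apply: contrapT => /eqP ek; apply: hn; exists k.
have rm0 : 0 < Num.min r r1 by rewrite lt_min r_gt0.
have [C [r0 [B [r0r ch]]]] := chart_exists hp ec ej rm0.
have r00 := chart_r ch.
have [r0a r0b] : r0 <= r /\ r0 <= r1 by move: r0r; rewrite le_min => /andP[].
have [[v0 Hn] _ Hnot] := hin r0 (introT andP (conj r00 r0b)).
have Hin t : 0 < t <= r0 -> points_inside (local_amoeba f (cbox p t)) (Log p) v.
  move=> /andP[t0 tr]; have [|//] := hin t.
  by rewrite t0 (le_trans tr).
have Hiso z : ev f z = 0 -> cbox p r0 z -> (forall k, lg z k = lg p k) -> z = p.
  move=> fz bz; apply: iso; first exact: chart_hypersurface ch bz fz.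
  exact: cbox_le bz.
have sided (eta : 'I_n -> R) (c' : Cx R) (e1 : R) : branch_chart f p eta c' j C r0 B -> 0 < e1 ->
   (forall z, ev f z = 0 -> cbox p e1 z -> (forall k, k != j -> lg z k = lg p k) ->
      0 <= eta j * (lg z j - lg p j)) ->
  (forall e : R, 0 < e -> exists2 d : R, 0 < d & forall z, hypersurface f z -> cbox p d z ->
     - (e * \sum_k `|lg z k - lg p k|) <= \sum_k v 0 k * (lg z k - lg p k)) /\
  (exists2 d : R, 0 < d & forall y : 'I_n -> R, (forall k, `|y k| <= d) ->
     0 <= \sum_k v 0 k * y k ->
     exists2 z, hypersurface f z & forall k, lg z k = lg p k + y k).
  move=> ch' e10 hs; split=> [q q0|].
    have [d d0 hd] := sided_lower ch' e10 hs Hiso v0 Hn Hin q0.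
    by exists d => // z /hypersurfaceP[_ fz]; exact: hd.
  have [d d0 hd] := sided_fill ch' e10 hs Hiso v0 Hn Hin.
  exists d => // y hy hv; have [z [fz bz lz]] := hd y hy hv.
  by exists z => //; exact: chart_hypersurface ch bz fz.
(* The slice carries points of V on both sides of p, or one of the two signs is missing. *)
pose S (b : R) := exists2 e1 : R, 0 < e1 & forall z, ev f z = 0 -> cbox p e1 z ->
  (forall k, k != j -> lg z k = lg p k) -> 0 <= b * (lg z j - lg p j).
have [[e1 e10 h1]|nS] := pselect (S (e 0 j)); first exact: sided ch e10 h1.
have [[e1 e10 h1]|nS'] := pselect (S (- e 0 j)); first exact: sided (chart_opp ch) e10 h1.
have neg (b : R) : b != 0 -> ~ S b -> forall e1 : R, 0 < e1 -> exists z, [/\ ev f z = 0, cbox p e1 z,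
    forall k, k != j -> lg z k = lg p k & b * (lg z j - lg p j) < 0].
  move=> b0 nSb e1 e10; apply: contrapT => hno; apply: nSb; exists e1 => // z fz bz sz.
  by rewrite leNgt; apply/negP => hlt; apply: hno; exists z.
have nb : - e 0 j != 0 by rewrite oppr_eq0.
case: Hnot.
have [d d0 hd] : exists2 d : R, 0 < d & forall y : 'I_n -> R, (forall k, `|y k| <= d) ->
    exists z, [/\ ev f z = 0, cbox p r0 z & forall k, lg z k = lg p k + y k].
  have [ej0|ej0|/eqP] := ltgtP (e 0 j) 0; last by rewrite (negbTE ej).
  - apply: (both_sides ch) => e1 e10.
      have [z [fz bz sz lz]] := neg _ nb nS' e1 e10; exists z; split=> //.
      by move: lz; rewrite pmulr_rlt0 ?oppr_gt0// subr_lt0.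
    have [z [fz bz sz lz]] := neg _ ej nS e1 e10; exists z; split=> //.
    by move: lz; rewrite nmulr_rlt0// subr_gt0.
  - apply: (both_sides ch) => e1 e10.
      have [z [fz bz sz lz]] := neg _ ej nS e1 e10; exists z; split=> //.
      by move: lz; rewrite pmulr_rlt0// subr_lt0.
    have [z [fz bz sz lz]] := neg _ nb nS' e1 e10; exists z; split=> //.
    by move: lz; rewrite nmulr_rlt0 ?oppr_lt0// subr_gt0.
pose N := 1 + \sum_k `|v 0 k|.
have N0 : 0 < N by rewrite ltr_pwDl// sumr_ge0.
apply: (@points_insideI _ _ _ _ _ (d / N)); first by rewrite divr_gt0.
move=> t /andP[t0 td]; have [|z [fz bz lz]] := hd (fun k => - (t * v 0 k)).
  move=> k; rewrite normrN normrM gtr0_norm//; move: td; rewrite ler_pdivlMr//.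
  apply: le_trans; rewrite ler_pM2l// /N (bigD1 k)//=.
  have : 0 <= \sum_(i | i != k) `|v 0 i| by exact: sumr_ge0.
  by lra.
exists z; first by split=> //; exact: chart_hypersurface ch bz fz.
by apply/rowP => k; rewrite LogE lz [RHS]mxE LogE !mxE mulrN.
Qed.

End BranchBounds.

(** * Convex hulls and half-spaces *)

Section Gordan.
Context {R : realType} {n : nat}.
Implicit Types (a b w : 'rV[R]_n).

(** The scalar product of R^n. *)
Definition dot a b : R := \sum_k a 0 k * b 0 k.

Lemma dotDl a b w : dot (a + b) w = dot a w + dot b w.
Proof. by rewrite -big_split; apply: eq_bigr => k _; rewrite mxE mulrDl. Qed.

Lemma dotZl (t : R) a w : dot (t *: a) w = t * dot a w.
Proof. by rewrite mulr_sumr; apply: eq_bigr => k _; rewrite mxE mulrA. Qed.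

Lemma dotC a b : dot a b = dot b a.
Proof. by apply: eq_bigr => k _; rewrite mulrC. Qed.

Lemma dot_gt0 a : a != 0 -> 0 < dot a a.
Proof.
move=> a0; rewrite lt_def sumr_ge0 ?andbT => [|k _]; last by rewrite -expr2 sqr_ge0.
apply: contra a0 => /eqP; rewrite /dot => s0; apply/eqP/rowP => k; rewrite mxE.
have /psumr_eq0P : forall i : 'I_n, true -> 0 <= a 0 i * a 0 i.
  by move=> i _; rewrite -expr2 sqr_ge0.
by move=> /(_ s0 k isT) /eqP; rewrite -expr2 sqrf_eq0 => /eqP.
Qed.

Lemma convex_hull_cone s (v : 'I_s -> 'rV[R]_n) (c : 'I_s -> R) :
  (forall i, 0 <= c i) -> 0 < \sum_i c i -> \sum_i c i *: v i = 0 -> convex_hull v 0.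
Proof.
move=> c0 T0 cv; exists (fun i => c i / \sum_i c i); split.
- by move=> i; rewrite divr_ge0// ltW.
- by rewrite -mulr_suml divff// gt_eqF.
- have := congr1 (fun w => (\sum_i c i)^-1 *: w) cv.
  rewrite scaler0 scaler_sumr => e; rewrite -[LHS]e.
  by apply: eq_bigr => i _; rewrite scalerA mulrC.
Qed.

(** Gordan's theorem of the alternative, by induction on the number of vectors. *)
Lemma gordan s (v : 'I_s -> 'rV[R]_n) :
  (exists w, forall i, dot (v i) w < 0) \/ convex_hull v 0.
Proof.
elim: s v => [|s ih] v; first by left; exists 0; case.
pose a := v ord0; pose u i := v (lift ord0 i).
have split_ord (P : 'I_s.+1 -> Prop) : P ord0 -> (forall i, P (lift ord0 i)) -> forall i, P i.
  by move=> P0 Pl i; case: (unliftP ord0 i) => [k|] ->.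
have cone (c0 : R) (c : 'I_s -> R) : 0 <= c0 -> (forall i, 0 <= c i) -> 0 < c0 + \sum_i c i ->
    c0 *: a + \sum_i c i *: u i = 0 -> convex_hull v 0.
  move=> h0 hc T0 e; pose c' i := if unlift ord0 i is Some k then c k else c0.
  have cl i : c' (lift ord0 i) = c i by rewrite /c' liftK.
  have c'0 : c' ord0 = c0 by rewrite /c' unlift_none.
  apply: (@convex_hull_cone _ _ c').
  - by apply: split_ord => [|i]; rewrite ?cl ?c'0.
  - by rewrite big_ord_recl c'0 (eq_bigr c)// => i _; rewrite cl.
  - by rewrite big_ord_recl c'0 -[RHS]e; congr (_ + _); apply: eq_bigr => i _; rewrite cl.
have [[w hw]|[c [c0 c1 cu]]] := ih u; last first.
  right; apply: (cone 0 c) => //; first by rewrite c1 add0r.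
  by rewrite scale0r add0r -cu.
have [a0|a_neq0] := eqVneq a 0.
  right; apply: (cone 1 (fun=> 0)) => //.
    by rewrite big1// addr0.
  by rewrite a0 scaler0 big1 ?addr0// => i _; rewrite scale0r.
(* A direction orthogonal to a can be tilted towards - a. *)
have tilt w' : dot a w' = 0 -> (forall i, dot (u i) w' < 0) -> exists w, forall i, dot (v i) w < 0.
  move=> aw uw.
  have [|t t0 ht] := @finite_min R 'I_s (fun i => - dot (u i) w' / (`|dot (u i) a| + 1)).
    by move=> i; rewrite divr_gt0 ?oppr_gt0// ltr_wpDl.
  exists (w' - t *: a); apply: split_ord => [|i]; rewrite -/a -?/(u i) dotC dotDl -scaleNr dotZl.
    by rewrite dotC aw add0r mulNr oppr_lt0 mulr_gt0// dot_gt0.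
  rewrite !(dotC _ (u i)); have := ht i; rewrite ler_pdivlMr ?ltr_wpDl//.
  have : - (t * dot (u i) a) <= t * `|dot (u i) a|.
    by rewrite -mulrN ler_wpM2l ?(ltW t0)// -normrN ler_norm.
  by lra.
have [aw|aw|aw] := ltgtP (dot a w) 0; last by left; exact: tilt aw hw.
  by left; exists w; apply: split_ord.
pose u' i := dot a w *: u i - dot (u i) w *: a.
have [[w' hw']|[c [c0 c1 cu]]] := ih u'; last first.
  right; apply: (cone (\sum_i c i * - dot (u i) w) (fun i => c i * dot a w)).
  - by apply: sumr_ge0 => i _; rewrite mulr_ge0// oppr_ge0 ltW.
  - by move=> i; rewrite mulr_ge0// ltW.
  - by rewrite -mulr_suml c1 mul1r ltr_wpDl// sumr_ge0// => i _; rewrite mulr_ge0// oppr_ge0 ltW.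
  - rewrite [RHS]cu scaler_suml -big_split; apply: eq_bigr => i _.
    by rewrite /= /u' scalerBr !scalerA mulrN scaleNr addrC.
left; apply: (tilt (dot a w *: w' - dot a w' *: w)) => [|i].
  by rewrite dotC dotDl -scaleNr !dotZl !(dotC _ a) mulrC mulNr subrr.
have := hw' i; rewrite /u' dotDl -scaleNr !dotZl.
rewrite [in X in _ -> X]dotC dotDl -scaleNr !dotZl !(dotC _ (u i)).
by lra.
Qed.

(** If 0 is a convex combination of the v_i, the half-spaces v_i . y >= 0 cover the
    space. *)
Lemma hull_halfspaces s (v : 'I_s -> 'rV[R]_n) y : convex_hull v 0 ->
  exists i, 0 <= dot (v i) y.
Proof.
move=> [c [c0 c1 cv]]; apply: contrapT => hn.
have vy i : dot (v i) y < 0.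
  by rewrite ltNge; apply/negP => h; apply: hn; exists i.
have e : \sum_i c i * dot (v i) y = 0.
  have d0 : dot 0 y = 0 by rewrite -(scale0r (0 : 'rV[R]_n)) dotZl mul0r.
  suff -> : \sum_i c i * dot (v i) y = dot (\sum_i c i *: v i) y by rewrite -cv.
  by elim/big_rec2: _ => [|i b1 b2 _ ->] //; rewrite dotDl dotZl.
have h0 i : c i * dot (v i) y = 0.
  have : \sum_i c i * - dot (v i) y = 0.
    by rewrite -[RHS]oppr0 -[in RHS]e -sumrN; apply: eq_bigr => k _; rewrite mulrN.
  have /psumr_eq0P h : forall i : 'I_s, true -> 0 <= c i * - dot (v i) y.
    by move=> k _; rewrite mulr_ge0// oppr_ge0 ltW.
  by move=> /h/(_ i isT); rewrite mulrN => /eqP; rewrite oppr_eq0 => /eqP.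
suff : (1 : R) = 0 by move/eqP; rewrite oner_eq0.
rewrite -c1; apply: big1 => i _; have /eqP := h0 i.
by rewrite mulf_eq0 (lt_eqF (vy i)) orbF => /eqP.
Qed.

End Gordan.

(** * Properness of Log *)

Section Properness.
Context {R : realType} {n : nat}.
Implicit Types (f : mpoly n (Cx R)) (z : 'rV[Cx R]_n) (x : 'rV[R]_n).

(** Log being proper, the points z of V with Log z close to x are close to one of the
    points of the fibre. *)
Lemma fibre_cover f x s (p : 'I_s -> 'rV[Cx R]_n) (d : 'I_s -> R) :
  fibre f x `<=` range p -> (forall i, 0 < d i) ->
  exists2 e : R, 0 < e & forall z, hypersurface f z -> (forall k, `|lg z k - x 0 k| <= e) ->
    exists i, cbox (p i) (d i) z.
Proof.
move=> fp d0; pose M := \sum_k expR (x 0 k + 1).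
pose pp (a : R) := a + `|a|.
have pp0 a : 0 <= pp a by rewrite /pp; have := ler_norm (- a); rewrite normrN; lra.
have ppE a : (pp a <= 0) = (a <= 0).
  rewrite /pp; have [a0|a0] := leP 0 a; first by rewrite ger0_norm//; apply/idP/idP; lra.
  by rewrite ltr0_norm// subrr lexx ltW.
have lip_pp g z : lipat g z -> lipat (fun w => pp (g w)) z.
  by move=> h; apply: lipatD => //; exact: lipat_norm.
(* K is a compact subset of the torus off the given polydiscs, on which G, which
   vanishes only on the fibre, has a positive lower bound. *)
pose g z := \sum_k pp (expR (x 0 k - 1) - nc (z 0 k - 0)) + \sum_i pp (d i - dist1 (p i) z).
pose K := [set z | cbox (0 : 'rV[Cx R]_n) M z /\ g z <= 0].
have cK : compact K.
  apply: compact_sublevel; first exact: compact_cbox.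
  move=> z _; apply: lipat_continuous; apply: lipatD; apply: lipat_sum => i _; apply: lip_pp.
    by apply: lipatB; [exact: lipat_cst|exact: lipat_coord].
  by apply: lipatB; [exact: lipat_cst|exact: lipat_dist1].
have KP z : K z <-> [/\ cbox (0 : 'rV[Cx R]_n) M z, forall k, expR (x 0 k - 1) <= nc (z 0 k)
    & forall i, d i <= dist1 (p i) z].
  have s0 (I : finType) (a : I -> R) : (\sum_i pp (a i) <= 0) <-> (forall i, a i <= 0).
    split=> [h i|h]; last by apply: sumr_le0 => i _; rewrite ppE.
    rewrite -ppE; apply: le_trans h; rewrite (bigD1 i)//= lerDl sumr_ge0//.
  split=> [[h1]|[h1 h2 h3]].
    rewrite /g => h.
    have n1 : 0 <= \sum_k pp (expR (x 0 k - 1) - nc (z 0 k - 0)) by exact: sumr_ge0.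
    have n2 : 0 <= \sum_i pp (d i - dist1 (p i) z) by exact: sumr_ge0.
    split=> // [k|i].
      have /s0/(_ k) : \sum_k pp (expR (x 0 k - 1) - nc (z 0 k - 0)) <= 0 by lra.
      by rewrite subr_le0 subr0.
    have /s0/(_ i) : \sum_i pp (d i - dist1 (p i) z) <= 0 by lra.
    by rewrite subr_le0.
  split=> //; rewrite /g -[leRHS]addr0 lerD//; apply/s0 => i; rewrite subr_le0//.
  by rewrite subr0.
pose G z := nc (ev f z) + \sum_k `|lg z k - x 0 k|.
have znz z : K z -> forall k, z 0 k != 0.
  by move=> /KP[_ h _] k; rewrite -nc_gt0 (lt_le_trans _ (h k))// expR_gt0.
have [m m0 hm] : exists2 m, 0 < m & forall z, K z -> m <= G z.
  apply: compact_pos cK _ _ => z.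
    rewrite inE => kz; apply: lipat_continuous; apply: lipatD; first exact: lipat_ev.
    apply: lipat_sum => k _; apply: lipat_norm; apply: lipatB; last exact: lipat_cst.
    exact/lipat_lg/znz.
  move=> kz; have nn : 0 <= \sum_k `|lg z k - x 0 k| by exact: sumr_ge0.
  rewrite lt_def addr_ge0 ?nc_ge0// andbT; apply/negP => /eqP G0.
  have f0 : ev f z = 0.
    by apply/eqP; rewrite -nc_eq0; apply/eqP; have := nc_ge0 (ev f z); rewrite /G in G0; lra.
  have l0 : \sum_k `|lg z k - x 0 k| = 0 by move: G0; rewrite /G f0 nc0 add0r.
  have [i _ pz] : range p z.
    apply: fp; split; first by apply/hypersurfaceP; split=> //; exact: znz.
    apply/rowP => k; rewrite LogE; apply/eqP; rewrite -subr_eq0 -normr_eq0; apply/eqP.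
    have /psumr_eq0P h : forall k : 'I_n, true -> 0 <= `|lg z k - x 0 k| by [].
    exact: h l0 k isT.
  have [_ _ /(_ i)] := (KP z).1 kz; rewrite pz leNgt => /negP; apply.
  by rewrite dist1.unlock big1// => k _; rewrite subrr nc0.
exists (Num.min 1 (m / (n%:R + 1))) => [|z hz lz].
  by rewrite lt_min ltr01 divr_gt0// ltr_wpDl.
apply: contrapT => hn; have [tz fz] := (hypersurfaceP f z).1 hz.
have nE k : nc (z 0 k) = expR (lg z k) by rewrite /lg lnK// posrE nc_gt0.
have kz : K z.
  apply/KP; split=> [k|k|i].
  - rewrite mxE subr0 nE /M (bigD1 k)//=.
    have : expR (lg z k) <= expR (x 0 k + 1).
      by rewrite ler_expR; have := lz k; rewrite le_min => /andP[/ler_normlP[? ?] _]; lra.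
    have : 0 <= \sum_(i | i != k) expR (x 0 i + 1).
      by apply: sumr_ge0 => i _; exact: expR_ge0.
    lra.
  - rewrite nE ler_expR; have := lz k; rewrite le_min => /andP[/ler_normlP[? ?] _]; lra.
  - rewrite leNgt; apply/negP => h; apply: hn; exists i => k.
    by rewrite (le_trans (nc_le_dist1 (p i) z k))// ltW.
have := hm z kz; rewrite /G fz nc0 add0r leNgt => /negP; apply.
have q0 : 0 < m / (n%:R + 1) by rewrite divr_gt0// ltr_wpDl.
apply: (@le_lt_trans _ _ (\sum_(k < n) m / (n%:R + 1))).
  by apply: ler_sum => k _; rewrite (le_trans (lz k))// ge_min lexx orbT.
rewrite sumr_const card_ord -[X in X < _]mulr_natr mulrAC ltr_pdivrMr ?ltr_wpDl// mulrDr mulr1 ltrDl//.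
Qed.

End Properness.

Lemma dist1_gt0 (R : realType) n (z w : 'rV[Cx R]_n) : z != w -> 0 < dist1 z w.
Proof.
move=> zw; rewrite lt_def dist1_ge0 andbT; apply: contra zw; rewrite dist1.unlock => /eqP d0.
apply/eqP/rowP => k; apply/eqP; rewrite eq_sym -subr_eq0 -nc_eq0; apply/eqP.
have /psumr_eq0P h : forall k : 'I_n, true -> 0 <= nc (w 0 k - z 0 k) by move=> *; exact: nc_ge0.
exact: h d0 k isT.
Qed.

(** A finite family of distinct points has isolated points. *)
Lemma finite_isolated (R : realType) n s (p : 'I_s -> 'rV[Cx R]_n) i : injective p ->
  exists2 r : R, 0 < r & forall i', cbox (p i) r (p i') -> p i' = p i.
Proof.
move=> pinj; have n1 : 0 < n%:R + 1 :> R by rewrite ltr_wpDl.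
have [|r r0 hr] := @finite_min R 'I_s (fun i' => if i' == i then 1 else dist1 (p i) (p i') / (n%:R + 1)).
  move=> i'; case: eqVneq => // ii'; rewrite divr_gt0// dist1_gt0//.
  by rewrite (inj_eq pinj) eq_sym.
exists r => // i' /dist1_cbox; have := hr i'; have [->//|ii'] := eqVneq.
rewrite ler_pdivlMr// mulrDr mulr1 mulrC => h1 h2.
by exfalso; lra.
Qed.

(** * Interior points of the amoeba *)

Theorem theorem4p1 (R : realType) (n : nat) (f : mpoly n (Cx R))
    (x : 'rV[R]_n) (s : nat) (p : 'I_s -> 'rV[Cx R]_n) (v : 'I_s -> 'rV[R]_n) :
  (0 < n)%N ->
  regular_value f x ->
  fibre f x `<=` smooth_point f ->
  fibre f x `<=` Critp f ->
  injective p ->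
  range p = fibre f x ->
  (forall i, branch_dimension f (p i)) ->
  (forall i, inward_normal f (p i) (v i)) ->
  (~ convex_hull v 0 <-> boundary (amoeba f) x) /\
  (convex_hull v 0 <-> (amoeba f)° x).
Proof.
move=> _ [cv _] _ fc pinj rp _ inn.
have fp i : fibre f x (p i) by rewrite -rp; exists i.
have px i k : lg (p i) k = x 0 k by have [_ /= <-] := fp i; rewrite LogE.
have lgx z : (forall k, lg z k = x 0 k) -> Log z = x.
  by move=> h; apply/rowP => k; rewrite LogE.
have bb i : (forall e : R, 0 < e -> exists2 d : R, 0 < d &
       forall z, hypersurface f z -> cbox (p i) d z ->
       - (e * \sum_k `|lg z k - x 0 k|) <= dot (v i) (Log z - x)) /\
    (exists2 d : R, 0 < d & forall y : 'rV[R]_n, (forall k, `|y 0 k - x 0 k| <= d) ->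
       0 <= dot (v i) (y - x) -> amoeba f y).
  have [r r0 hr] := finite_isolated i pinj.
  have [|low [d d0 hd]] := branch_bounds r0 (fc _ (fp i)) _ (inn i).
    move=> z hz bz lz; have [i' _ pz] : range p z.
      by rewrite rp; split=> //=; apply: lgx => k; rewrite lz.
    by rewrite -pz in bz *; exact: hr.
  have dotE (y : 'rV[R]_n) : \sum_k v i 0 k * (y 0 k - x 0 k) = dot (v i) (y - x).
    by apply: eq_bigr => k _; rewrite !mxE.
  split=> [e e0|].
    have [d' d'0 h] := low e e0; exists d' => // z hz bz.
    have := h z hz bz; under eq_bigr do rewrite px.
    by under [leRHS]eq_bigr do rewrite px -LogE; rewrite dotE.
  exists d => // y hy vy; have [//||z hz lz] := hd (fun k => y 0 k - x 0 k).
    by rewrite dotE.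
  by exists z => //; apply/rowP => k; rewrite LogE lz px addrC subrK.
have ax : amoeba f x by case: cv => z [[hz _] _] <-; exists z.
have interior_hull : convex_hull v 0 <-> (amoeba f)° x.
  split=> [h0|hi].
    have /choice[d hd] : forall i, exists d : R, 0 < d /\ forall y : 'rV[R]_n,
        (forall k, `|y 0 k - x 0 k| <= d) -> 0 <= dot (v i) (y - x) -> amoeba f y.
      by move=> i; have [_ [d d0 h]] := bb i; exists d.
    have [r r0 hr] := finite_min (fun i => (hd i).1).
    apply/nbhs_rboxP; exists r => // y hy.
    have [i vy] := hull_halfspaces (y - x) h0.
    by apply: (hd i).2 vy => k; exact: le_trans (hy k) (hr i).
  have [[w hw]|//] := gordan v; exfalso.
  pose S := \sum_k `|w 0 k|.
  have S0 : 0 <= S by apply: sumr_ge0.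
  have S1 : 0 < S + 1 by rewrite ltr_wpDl.
  pose e i := - dot (v i) w / (S + 1).
  have e0 i : 0 < e i by rewrite divr_gt0// oppr_gt0.
  have /choice[d hd] : forall i, exists d : R, 0 < d /\ forall z, hypersurface f z ->
      cbox (p i) d z -> - (e i * \sum_k `|lg z k - x 0 k|) <= dot (v i) (Log z - x).
    by move=> i; have [h _] := bb i; have [d d0 hd] := h (e i) (e0 i); exists d.
  have frp : fibre f x `<=` range p by rewrite rp.
  have [q q0 hq] := fibre_cover frp (fun i => (hd i).1).
  have [r r0 hr] := (nbhs_rboxP x (amoeba f)).1 hi.
  have [|t t0 /= /and3P[tq tr _]] := @small_radius R [:: (S, q); (S, r)].
    by rewrite /= q0 r0.
  have wS k : `|t * w 0 k| <= S * t.
    rewrite normrM gtr0_norm// mulrC ler_pM2r// /S (bigD1 k)//= lerDl sumr_ge0//.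
  have xtw k : (x + t *: w) 0 k - x 0 k = t * w 0 k by rewrite !mxE; ring.
  have [|z hz lz] := hr (x + t *: w).
    by move=> k; rewrite xtw (le_trans (wS k)).
  have lzk k : lg z k - x 0 k = t * w 0 k.
    by rewrite -LogE lz xtw.
  have [|i bz] := hq z hz.
    by move=> k; rewrite lzk (le_trans (wS k)).
  have := (hd i).2 z hz bz; rewrite lz [X in dot _ X]addrC addKr.
  have -> : dot (v i) (t *: w) = t * dot (v i) w by rewrite dotC dotZl dotC.
  have -> : \sum_k `|lg z k - x 0 k| = t * S.
    by rewrite mulr_sumr; apply: eq_bigr => k _; rewrite lzk normrM gtr0_norm.
  rewrite mulrCA -mulrN ler_pM2l// /e.
  have hwi := hw i; have -> : - (- dot (v i) w / (S + 1) * S) = dot (v i) w * (S / (S + 1)).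
    by field; rewrite gt_eqF.
  rewrite ger_nMr// leNgt => /negP; apply.
  by rewrite ltr_pdivrMr// mul1r ltrDl.
split=> //; rewrite interior_hull; split=> [ni|[]//].
by split=> //; exact: subset_closure.
Qed.
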